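(* Up to conjugacy in $\mathrm{Aut}^*\mathbf A^n$, the torus $D_n^*$ is the unique $(n-1)$-dimensional diagonalizable subgroup of $\mathrm{Aut}^*\mathbf A^n$.
   Context: $k$ is an algebraically closed field of characteristic $0$; $\mathbf A^n$ is affine space over $k$ with standard coordinate functions $x_1,\ldots,x_n$. $\mathrm{Aut}\,\mathbf A^n$ is the group of polynomial automorphisms of $\mathbf A^n$, an element $g$ being written $(g_1,\ldots,g_n)$ with $g_i=g^*(x_i)$; $\mathrm{Jac}(g)=\det(\partial g_i/\partial x_j)$ and $\mathrm{Aut}^*\mathbf A^n=\{g\in\mathrm{Aut}\,\mathbf A^n\mid\mathrm{Jac}(g)=1\}$. A subgroup of $\mathrm{Aut}\,\mathbf A^n$ is called algebraic if it is the image of an algebraic group under a homomorphism to $\mathrm{Aut}\,\mathbf A^n$ for which the action map on $\mathbf A^n$ is a morphism. A diagonalizable subgroup is an algebraic subgroup that is a diagonalizable algebraic group (not necessarily connected). $D_n^*=\{(t_1x_1,\ldots,t_nx_n)\mid t_1,\ldots,t_n\in k,\ t_1\cdots t_n=1\}\subset\mathrm{Aut}^*\mathbf A^n$. *)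

(* Defs.v *)
From HB Require Import structures.
From mathcomp Require Import all_boot all_order all_algebra.
From mathcomp Require Import mpoly.

Set Implicit Arguments.
Unset Strict Implicit.
Unset Printing Implicit Defensive.

Import GRing.Theory.
Local Open Scope ring_scope.

(* Points of A^m are row vectors 'rV[k]_m, and subsets of A^m are predicates. *)

Section PolynomialMaps.
Variable k : closedFieldType.

(* A morphism A^m -> A^n, given by the pullbacks of the n coordinates. *)
Definition polymap (m n : nat) : Type := n.-tuple {mpoly k[m]}.

Definition peval m n (f : polymap m n) (x : 'rV[k]_m) : 'rV[k]_n :=
  \row_i (tnth f i).@[x 0].

(* Composition of maps on points: first f, then g. *)
Definition pcomp m n p (g : polymap n p) (f : polymap m n) : polymap m p :=
  [tuple tnth g i \mPo f | i < p].

Definition pid n : polymap n n := [tuple 'X_i | i < n].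

Definition inverse_pair n (g h : polymap n n) : Prop :=
  pcomp g h = pid n /\ pcomp h g = pid n.

Definition is_aut n (g : polymap n n) : Prop := exists h, inverse_pair g h.

Definition jac n (g : polymap n n) : {mpoly k[n]} :=
  \det (\matrix_(i < n, j < n) (tnth g i)^`M(j)).

Definition is_aut_star n (g : polymap n n) : Prop := is_aut g /\ jac g = 1.

Definition Dstar n (g : polymap n n) : Prop :=
  exists t : 'rV[k]_n,
    \prod_(i < n) t 0 i = 1 /\ g = [tuple t 0 i *: 'X_i | i < n].

Definition conjugate_in_aut_star n (H K : polymap n n -> Prop) : Prop :=
  exists g gi : polymap n n,
    [/\ is_aut_star g, inverse_pair g gi &
        forall f, H f <-> exists2 h, K h & f = pcomp g (pcomp h gi)].

End PolynomialMaps.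

Section Zariski.
Variables (k : closedFieldType) (m : nat).
Implicit Types X Y Z : 'rV[k]_m -> Prop.

Definition subset_of X Y : Prop := forall x, X x -> Y x.

Definition zariski_closed X : Prop :=
  exists I : {mpoly k[m]} -> Prop,
    forall x, X x <-> (forall p, I p -> p.@[x 0] = 0).

Definition irreducible_set X : Prop :=
  (exists x, X x) /\
  forall Y Z, zariski_closed Y -> zariski_closed Z ->
    (forall x, X x -> Y x \/ Z x) -> subset_of X Y \/ subset_of X Z.

(* C 0 < C 1 < ... < C d, strictly increasing irreducible closed sets in X. *)
Definition irreducible_chain X (d : nat) (C : nat -> 'rV[k]_m -> Prop) : Prop :=
  (forall i, (i <= d)%N ->
     [/\ zariski_closed (C i), irreducible_set (C i) & subset_of (C i) X]) /\
  (forall i, (i < d)%N -> subset_of (C i) (C i.+1) /\ ~ subset_of (C i.+1) (C i)).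

(* Krull dimension of a closed set X; for X not closed this would have to be
   phrased with the closed subsets of X in the induced topology. *)
Definition has_dim X (d : nat) : Prop :=
  (exists C, irreducible_chain X d C) /\
  (forall e C, irreducible_chain X e C -> (e <= d)%N).

End Zariski.

Section AlgebraicGroups.
Variable k : closedFieldType.

(* An affine algebraic group, as a closed subset of some A^m whose group law is
   the restriction of polynomial maps; the values of these maps outside of the
   closed subset are irrelevant.  Non-affine algebraic groups are not needed:
   a diagonalizable group is affine. *)
Record alg_group : Type := AlgGroup {
  ag_emb : nat;
  ag_set : 'rV[k]_ag_emb -> Prop;
  ag_one : 'rV[k]_ag_emb;
  ag_mul : polymap k (ag_emb + ag_emb) ag_emb;
  ag_inv : polymap k ag_emb ag_emb;
  ag_op := fun x y => peval ag_mul (row_mx x y);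
  ag_closed : zariski_closed ag_set;
  ag_one_in : ag_set ag_one;
  ag_op_in : forall x y, ag_set x -> ag_set y -> ag_set (ag_op x y);
  ag_inv_in : forall x, ag_set x -> ag_set (peval ag_inv x);
  ag_opA : forall x y z, ag_set x -> ag_set y -> ag_set z ->
    ag_op x (ag_op y z) = ag_op (ag_op x y) z;
  ag_op1g : forall x, ag_set x -> ag_op ag_one x = x;
  ag_opVg : forall x, ag_set x -> ag_op (peval ag_inv x) x = ag_one
}.

Record closed_subgroup (G : alg_group) : Type := ClosedSubgroup {
  cs_set : 'rV[k]_(ag_emb G) -> Prop;
  cs_closed : zariski_closed cs_set;
  cs_sub : forall x, cs_set x -> @ag_set G x;
  cs_one_in : cs_set (ag_one G);
  cs_op_in : forall x y, cs_set x -> cs_set y -> cs_set (@ag_op G x y);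
  cs_inv_in : forall x, cs_set x -> cs_set (peval (ag_inv G) x)
}.

Definition alg_group_of_closed_subgroup (G : alg_group) (K : closed_subgroup G) :
    alg_group :=
  @AlgGroup (ag_emb G) (@cs_set G K) (ag_one G) (ag_mul G) (ag_inv G)
    (cs_closed K) (cs_one_in K) (@cs_op_in G K) (@cs_inv_in G K)
    (fun x y z Kx Ky Kz => ag_opA (cs_sub Kx) (cs_sub Ky) (cs_sub Kz))
    (fun x Kx => ag_op1g (cs_sub Kx))
    (fun x Kx => ag_opVg (cs_sub Kx)).

Definition alg_group_iso (G K : alg_group) : Prop :=
  exists (f : polymap k (ag_emb G) (ag_emb K))
         (h : polymap k (ag_emb K) (ag_emb G)),
  [/\ forall x, ag_set x -> ag_set (peval f x),
      forall y, ag_set y -> ag_set (peval h y),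
      forall x, ag_set x -> peval h (peval f x) = x,
      forall y, ag_set y -> peval f (peval h y) = y &
      forall x y : 'rV_(ag_emb G), ag_set x -> ag_set y ->
        peval f (ag_op x y) = ag_op (peval f x) (peval f y)].

(* The group of invertible diagonal r x r matrices: diag(t_1, ..., t_r) is the
   point (t_1, ..., t_r, t_1^-1, ..., t_r^-1) of A^(r + r). *)
Definition diag_set r (x : 'rV[k]_(r + r)) : Prop :=
  forall i : 'I_r, x 0 (lshift r i) * x 0 (rshift r i) = 1.

Definition diag_mul r : polymap k ((r + r) + (r + r)) (r + r) :=
  [tuple 'X_(lshift (r + r) i) * 'X_(rshift (r + r) i) | i < r + r].

Definition diag_inv r : polymap k (r + r) (r + r) :=
  [tuple match split i with
         | inl j => 'X_(rshift r j)
         | inr j => 'X_(lshift r j)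
         end | i < r + r].

Definition diag_one r : 'rV[k]_(r + r) := const_mx 1.

Lemma diag_mulE r (x y : 'rV[k]_(r + r)) i :
  peval (diag_mul r) (row_mx x y) 0 i = x 0 i * y 0 i.
Proof. by rewrite mxE tnth_mktuple mevalM !mevalXU row_mxEl row_mxEr. Qed.

Lemma diag_invEl r (x : 'rV[k]_(r + r)) j :
  peval (diag_inv r) x 0 (lshift r j) = x 0 (rshift r j).
Proof.
by rewrite mxE tnth_mktuple (unsplitK (inl j : 'I_r + 'I_r)%type) mevalXU.
Qed.

Lemma diag_invEr r (x : 'rV[k]_(r + r)) j :
  peval (diag_inv r) x 0 (rshift r j) = x 0 (lshift r j).
Proof.
by rewrite mxE tnth_mktuple (unsplitK (inr j : 'I_r + 'I_r)%type) mevalXU.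
Qed.

Fact diag_closed r : zariski_closed (@diag_set r).
Proof.
exists (fun p => exists i : 'I_r, p = 'X_(lshift r i) * 'X_(rshift r i) - 1).
move=> x; split=> [Dx p [i ->]|Dx i].
  by rewrite mevalB mevalM !mevalXU meval1 Dx subrr.
apply/eqP; rewrite -subr_eq0; apply/eqP.
have := Dx _ (ex_intro _ i erefl).
by rewrite mevalB mevalM !mevalXU meval1.
Qed.

Fact diag_one_in r : @diag_set r (diag_one r).
Proof. by move=> i; rewrite !mxE mulr1. Qed.

Fact diag_op_in r (x y : 'rV[k]_(r + r)) : diag_set x -> diag_set y ->
  diag_set (peval (diag_mul r) (row_mx x y)).
Proof. by move=> Dx Dy i; rewrite !diag_mulE mulrACA Dx Dy mulr1. Qed.

Fact diag_inv_in r (x : 'rV[k]_(r + r)) : diag_set x ->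
  diag_set (peval (diag_inv r) x).
Proof. by move=> Dx i; rewrite diag_invEl diag_invEr mulrC Dx. Qed.

Fact diag_opA r (x y z : 'rV[k]_(r + r)) :
    diag_set x -> diag_set y -> diag_set z ->
  peval (diag_mul r) (row_mx x (peval (diag_mul r) (row_mx y z))) =
  peval (diag_mul r) (row_mx (peval (diag_mul r) (row_mx x y)) z).
Proof. by move=> _ _ _; apply/rowP=> i; rewrite !diag_mulE mulrA. Qed.

Fact diag_op1g r (x : 'rV[k]_(r + r)) : diag_set x ->
  peval (diag_mul r) (row_mx (diag_one r) x) = x.
Proof. by move=> _; apply/rowP=> i; rewrite diag_mulE mxE mul1r. Qed.

Fact diag_opVg r (x : 'rV[k]_(r + r)) : diag_set x ->
  peval (diag_mul r) (row_mx (peval (diag_inv r) x) x) = diag_one r.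
Proof.
move=> Dx; apply/rowP=> i; rewrite diag_mulE [RHS]mxE -[i]splitK.
by case: (split i) => j /=; rewrite ?diag_invEl ?diag_invEr // mulrC.
Qed.

Definition diag_group r : alg_group :=
  @AlgGroup (r + r) (@diag_set r) (diag_one r) (diag_mul r) (diag_inv r)
    (@diag_closed r) (@diag_one_in r) (@diag_op_in r) (@diag_inv_in r)
    (@diag_opA r) (@diag_op1g r) (@diag_opVg r).

Definition diagonalizable_group (G : alg_group) : Prop :=
  exists r (K : closed_subgroup (diag_group r)),
    alg_group_iso G (alg_group_of_closed_subgroup K).

End AlgebraicGroups.

Section AlgebraicSubgroups.
Variables (k : closedFieldType) (n : nat).
Implicit Types (G : alg_group k) (H : polymap k n n -> Prop).

(* phi is a homomorphism G -> Aut A^n such that the action map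
   G x A^n -> A^n, (x, a) |-> phi(x)(a), is a morphism. *)
Definition algebraic_hom G (phi : 'rV[k]_(ag_emb G) -> polymap k n n) : Prop :=
  [/\ forall x, ag_set x -> is_aut (phi x),
      forall x y, ag_set x -> ag_set y ->
        phi (ag_op x y) = pcomp (phi x) (phi y) &
      exists F : polymap k (ag_emb G + n) n,
        forall x a, ag_set x -> peval (phi x) a = peval F (row_mx x a)].

Definition image_of G (phi : 'rV[k]_(ag_emb G) -> polymap k n n) H : Prop :=
  forall g, H g <-> exists2 x, ag_set x & g = phi x.

(* H is an algebraic subgroup whose structure of algebraic group is that of G:
   phi identifies G with H.  In characteristic 0 this structure on H is unique
   up to isomorphism, and it is G' / ker phi' whenever H is the image of
   phi' : G' -> Aut A^n. *)
Definition algebraic_subgroup_iso H G : Prop :=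
  exists phi, [/\ @algebraic_hom G phi, image_of phi H &
    forall x y, ag_set x -> ag_set y -> phi x = phi y -> x = y].

Definition diagonalizable_subgroup_of_dim H (d : nat) : Prop :=
  exists G, [/\ algebraic_subgroup_iso H G, diagonalizable_group G &
                has_dim (@ag_set k G) d].

End AlgebraicSubgroups.

(* Main.v *)
(* Let a diagonalizable group K of dimension n - 1 act on A^n with Jacobian 1,
   and grade A = k[x] by the characters of K; the volume form has weight 0.
   Contracting it with the Lie algebra of K gives the differential df of a
   nonconstant invariant f.  The weight 0 component D of the Euler
   field satisfies D f = (deg f) f; decomposing invariants into eigenvectors of D
   and comparing orders of vanishing at a zero of f shows that the invariants
   are k[f].  Each weight space is then free of rank 1 over k[f], and the
   logarithmic derivatives of semi-invariants have no pole outside f = 0, which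
   yields a fixed point a on f = 0.  Semi-invariants g_1, ..., g_n which are local
   coordinates at a have a product proportional to f and generate A, so the
   action is diagonal in the coordinates g_i, which can be rescaled to have
   Jacobian 1.  Conversely, characters extend along inclusions of lattices because
   k^* is divisible, so K fills the whole torus D_n^*. *)
Require Import Defs.
From HB Require Import structures.
From mathcomp Require Import all_boot all_order all_algebra.
From mathcomp Require Import perm ring_quotient mpoly ring zify.
From Stdlib Require Import Classical ClassicalEpsilon.

Set Implicit Arguments.
Unset Strict Implicit.
Unset Printing Implicit Defensive.

Import Order.TTheory GRing.Theory.
Local Open Scope ring_scope.
(* ssrfun also defines a pcomp. *)
Local Notation pcomp := Defs.pcomp.

(** * Polynomial maps and Jacobians *)

(** The Lie algebra of K is never constructed. It appears as n - 1 additive functions [dl j] on the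
    weights, each giving the derivation that multiplies a weight vector by a scalar; n - 1 is the
    number of vector fields that contracts a volume form to a 1-form. The action is only known to be
    polynomial, so the degree need not be compatible with the weights. Projecting the Euler field to
    weight 0 repairs this: the projection multiplies f by n, and D is this projection rescaled by
    deg f / n, so that the eigenvalue of an invariant eigenvector is its degree. Since K may be
    disconnected, its character group may have torsion, and a weight is comparable with the weights
    of the coordinates only after multiplication by some N > 0; hence the N-th powers and roots in
    the final step. A vanishing order at a point is refined to an exponent vector, which separates
    the n coordinates and recovers each semi-invariant as a monomial in them. *)

Section PolynomialAlgebra.
Variables (R : comNzRingType) (n : nat).

Lemma mpoly_alg_ind (P : {mpoly R[n]} -> Prop) :
  (forall c, P c%:MP) -> (forall i, P 'X_i) ->
  (forall p q, P p -> P q -> P (p + q)) ->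
  (forall p q, P p -> P q -> P (p * q)) -> forall p, P p.
Proof.
move=> PC PX PD PM; elim/mpolyind=> [|c m p _ _ Pp]; first exact: (PC 0).
apply: (PD) => //; rewrite -mul_mpolyC; apply: (PM) => //.
rewrite mpolyXE_id; elim/big_ind: _ => [|p1 p2|i _]; [exact: (PC 1)|exact: (PM)|].
by elim: (m i) => [|d IH]; [exact: (PC 1)|rewrite exprS; apply: (PM)].
Qed.

Lemma mpoly_rmorph_eq (S : nzRingType) (f g : {rmorphism {mpoly R[n]} -> S}) :
  (forall c, f c%:MP = g c%:MP) -> (forall i, f 'X_i = g 'X_i) -> f =1 g.
Proof.
move=> eC eX; elim/mpoly_alg_ind=> // p q ep eq.
  by rewrite !rmorphD ep eq.
by rewrite !rmorphM ep eq.
Qed.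

(** A derivation along a ring morphism is determined by its values on the variables. For a
    substitution [f] this is the chain rule; for the identity it turns an operator defined weight by
    weight into a vector field. *)
Lemma mpoly_derivationE (S : comNzRingType) (f : {rmorphism {mpoly R[n]} -> S})
    (D : {mpoly R[n]} -> S) :
  (forall c, D c%:MP = 0) -> {morph D : p q / p + q} ->
  (forall p q, D (p * q) = D p * f q + f p * D q) ->
  forall p, D p = \sum_i f (p^`M(i)) * D 'X_i.
Proof.
move=> DC DD DM; elim/mpoly_alg_ind=> [c|j|p q Ep Eq|p q Ep Eq].
- by rewrite DC big1 // => i _; rewrite mderivC rmorph0 mul0r.
- rewrite (bigD1 j) //= big1 => [|i /negPf ne]; rewrite mderivX mnm1E ?eqxx.
    suff ->: ((U_(j) - U_(j))%MM = 0%MM :> 'X_{1..n}).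
      by rewrite mpolyX0 scale1r rmorph1 mul1r addr0.
    by apply/mnmP=> l; rewrite mnmBE subnn mnm0E.
  by rewrite eq_sym ne scale0r rmorph0 mul0r.
- rewrite DD Ep Eq -big_split /=; apply: eq_bigr => i _.
  by rewrite mderivD rmorphD mulrDl.
- rewrite DM Ep Eq mulr_suml mulr_sumr -big_split /=; apply: eq_bigr => i _.
  by rewrite mderivM rmorphD !rmorphM mulrDl mulrA mulrAC.
Qed.

End PolynomialAlgebra.

(** Isolating the last variable keeps every coefficient; inductions on the number of variables rest
    on this. *)
Lemma mcoeff_muni (R : nzRingType) n (p : {mpoly R[n.+1]}) (m : 'X_{1..n.+1}) :
  (muni p)`_(m ord_max)@_[multinom m (widen_ord (leqnSn n) i) | i < n] = p@_m.
Proof.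
rewrite muniE coef_sum raddf_sum /= {3}(mpolyE p) [RHS]raddf_sum /=.
apply: eq_bigr => m' _; rewrite coefZ coefXn mulr_natr mcoeffMn !mcoeffZ.
rewrite !mcoeffX -mulrnAr -mulrnA mulnb; congr (_ * (_)%:R).
congr nat_of_bool; apply/andP/eqP=> [[/eqP/mnmP e /eqP e']|->]; last by rewrite !eqxx.
apply/mnmP=> i; have [->//|ne] := eqVneq i ord_max.
have lt : (i < n)%N.
  by rewrite ltn_neqAle -ltnS ltn_ord andbT; apply: contraNneq ne => ?; apply/eqP/val_inj.
have -> : i = widen_ord (leqnSn n) (Ordinal lt) by apply/val_inj.
by have := e (Ordinal lt); rewrite !mnmE.
Qed.

(** * Polynomials over a field of characteristic 0 *)

Section CharZero.
Variables (k : fieldType) (char0 : [pchar k] =i pred0).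

Lemma natr_eq0_char0 m : (m%:R == 0 :> k) = (m == 0)%N.
Proof. by move/pcharf0P: char0 => ->. Qed.

Lemma natr_inj_char0 : injective (fun m : nat => m%:R : k).
Proof.
move=> a b; wlog le : a b / (a <= b)%N => [hw e|].
  by case/orP: (leq_total a b) => le; [|symmetry]; apply: hw.
move/eqP; rewrite eq_sym -subr_eq0 -natrB // natr_eq0_char0 subn_eq0 => le'.
by apply/eqP; rewrite eqn_leq le.
Qed.

Lemma poly_nonroot (p : {poly k}) : p != 0 -> exists c, p.[c] != 0.
Proof.
move=> p0; pose s := [seq i%:R : k | i <- iota 0 (size p)].
have us : uniq s by rewrite map_inj_uniq ?iota_uniq //; exact: natr_inj_char0.
have [a|/allPn[c _ ?]] := boolP (all (root p) s); last by exists c.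
by have := max_poly_roots p0 a us; rewrite size_map size_iota ltnn.
Qed.

Lemma meval_muni n (p : {mpoly k[n.+1]}) (v : 'I_n.+1 -> k) :
  p.@[v] = (map_poly (meval (fun i => v (widen_ord (leqnSn n) i))) (muni p)).[v ord_max].
Proof.
rewrite muniE mevalE rmorph_sum /= horner_sum; apply: eq_bigr => m _.
rewrite !map_polyZ /= map_polyXn hornerZ hornerXn mevalZ mevalX.
rewrite big_ord_recr /= mulrA; congr (_ * _ * _).
by apply: eq_bigr => i _; rewrite mnmE.
Qed.

(** Specialize all variables but the last so that one coefficient in the last variable survives,
    then avoid finitely many roots in the infinite field [k]. *)
Lemma mpoly_nonroot n (p : {mpoly k[n]}) : p != 0 -> exists v, p.@[v] != 0.
Proof.
elim: n p => [|n IH] p p0.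
  exists (fun=> 0); rewrite (nvar0_mpolyC p) mevalC.
  by apply: contra_neq p0 => e; rewrite (nvar0_mpolyC p) e.
have [m mp] : exists m, p@_m != 0.
  by exists (mlead p); rewrite mleadc_eq0.
have /IH[v] : (muni p)`_(m ord_max) != 0.
  by apply: contra_neq mp => e; rewrite -mcoeff_muni e mcoeff0.
rewrite -coef_map /= => pv.
have /poly_nonroot[c] : map_poly (meval v) (muni p) != 0.
  by apply: contra_neq pv => ->; rewrite coef0.
move=> pc; exists (fun i => oapp v c (unlift ord_max i)).
rewrite meval_muni unlift_none /=; move: pc; congr (_.[_] != 0).
apply: eq_map_poly => q; apply: meval_eq => i.
suff -> : widen_ord (leqnSn n) i = lift ord_max i by rewrite liftK.
by apply/val_inj; rewrite /= /bump leqNgt ltn_ord.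
Qed.

Lemma mpoly_eq_eval n (p q : {mpoly k[n]}) : (forall v, p.@[v] = q.@[v]) -> p = q.
Proof.
move=> e; apply/eqP; rewrite -subr_eq0; apply/negPn/negP => /mpoly_nonroot[v].
by rewrite mevalB e subrr eqxx.
Qed.

Lemma mderiv_eq0_const n (p : {mpoly k[n]}) : (forall i, p^`M(i) = 0) -> p = (p@_0%MM)%:MP.
Proof.
move=> dp; apply/mpolyP => m; rewrite mcoeffC.
have [->|m0] := eqVneq m 0%MM; first by rewrite mulr1.
rewrite mulr0; have [i mi] : exists i, m i != 0%N.
  apply/existsP; rewrite -negb_forall; apply: contra m0 => /forallP h.
  by apply/eqP/mnmP => i; rewrite mnm0E; apply/eqP.
have := congr1 (mcoeff (m - U_(i))) (dp i); rewrite mcoeff_deriv mcoeff0 submK ?lep1mP //.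
move/eqP; rewrite -mulr_natr mulf_eq0 natr_eq0_char0 orbF.
by move/eqP.
Qed.
End CharZero.

(** * Jacobian matrices and invertible maps *)

Section Jacobian.
Variable k : closedFieldType.

Definition jacmx m n (f : polymap k m n) : 'M[{mpoly k[m]}]_(n, m) :=
  \matrix_(i, j) (tnth f i)^`M(j).

Lemma mderiv_comp m n (p : {mpoly k[n]}) (f : polymap k m n) j :
  (p \mPo f)^`M(j) = \sum_i (p^`M(i) \mPo f) * (tnth f i)^`M(j).
Proof.
pose D q := (q \mPo f)^`M(j).
have -> : (p \mPo f)^`M(j) = D p by [].
rewrite (@mpoly_derivationE _ _ _ (comp_mpoly f) D) /D => [|c|q r|q r].
- by apply: eq_bigr => i _; rewrite comp_mpolyXU -tnth_nth.
- by rewrite comp_mpolyC mderivC.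
- by rewrite comp_mpolyD mderivD.
- by rewrite rmorphM mderivM.
Qed.

Lemma jacmx_comp m n p (g : polymap k n p) (f : polymap k m n) :
  jacmx (pcomp g f) = map_mx (comp_mpoly f) (jacmx g) *m jacmx f.
Proof.
apply/matrixP=> i j; rewrite !mxE tnth_mktuple mderiv_comp.
by apply: eq_bigr => l _; rewrite !mxE.
Qed.

Lemma jac_comp n (g f : polymap k n n) : jac (pcomp g f) = (jac g \mPo f) * jac f.
Proof. by rewrite /jac -!/(jacmx _) jacmx_comp det_mulmx det_map_mx. Qed.

Lemma pcompA m n p q (h : polymap k p q) (g : polymap k n p) (f : polymap k m n) :
  pcomp h (pcomp g f) = pcomp (pcomp h g) f.
Proof.
apply: eq_from_tnth => i; rewrite !tnth_mktuple.
apply: (@mpoly_rmorph_eq _ _ _ (comp_mpoly _) (comp_mpoly f \o comp_mpoly g)) => /= [c|j].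
  by rewrite !comp_mpolyC.
by rewrite !comp_mpolyXU -!tnth_nth tnth_mktuple.
Qed.

Lemma pcomp1f m n (f : polymap k m n) : pcomp (pid k n) f = f.
Proof.
by apply: eq_from_tnth => i; rewrite !tnth_mktuple comp_mpolyXU -tnth_nth.
Qed.

Lemma jac_pid n : jac (pid k n) = 1.
Proof.
rewrite /jac (_ : \matrix_(_, _) _ = 1%:M) ?det1 //.
apply/matrixP=> i j; rewrite !mxE tnth_mktuple mderivX mnm1E.
have [->|_] := eqVneq i j; last by rewrite scale0r.
suff ->: ((U_(j) - U_(j))%MM = 0%MM :> 'X_{1..n}) by rewrite mpolyX0 scale1r.
by apply/mnmP=> l; rewrite mnmBE subnn mnm0E.
Qed.

Lemma comp_mpolyA m n p (q : {mpoly k[p]}) (g : polymap k n p) (f : polymap k m n) :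
  q \mPo g \mPo f = q \mPo pcomp g f.
Proof.
have /(congr1 (fun t => tnth t ord0)) := pcompA [tuple q] g f.
by rewrite !tnth_mktuple.
Qed.

Lemma peval_comp m n p (g : polymap k n p) (f : polymap k m n) x :
  peval (pcomp g f) x = peval g (peval f x).
Proof.
apply/rowP=> i; rewrite !mxE tnth_mktuple comp_mpoly_meval.
by apply: meval_eq => j; rewrite mxE.
Qed.

(** The chain rule makes the Jacobian a unit, and units of a polynomial ring are constants because
    degrees add. *)
Lemma inverse_pair_jac n (g h : polymap k n n) : inverse_pair g h ->
  exists2 c, c != 0 & jac g = c%:MP.
Proof.
case=> gh hg; have := jac_comp h g; rewrite hg jac_pid => e.
have /eqP := congr1 (fun p : {mpoly k[n]} => msize p) e.
have : jac g != 0 by apply: contra_eq_neq e => ->; rewrite mulr0 oner_neq0.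
have : jac h \mPo g != 0 by apply: contra_eq_neq e => ->; rewrite mul0r oner_neq0.
move=> h0 g0; rewrite msize1 msizeM //; move: h0 g0.
rewrite -!msize_poly_eq0; case: (msize _) => // a _; case E: (msize _) => [//|[|b]] _.
  by move=> _; have /eqP/msize_poly1P[c c0 ->] := E; exists c.
by rewrite addnS /= addnS.
Qed.

Lemma msize_mderiv n (p : {mpoly k[n]}) i : (msize p^`M(i) <= (msize p).-1)%N.
Proof.
have [->|p0] := eqVneq (p^`M(i)) 0; first by rewrite msize0.
rewrite -mlead_deg //; have := mlead_supp p0.
rewrite mcoeff_msupp mcoeff_deriv => h.
have : (mlead p^`M(i) + U_(i))%MM \in msupp p.
  by rewrite mcoeff_msupp; apply: contra_neq h => ->; rewrite mul0rn.
by move/msize_mdeg_lt; rewrite mdegD mdeg1 addn1; case: (msize p).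
Qed.

(** Jacobian criterion, by induction on the degree of the relation. Differentiating it shows that
    the row of the partial derivatives of [p], composed with [f], is killed by the Jacobian matrix;
    so each partial derivative is a relation of smaller degree. *)
Lemma mpoly_alg_indep n (f : polymap k n n) (p : {mpoly k[n]}) :
  [pchar k] =i pred0 -> jac f != 0 -> p \mPo f = 0 -> p = 0.
Proof.
move=> char0 Jf; have [s] := ubnP (msize p); elim: s p => // s IH p sz pf.
have dp i : p^`M(i) = 0.
  have [->|p0] := eqVneq p 0; first by rewrite mderiv0.
  apply: IH.
    apply: leq_ltn_trans (msize_mderiv p i) _.
    by move: sz p0; rewrite -msize_poly_eq0 ltnS; case: (msize p).
  pose u : 'rV[{mpoly k[n]}]_n := \row_i (p^`M(i) \mPo f).
  have uJ : u *m jacmx f = 0.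
    apply/rowP=> j; rewrite !mxE.
    transitivity ((p \mPo f)^`M(j)); last by rewrite pf mderiv0.
    by rewrite mderiv_comp; apply: eq_bigr => l _; rewrite !mxE.
  have : u *m jacmx f *m \adj (jacmx f) = 0 by rewrite uJ mul0mx.
  rewrite -mulmxA mul_mx_adj mul_mx_scalar => /rowP/(_ i).
  by rewrite !mxE => /eqP; rewrite mulf_eq0 (negPf Jf) => /eqP.
have pc := mderiv_eq0_const char0 dp; move: pf.
by rewrite pc comp_mpolyC => /eqP; rewrite mpolyC_eq0 => /eqP ->.
Qed.
End Jacobian.

(** * Signed maximal minors *)

Section Determinants.
Variable R : comNzRingType.

(** Multilinearity in the rows: [t] picks one summand for each row. *)
Lemma det_sum_rows (I : finType) n (B : I -> 'I_n -> 'I_n -> R) :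
  \det (\matrix_(i, j) \sum_a B a i j) =
  \sum_(t : {ffun 'I_n -> I}) \det (\matrix_(i, j) B (t i) i j).
Proof.
rewrite exchange_big /=; apply: eq_bigr => s _; rewrite -mulr_sumr.
congr (_ * _); transitivity (\prod_i \sum_a B a i (s i)).
  by apply: eq_bigr => i _; rewrite mxE.
rewrite bigA_distr_bigA; apply: eq_bigr => t _.
by apply: eq_bigr => i _; rewrite mxE.
Qed.

Variable m : nat.
Implicit Types N : 'M[R]_(m.+1, m).

(* The coefficients of the linear form v |-> det (v | N), i.e. the contraction of
   the volume form with the columns of N. *)
Definition kap N (l : 'I_m.+1) : R := (-1) ^+ l * \det (row' l N).

Lemma det_row_mx_kap (v : 'cV[R]_m.+1) N :
  \det (row_mx v N : 'M_m.+1) = \sum_l v l 0 * kap N l.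
Proof.
rewrite (expand_det_col _ ord0); apply: eq_bigr => l _.
have e0 : lshift m (0 : 'I_1) = ord0 :> 'I_(1 + m) by apply/val_inj.
have eS (j : 'I_m) : rshift 1 j = lift ord0 j :> 'I_(1 + m) by apply/val_inj.
rewrite -{1}e0 (row_mxEl v N) /cofactor addn0; congr (_ * (_ * \det _)).
by apply/matrixP=> i j; rewrite [LHS]mxE [LHS]mxE [RHS]mxE -eS (row_mxEr v N).
Qed.

(** Both sides are det (B (e_l | N)), computed by expansion along the first column and by
    multiplicativity. *)
Lemma kap_mulmx (B : 'M[R]_m.+1) N l :
  \sum_i B i l * kap (B *m N) i = \det B * kap N l.
Proof.
transitivity (\det (B *m (row_mx (delta_mx l 0 : 'cV[R]_m.+1) N : 'M_m.+1))).
  have -> : B *m (row_mx (delta_mx l 0 : 'cV[R]_m.+1) N : 'M_m.+1) =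
            (row_mx (B *m (delta_mx l 0 : 'cV[R]_m.+1)) (B *m N) : 'M_m.+1).
    exact: (mul_mx_row B (delta_mx l 0 : 'cV[R]_m.+1) N).
  by rewrite det_row_mx_kap; apply: eq_bigr => i _; rewrite -colE mxE.
rewrite det_mulmx det_row_mx_kap (bigD1 l) //= big1 => [|i /negPf ne].
  by rewrite mxE !eqxx mul1r addr0.
by rewrite mxE ne mul0r.
Qed.

Lemma kap_diag (d : 'rV[R]_m.+1) N i :
  kap (diag_mx d *m N) i = (\prod_(l | l != i) d 0 l) * kap N i.
Proof.
rewrite /kap mulrCA; congr (_ * _).
have -> : row' i (diag_mx d *m N) = diag_mx (col' i d) *m row' i N.
  by apply/matrixP=> a b; rewrite !mul_diag_mx !mxE.
rewrite det_mulmx det_diag; congr (_ * _).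
under [RHS]eq_bigl do rewrite eq_sym.
rewrite [RHS](big_mkcond) (bigD1_ord i) //= eqxx mul1r.
by apply: eq_bigr => j _; rewrite neq_lift !mxE.
Qed.

(** The difference of two signed minors is det (e_i - e_0 | N), and the row of ones annihilates this
    matrix. It applies to weights of total 0. *)
Lemma kap_const N : (forall j, \sum_i N i j = 0) -> forall i, kap N i = kap N 0.
Proof.
move=> N0 i; apply/eqP; rewrite -subr_eq0; apply/eqP.
transitivity (\det (row_mx (delta_mx i 0 - delta_mx 0 0 : 'cV[R]_m.+1) N : 'M_m.+1)).
  have E l : \sum_a (delta_mx l 0 : 'cV[R]_m.+1) a 0 * kap N a = kap N l.
    rewrite (bigD1 l) //= big1 => [|a /negPf ne]; first by rewrite mxE !eqxx mul1r addr0.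
    by rewrite mxE ne mul0r.
  rewrite det_row_mx_kap -(E i) -[kap N 0]E -sumrB; apply: eq_bigr => a _.
  by rewrite !mxE mulrBl.
set W := (X in \det X).
have W1 : const_mx 1 *m W = 0 :> 'rV_m.+1.
  transitivity (row_mx (const_mx 1 *m (delta_mx i 0 - delta_mx 0 0)) (const_mx 1 *m N) : 'rV[R]_(1 + m)).
    exact: (mul_mx_row (const_mx 1 : 'rV[R]_m.+1) (delta_mx i 0 - delta_mx 0 0 : 'cV[R]_m.+1) N).
  have -> : const_mx 1 *m N = 0 :> 'rV_m.
    by apply/rowP=> j; rewrite !mxE -[RHS](N0 j); apply: eq_bigr => a _; rewrite mxE mul1r.
  suff -> : const_mx 1 *m (delta_mx i 0 - delta_mx 0 0) = 0 :> 'rV[R]_1 by rewrite row_mx0.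
  by rewrite mulmxBr -!colE; apply/rowP=> j; rewrite !mxE subrr.
have : const_mx 1 *m W *m \adj W = 0 :> 'rV_m.+1 by rewrite W1 mul0mx.
by rewrite -mulmxA mul_mx_adj mul_mx_scalar => /rowP/(_ 0); rewrite !mxE mulr1.
Qed.

(** A row killed by [N] is proportional to the row of signed minors: multiply u (e_i | N) = u_i e_0
    by the adjugate, whose first row consists of these minors. *)
Lemma kap_ker (u : 'rV[R]_m.+1) N i l : u *m N = 0 ->
  u 0 i * kap N l = u 0 l * kap N i.
Proof.
move=> uN; pose W := row_mx (delta_mx i 0 : 'cV[R]_m.+1) N : 'M_m.+1.
have uW : u *m W = u 0 i *: delta_mx 0 0.
  transitivity (row_mx (u *m (delta_mx i 0 : 'cV[R]_m.+1)) (u *m N) : 'rV_m.+1).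
    exact: (mul_mx_row u (delta_mx i 0 : 'cV[R]_m.+1) N).
  rewrite uN -colE; apply/rowP=> j; rewrite !mxE eqxx /=.
  case: splitP => j' jE; rewrite !mxE ?ord1.
    have -> : j = 0 by apply/ord_inj; rewrite jE ord1.
    by rewrite eqxx mulr1.
  by case: (eqVneq j 0) jE => [->//|_ _]; rewrite mulr0.
have detW : \det W = kap N i.
  rewrite det_row_mx_kap (bigD1 i) //= big1 => [|a /negPf ne]; first by rewrite mxE !eqxx mul1r addr0.
  by rewrite mxE ne mul0r.
have := congr1 (mulmx^~ (\adj W)) uW.
rewrite -mulmxA mul_mx_adj mul_mx_scalar detW => /rowP/(_ l).
rewrite -scalemxAl -rowE !mxE mulrC => ->; congr (_ * _).
rewrite /cofactor addn0 /kap; congr (_ * \det _); apply/matrixP=> a b; apply/esym.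
have eS (j : 'I_m) : rshift 1 j = lift ord0 j :> 'I_(1 + m) by apply/val_inj.
by rewrite [LHS]mxE [LHS]mxE [RHS]mxE -eS (row_mxEr (delta_mx i 0 : 'cV[R]_m.+1) N).
Qed.

End Determinants.

Lemma kap_map (R S : comNzRingType) (f : {rmorphism R -> S}) m (N : 'M[R]_(m.+1, m)) i :
  kap (map_mx f N) i = f (kap N i).
Proof. by rewrite /kap rmorphM /= rmorph_sign -map_row' det_map_mx. Qed.

(** * Gradings compatible with the volume form *)

Lemma big_uniq_supp (T : eqType) (V : zmodType) (s t : seq T) (G : T -> V) :
  uniq s -> uniq t -> (forall w, G w != 0 -> w \in s) ->
  (forall w, G w != 0 -> w \in t) -> \sum_(w <- s) G w = \sum_(w <- t) G w.
Proof.
move=> us ut Gs Gt; apply: perm_big_supp; apply: uniq_perm; rewrite ?filter_uniq // => w.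
by rewrite !mem_filter; case: (boolP (G w != 0)) => //= Gw; rewrite Gs ?Gt.
Qed.

(* A grading of k[x] by M for which the volume form dx_1 /\ ... /\ dx_n has weight 0
   (this is gr_jac). *)
Record grading (k : closedFieldType) (n : nat) (M : zmodType) : Type := Grading {
  gr_pi : M -> {mpoly k[n]} -> {mpoly k[n]};
  gr_supp : {mpoly k[n]} -> seq M;
  gr_piD : forall w, {morph gr_pi w : p q / p + q};
  gr_piZ : forall w c p, gr_pi w (c *: p) = c *: gr_pi w p;
  gr_pi_pi : forall w w' p, gr_pi w (gr_pi w' p) = if w == w' then gr_pi w p else 0;
  gr_supp_uniq : forall p, uniq (gr_supp p);
  gr_supp_sum : forall p, p = \sum_(w <- gr_supp p) gr_pi w p;
  gr_pi1 : gr_pi 0 1 = 1;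
  gr_piM : forall w w' p q, gr_pi w p = p -> gr_pi w' q = q ->
    gr_pi (w + w') (p * q) = p * q;
  gr_jac : forall (y : polymap k n n) (w : 'I_n -> M),
    (forall i, gr_pi (w i) (tnth y i) = tnth y i) ->
    gr_pi (\sum_i w i) (jac y) = jac y
}.

Section Operators.
Variables (k : closedFieldType) (n : nat) (M : zmodType) (Gr : grading k n M).
Implicit Types (p q : {mpoly k[n]}) (w : M).
Notation gpi := (gr_pi Gr).
Notation supp := (gr_supp Gr).

Definition has_wt w p := gpi w p = p.

Lemma pi0 w : gpi w 0 = 0.
Proof. by have := gr_piZ Gr w 0 0; rewrite !scale0r. Qed.

Lemma pi_sum w (I : Type) (s : seq I) (P : pred I) (F : I -> {mpoly k[n]}) :
  gpi w (\sum_(i <- s | P i) F i) = \sum_(i <- s | P i) gpi w (F i).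
Proof. exact: (big_morph (gpi w) (gr_piD Gr w) (pi0 w)). Qed.

Lemma piN w p : gpi w (- p) = - gpi w p.
Proof. by rewrite -scaleN1r gr_piZ scaleN1r. Qed.

Lemma wt_pi w p : has_wt w (gpi w p).
Proof. by rewrite /has_wt gr_pi_pi eqxx. Qed.

Lemma wt_pi_ne w w' p : has_wt w p -> gpi w' p = if w' == w then p else 0.
Proof. by move=> <-; rewrite gr_pi_pi; case: eqP => // ->. Qed.

Lemma wt0 w : has_wt w 0. Proof. exact: pi0. Qed.
Lemma wt1 : has_wt 0 1. Proof. exact: gr_pi1. Qed.

Lemma wtD w p q : has_wt w p -> has_wt w q -> has_wt w (p + q).
Proof. by rewrite /has_wt gr_piD => -> ->. Qed.

Lemma wtZ w c p : has_wt w p -> has_wt w (c *: p).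
Proof. by rewrite /has_wt gr_piZ => ->. Qed.

Lemma wtN w p : has_wt w p -> has_wt w (- p).
Proof. by rewrite /has_wt piN => ->. Qed.

Lemma wtB w p q : has_wt w p -> has_wt w q -> has_wt w (p - q).
Proof. by move=> hp hq; apply: wtD hp _; apply: wtN. Qed.

Lemma wtM w w' p q : has_wt w p -> has_wt w' q -> has_wt (w + w') (p * q).
Proof. exact: gr_piM. Qed.

Lemma wtC c : has_wt 0 c%:MP.
Proof. by rewrite -[c]mulr1 mpolyCM mul_mpolyC; apply: wtZ; rewrite mpolyC1; apply: wt1. Qed.

Lemma wtX w p d : has_wt w p -> has_wt (w *+ d) (p ^+ d).
Proof.
move=> hp; elim: d => [|d IH]; first exact: wt1.
by rewrite exprS mulrS; apply: wtM.
Qed.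

Lemma wt_sum w (I : Type) (s : seq I) (P : pred I) (F : I -> {mpoly k[n]}) :
  (forall i, P i -> has_wt w (F i)) -> has_wt w (\sum_(i <- s | P i) F i).
Proof. by move=> h; rewrite /has_wt pi_sum; apply: eq_bigr => i /h. Qed.

Lemma wt_prod (I : Type) (s : seq I) (P : pred I) (F : I -> {mpoly k[n]}) (W : I -> M) :
  (forall i, P i -> has_wt (W i) (F i)) ->
  has_wt (\sum_(i <- s | P i) W i) (\prod_(i <- s | P i) F i).
Proof.
by move=> h; elim/big_rec2: _ => [|i w p /h hi hp]; [exact: wt1|exact: wtM].
Qed.

Lemma wt_uniq w w' p : has_wt w p -> has_wt w' p -> p != 0 -> w = w'.
Proof.
move=> hp hp'; apply: contra_neq_eq => ne.
by rewrite -hp' (wt_pi_ne _ hp) eq_sym (negPf ne).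
Qed.

Lemma supp_mem p w : gpi w p != 0 -> w \in supp p.
Proof.
apply: contraR => nw; rewrite [p](gr_supp_sum Gr) pi_sum big_seq big1 // => w' w's.
by rewrite gr_pi_pi; case: eqP => // e; rewrite e w's in nw.
Qed.

Lemma pi_sumE p (s : seq M) : uniq s -> (forall w, gpi w p != 0 -> w \in s) ->
  p = \sum_(w <- s) gpi w p.
Proof.
move=> us hs; rewrite {1}[p](gr_supp_sum Gr); apply: big_uniq_supp => //.
  exact: gr_supp_uniq.
exact: supp_mem.
Qed.

Section Op.
Variable F : M -> {mpoly k[n]} -> {mpoly k[n]}.
Hypothesis FD : forall w, {morph F w : p q / p + q}.

Let F0 w : F w 0 = 0.
Proof. by apply: (@addrI _ (F w 0)); rewrite -FD !addr0. Qed.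

(** If the [F w] are additive and obey the Leibniz rule on homogeneous factors, this is a
    derivation. Both the Lie algebra and the weight 0 part of the Euler field are obtained in this
    way. *)
Definition grop p := \sum_(w <- supp p) F w (gpi w p).

Lemma gropE p (s : seq M) : uniq s -> (forall w, gpi w p != 0 -> w \in s) ->
  grop p = \sum_(w <- s) F w (gpi w p).
Proof.
have h w : F w (gpi w p) != 0 -> gpi w p != 0.
  by apply: contra_neq => ->; apply: F0.
move=> us hs; apply: big_uniq_supp => //; first exact: gr_supp_uniq.
  by move=> w /h /supp_mem.
by move=> w /h /hs.
Qed.

Lemma grop_wt w p : has_wt w p -> grop p = F w p.
Proof.
move=> hp; rewrite (@gropE p [:: w]) //.
  by rewrite big_seq1 hp.
by move=> w'; rewrite (wt_pi_ne _ hp) inE; case: (w' == w); rewrite ?eqxx.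
Qed.

Lemma gropD : {morph grop : p q / p + q}.
Proof.
move=> p q; pose s := undup (supp p ++ supp q).
have us : uniq s by exact: undup_uniq.
have sp w : gpi w p != 0 -> w \in s by move/supp_mem => h; rewrite mem_undup mem_cat h.
have sq w : gpi w q != 0 -> w \in s by move/supp_mem => h; rewrite mem_undup mem_cat h orbT.
rewrite (gropE us sp) (gropE us sq) (gropE (s := s)) //.
  by rewrite -big_split; apply: eq_bigr => w _ /=; rewrite gr_piD FD.
move=> w; rewrite gr_piD => h; have [e|/sp//] := eqVneq (gpi w p) 0.
by apply: sq; rewrite e add0r in h.
Qed.

Lemma grop0 : grop 0 = 0.
Proof. by rewrite (grop_wt (wt0 0)) F0. Qed.

Lemma grop_sum (I : Type) (s : seq I) (P : pred I) (G : I -> {mpoly k[n]}) :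
  grop (\sum_(i <- s | P i) G i) = \sum_(i <- s | P i) grop (G i).
Proof. exact: (big_morph grop gropD grop0). Qed.

Hypothesis FM : forall w w' p q, has_wt w p -> has_wt w' q ->
  F (w + w') (p * q) = F w p * q + p * F w' q.

Lemma gropM p q : grop (p * q) = grop p * q + p * grop q.
Proof.
transitivity (\sum_(w <- supp p) \sum_(w' <- supp q) grop (gpi w p * gpi w' q)).
  rewrite {1}[p](gr_supp_sum Gr) mulr_suml grop_sum; apply: eq_bigr => w _.
  by rewrite {1}[q](gr_supp_sum Gr) mulr_sumr grop_sum.
transitivity (\sum_(w <- supp p) \sum_(w' <- supp q)
    (F w (gpi w p) * gpi w' q + gpi w p * F w' (gpi w' q))).
  apply: eq_bigr => w _; apply: eq_bigr => w' _.
  by rewrite (grop_wt (wtM (wt_pi _ _) (wt_pi _ _))) FM //; apply: wt_pi.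
under eq_bigr do rewrite big_split /= -!mulr_sumr -gr_supp_sum.
by rewrite big_split /= -!mulr_suml -gr_supp_sum.
Qed.

Hypothesis F1 : F 0 1 = 0.
Hypothesis FZ : forall c p, F 0 (c *: p) = c *: F 0 p.

Lemma grop_derivE p : grop p = \sum_i p^`M(i) * grop 'X_i.
Proof.
apply: (@mpoly_derivationE _ _ _ idfun) => [c||] /=; [|exact: gropD|exact: gropM].
by rewrite (grop_wt (wtC c)) -[c%:MP]mulr1 mul_mpolyC FZ F1 scaler0.
Qed.

End Op.
End Operators.

Lemma mderiv_prod (R : comNzRingType) n (I : eqType) (s : seq I) (F : I -> {mpoly R[n]}) l :
  uniq s -> (\prod_(i <- s) F i)^`M(l) =
    \sum_(i <- s) (F i)^`M(l) * \prod_(j <- s | j != i) F j.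
Proof.
elim: s => [|a s IH] /=; first by rewrite !big_nil mderivC.
case/andP=> a_s /IH{}IH; rewrite !big_cons mderivM IH; congr (_ + _).
  congr (_ * _); rewrite eqxx /= big_seq [RHS]big_seq_cond.
  apply: eq_bigl => i; case: (boolP (i \in s)) => //= i_s; apply/esym.
  by apply: contraNneq a_s => <-.
rewrite mulr_sumr [LHS]big_seq [RHS]big_seq; apply: eq_bigr => i i_s.
rewrite big_cons ifT 1?mulrCA //.
by apply: contraNneq a_s => ->.
Qed.

(** * Vector fields acting by a scalar on each weight *)

Section WeightFields.
Variables (k : closedFieldType) (n : nat) (M : zmodType) (Gr : grading k n M).
Variables (p : nat) (dl : 'I_p -> M -> k).
Hypothesis dlD : forall j w w', dl j (w + w') = dl j w + dl j w'.
Notation A := {mpoly k[n]}.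
Notation has_wt := (has_wt Gr).
Notation gpi := (gr_pi Gr).

Lemma dl0 j : dl j 0 = 0.
Proof. by apply: (@addrI _ (dl j 0)); rewrite -dlD !addr0. Qed.

Lemma dl_sum j (I : Type) (s : seq I) (P : pred I) (w : I -> M) :
  dl j (\sum_(i <- s | P i) w i) = \sum_(i <- s | P i) dl j (w i).
Proof. exact: (big_morph (dl j) (dlD j) (dl0 j)). Qed.

(* Column j is the vector field of the derivation acting on weight w by dl j w. *)
Definition vfield : 'M[A]_(n, p) :=
  \matrix_(l, j) grop Gr (fun w q => dl j w *: q) 'X_l.

(** Pairing of the weights with the [dl j], which play the role of a basis of the Lie algebra. *)
Definition wmx (w : 'I_n -> M) : 'M[k]_(n, p) := \matrix_(i, j) dl j (w i).

Lemma vfield_wt w q j : has_wt w q ->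
  \sum_l q^`M(l) * vfield l j = dl j w *: q.
Proof.
move=> hq; pose F w (q : A) := dl j w *: q.
have FD v : {morph F v : p q / p + q} by move=> a b; rewrite /F scalerDr.
rewrite -[RHS]/(F w q) -(grop_wt FD hq) (grop_derivE FD).
- by apply: eq_bigr => l _; rewrite mxE.
- by move=> v v' a b _ _; rewrite /F dlD scalerDl scalerAl scalerAr.
- by rewrite /F dl0 scale0r.
- by move=> c a; rewrite /F dl0 !scale0r scaler0.
Qed.

Section Tuple.
Variables (y : polymap k n n) (w : 'I_n -> M).
Hypothesis hy : forall i, has_wt (w i) (tnth y i).

Lemma jacmx_vfield : jacmx y *m vfield =
  diag_mx (\row_i tnth y i) *m map_mx (@mpolyC n k) (wmx w).
Proof.
apply/matrixP=> i j; rewrite mul_diag_mx !mxE mulrC mul_mpolyC -(vfield_wt _ (hy i)).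
by apply: eq_bigr => l _; rewrite !mxE.
Qed.

Hypothesis dl_faithful : forall c : 'cV[k]_p,
  (forall i w, gpi w 'X_i != 0 -> \sum_j dl j w * c j 0 = 0) -> c = 0.

(** If [c] kills the weights of [y], the combination of the vector fields with coefficients [c]
    annihilates every entry of [y]. As [jac y] is nonzero this field vanishes, so [c] kills every
    weight occurring in a variable. *)
Lemma wmx_inj (c : 'cV[k]_p) : jac y != 0 -> wmx w *m c = 0 -> c = 0.
Proof.
move=> J0 Nc; pose C := map_mx (@mpolyC n k) c.
have : jacmx y *m (vfield *m C) = 0.
  by rewrite mulmxA jacmx_vfield -mulmxA -map_mxM Nc map_mx0 mulmx0.
move/(congr1 (mulmx (\adj (jacmx y)))).
rewrite (mulmxA (\adj _) (jacmx y)) mul_adj_mx mulmx0 mul_scalar_mx => VC.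
have {}VC l : \sum_j vfield l j * (c j 0)%:MP = 0.
  have J0' : \det (jacmx y) != 0 := J0.
  have /colP/(_ l) := VC; rewrite mxE [RHS]mxE => /eqP; rewrite mulf_eq0 (negPf J0') /=.
  move/eqP => VC0; rewrite -[RHS]VC0 [RHS]mxE; apply: eq_bigr => j _.
  by rewrite [C j 0]mxE.
apply: dl_faithful => i w' hw'; apply/eqP.
have := congr1 (gpi w') (VC i); rewrite pi0 pi_sum.
have -> : \sum_j gpi w' (vfield i j * (c j 0)%:MP) =
    (\sum_j dl j w' * c j 0) *: gpi w' 'X_i.
  rewrite scaler_suml; apply: eq_bigr => j _.
  rewrite mulrC mul_mpolyC gr_piZ mxE mulrC -scalerA; congr (_ *: _).
  rewrite /grop pi_sum (bigD1_seq w' (supp_mem hw') (gr_supp_uniq _ _)) /=.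
  rewrite big1 => [|v /negPf ne]; first by rewrite addr0 gr_piZ gr_pi_pi eqxx.
  by rewrite gr_piZ gr_pi_pi eq_sym ne scaler0.
by move/eqP; rewrite scaler_eq0 (negPf hw') orbF.
Qed.
End Tuple.
End WeightFields.

(** * The contracted volume form and its primitive *)

Section VolumeForm.
Variables (k : closedFieldType) (char0 : [pchar k] =i pred0) (m : nat) (M : zmodType).
Variables (Gr : grading k m.+1 M) (dl : 'I_m -> M -> k).
Hypothesis dlD : forall j w w', dl j (w + w') = dl j w + dl j w'.
Hypothesis dl_faithful : forall c : 'cV[k]_m,
  (forall i w, gr_pi Gr w 'X_i != 0 -> \sum_j dl j w * c j 0 = 0) -> c = 0.
Notation A := {mpoly k[m.+1]}.
Notation has_wt := (has_wt Gr).
Notation gpi := (gr_pi Gr).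
Notation vfield := (vfield Gr dl).
Notation wmx := (wmx dl).

(** For weights of total 0 all signed minors of [wmx w] coincide; this is their common value. *)
Definition cst w := kap (wmx w) 0.

Section Tuple.
Variables (y : polymap k m.+1 m.+1) (w : 'I_m.+1 -> M).
Hypothesis hy : forall i, has_wt (w i) (tnth y i).

(** In the functions [y] the vector fields become constant combinations of the fields y_i d/dy_i.
    Since the weights have total 0, all minors equal [cst w], and the terms add up by the product
    rule to the differential of the product of the y_i. *)
Lemma jac_kap l : \sum_i w i = 0 ->
  jac y * kap vfield l = cst w *: (\prod_i tnth y i)^`M(l).
Proof.
move=> w0; rewrite /jac -/(jacmx y) -kap_mulmx (jacmx_vfield dlD hy).
rewrite mderiv_prod ?index_enum_uniq // scaler_sumr; apply: eq_bigr => i _.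
rewrite kap_diag kap_map mxE kap_const => [|j]; last first.
  by under eq_bigr do rewrite mxE; rewrite -(dl_sum dlD) w0 (dl0 dlD).
rewrite mulrA mulrC mul_mpolyC; congr (_ *: (_ * _)).
by apply: eq_bigr => j _; rewrite mxE.
Qed.

Lemma det_one_wmx : \sum_i w i = 0 ->
  \sum_l kap (wmx w) l = cst w *+ m.+1.
Proof.
move=> w0; rewrite -[m.+1 in RHS]card_ord -sumr_const; apply: eq_bigr => i _.
apply: kap_const => j.
by under eq_bigr do rewrite mxE; rewrite -(dl_sum dlD) w0 (dl0 dlD).
Qed.

End Tuple.

(** All weights occurring in the variables, so that every variable is a sum over one common index
    set. *)
Let s := undup (flatten [seq gr_supp Gr 'X_i | i : 'I_m.+1]).
Let s_uniq : uniq s. Proof. exact: undup_uniq. Qed.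
Let om (a : 'I_(size s)) : M := nth 0 s a.

Let s_supp i w : gpi w 'X_i != 0 -> w \in s.
Proof.
move/supp_mem => h; rewrite mem_undup; apply/flattenP.
by exists (gr_supp Gr 'X_i) => //; apply: map_f; rewrite mem_enum.
Qed.

Let XE i : 'X_i = \sum_a gpi (om a) 'X_i :> A.
Proof.
rewrite {1}(pi_sumE s_uniq (@s_supp i)).
by rewrite (big_nth 0) big_mkord.
Qed.

Let tw := {ffun 'I_m.+1 -> 'I_(size s)}.
Definition tup (t : tw) : polymap k m.+1 m.+1 := [tuple gpi (om (t i)) 'X_i | i < m.+1].
Definition twt (t : tw) i := om (t i).

Let tupP t i : has_wt (twt t i) (tnth (tup t) i).
Proof. by rewrite tnth_mktuple; apply: wt_pi. Qed.

(** Expand the Jacobian of the identity by multilinearity over the choices of one weight component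
    per variable. Each [jac (tup t)] has the total weight of the choice, so only total weight 0
    contributes to the constant 1. *)
Lemma sum_jac_tup : \sum_(t | \sum_i twt t i == 0) jac (tup t) = 1.
Proof.
have e : \sum_t jac (tup t) = 1.
  rewrite -[RHS](@jac_pid k m.+1) /jac.
  transitivity (\det (\matrix_(i, j) \sum_a (gpi (om a) 'X_i : A)^`M(j))).
    rewrite (det_sum_rows (fun a i j => (gpi (om a) 'X_i : A)^`M(j))).
    apply: eq_bigr => t _; congr (\det _); apply/matrixP=> i j.
    by rewrite !mxE tnth_mktuple.
  congr (\det _); apply/matrixP=> i j; rewrite !mxE tnth_mktuple [in RHS]XE.
  by rewrite raddf_sum.
have := congr1 (gpi 0) e; rewrite gr_pi1 pi_sum => e'; rewrite -{}[RHS]e'.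
rewrite big_mkcond; apply: eq_bigr => t _.
have hJ : has_wt (\sum_i twt t i) (jac (tup t)) by apply: gr_jac => i; apply: tupP.
by rewrite (wt_pi_ne _ hJ) eq_sym.
Qed.

(* A primitive of the contraction of the volume form with the vector fields
   (fpol_deriv), read off from the expansion of jac x = 1 into weight components. *)
Definition fpol : A :=
  \sum_(t | \sum_i twt t i == 0) cst (twt t) *: \prod_i tnth (tup t) i.

Lemma fpol_wt : has_wt 0 fpol.
Proof.
apply: wt_sum => t /eqP t0; apply: wtZ; rewrite -t0.
by apply: wt_prod => i _; apply: tupP.
Qed.

Lemma fpol_deriv l : fpol^`M(l) = kap vfield l.
Proof.
rewrite -[RHS]mul1r -sum_jac_tup mulr_suml raddf_sum; apply: eq_bigr => t /eqP t0.
by rewrite (jac_kap (tupP t)) //= mderivZ.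
Qed.

Lemma jac_fpol y w l : (forall i, has_wt (w i) (tnth y i)) -> \sum_i w i = 0 ->
  jac y * fpol^`M(l) = cst w *: (\prod_i tnth y i)^`M(l).
Proof. by move=> hy w0; rewrite fpol_deriv; apply: jac_kap. Qed.

(** The differential of [fpol] applied to the Euler field is det (x | vfield). Expanded by rows over
    the choices of weights, a choice of total weight 0 contributes the sum of [m.+1] equal minors;
    hence the factor, which is the number of variables and not the degree. *)
Lemma pi_euler_fpol : gpi 0 (\sum_i 'X_i * fpol^`M(i)) = fpol *+ m.+1.
Proof.
pose Q (w : 'I_m.+1 -> M) : 'M[A]_(m.+1, 1 + m) :=
  row_mx (const_mx 1) (map_mx (@mpolyC m.+1 k) (wmx w)).
pose B a i j : A := Q (fun=> om a) i j * gpi (om a) 'X_i.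
have -> : \sum_i 'X_i * fpol^`M(i) = \det (row_mx (\col_i 'X_i) vfield : 'M_m.+1).
  by rewrite det_row_mx_kap; apply: eq_bigr => i _; rewrite fpol_deriv mxE.
have -> : row_mx (\col_i 'X_i) vfield = \matrix_(i, j) \sum_a B a i j.
  apply/matrixP=> i j; rewrite [RHS]mxE /B /Q -[j]splitK; case: (split j) => j' /=.
    rewrite row_mxEl mxE [LHS]XE; apply: eq_bigr => a _.
    by rewrite row_mxEl mxE mul1r.
  rewrite row_mxEr mxE (gropE _ s_uniq (@s_supp i)); last first.
    by move=> w a b; rewrite scalerDr.
  rewrite (big_nth 0) big_mkord; apply: eq_bigr => a _.
  by rewrite row_mxEr !mxE mul_mpolyC.
rewrite (det_sum_rows (n := m.+1) B) pi_sum /fpol -sumrMnl [RHS]big_mkcond.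
apply: eq_bigr => t _.
have -> : \det (\matrix_(i, j) B (t i) i j) =
    (\sum_l kap (wmx (twt t)) l) *: \prod_i tnth (tup t) i.
  transitivity (\det (diag_mx (\row_i tnth (tup t) i) *m (Q (twt t) : 'M_m.+1))).
    congr (\det _); apply/matrixP=> i j; rewrite mul_diag_mx !mxE mulrC.
    rewrite tnth_mktuple; congr (_ * _); rewrite /Q.
    by rewrite !mxE; case: splitP => j' _; rewrite !mxE.
  rewrite det_mulmx det_diag det_row_mx_kap mulrC -mul_mpolyC raddf_sum.
  congr (_ * _); first by apply: eq_bigr => l _; rewrite mxE mul1r kap_map.
  by apply: eq_bigr => l _; rewrite mxE.
rewrite gr_piZ (wt_pi_ne _ (wt_prod _ (fun i _ => tupP t i))).
rewrite eq_sym; case: eqP => [t0|_]; last by rewrite scaler0.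
by rewrite det_one_wmx // scalerMnl.
Qed.
(** If the minor vanishes, some nonzero [c] is killed by all rows of [wmx w] except possibly the
    first, hence by the first too because the rows sum to 0. This contradicts [wmx_inj]. *)
Lemma cst_neq0 y w : (forall i, has_wt (w i) (tnth y i)) -> \sum_i w i = 0 ->
  jac y != 0 -> cst w != 0.
Proof.
move=> hy w0 J0; apply/eqP => c0.
have /det0P[c c_n0 cN] : \det (row' 0 (wmx w))^T == 0.
  by move/eqP: c0; rewrite /cst /kap expr0 mul1r det_tr.
have Nc : wmx w *m c^T = 0.
  have rc i : (wmx w *m c^T) (lift 0 i) 0 = 0.
    have /rowP/(_ i) := cN; rewrite mxE [RHS]mxE => <-; rewrite mxE; apply: eq_bigr => j _.
    by rewrite !mxE mulrC.
  apply/colP=> i; have [j ->|->] := unliftP ord0 i; first by rewrite rc mxE.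
  have : \sum_i (wmx w *m c^T) i 0 = 0.
    under eq_bigr do rewrite mxE; rewrite exchange_big big1 //= => j _.
    rewrite -mulr_suml (_ : \sum_i _ = 0) ?mul0r //.
    by under eq_bigr do rewrite mxE; rewrite -(dl_sum dlD) w0 (dl0 dlD).
  rewrite big_ord_recl [X in _ + X]big1 => [|i' _]; last exact: rc.
  by rewrite addr0 => ->; rewrite mxE.
have cT : c^T = 0 by apply: (wmx_inj dlD hy dl_faithful J0 Nc).
by move/eqP: c_n0; apply; apply: trmx_inj; rewrite cT trmx0.
Qed.

(** Take a tuple of total weight 0 with nonzero Jacobian. If df = 0, the product of its entries is a
    nonzero constant by [jac_fpol]; its first entry is then constant and the Jacobian has a zero
    row. *)
Lemma fpol_nonconst : exists l, fpol^`M(l) != 0.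
Proof.
apply/existsP; rewrite -[[exists _, _]]negbK; apply/negP => /existsPn df0.
have [t t0 Jt] : exists2 t, \sum_i twt t i == 0 & jac (tup t) != 0.
  apply/exists_inP; rewrite -[[exists (_ | _), _]]negbK; apply/negP => /exists_inPn J0.
  have /eqP := sum_jac_tup; rewrite big1 => [|t /J0]; last by rewrite negbK => /eqP.
  by rewrite eq_sym oner_eq0.
have c0 := cst_neq0 (tupP t) (eqP t0) Jt.
pose y := tup t; pose P := \prod_i tnth y i.
have dP l : P^`M(l) = 0.
  have := jac_fpol l (tupP t) (eqP t0); have /negPn/eqP -> := df0 l.
  by rewrite mulr0 => /esym/eqP; rewrite scaler_eq0 (negPf c0) => /eqP.
have y_n0 i : tnth y i != 0.
  apply: contraNneq Jt => yi; rewrite /jac (expand_det_row _ i) big1 // => j _.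
  by rewrite mxE yi mderiv0 mul0r.
have P0 : P != 0 by apply/prodf_neq0 => i _; apply: y_n0.
have /eqP := mderiv_eq0_const char0 dP; move: P0.
rewrite /P (bigD1 ord0) //=; set Q := \prod_(_ | _) _ => P0 /eqP e.
have /msize_poly1P[c _ yc] : msize (tnth y ord0) == 1%N.
  have := congr1 (fun p : A => msize p) e; rewrite msizeC.
  move: P0; rewrite mulf_eq0 negb_or => /andP[_ Q0]; rewrite msizeM //.
  move: (y_n0 ord0) Q0; rewrite -!msize_poly_eq0.
  case: (msize (tnth y ord0)) => [|[|a]] // _; case: (msize Q) => // b _.
  by rewrite addnS /=; case: (_ == 0 :> k).
case/negP: Jt; rewrite /jac (expand_det_row _ ord0) big1 // => j _.
by rewrite mxE yc mderivC mul0r.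
Qed.

(** dg annihilates all the vector fields and df consists of their signed minors, so the two are
    proportional by [kap_ker]. *)
Lemma fpol_wronskian g i l : has_wt 0 g ->
  g^`M(i) * fpol^`M(l) = g^`M(l) * fpol^`M(i).
Proof.
move=> hg; pose u : 'rV[A]_m.+1 := \row_i g^`M(i).
have uV : u *m vfield = 0.
  apply/rowP=> j; rewrite !mxE -[RHS](scale0r g) -(dl0 dlD j) -(vfield_wt dlD _ hg).
  by apply: eq_bigr => a _; rewrite mxE.
by have := kap_ker i l uV; rewrite !mxE -!fpol_deriv.
Qed.

End VolumeForm.

(** * The weight 0 part of the Euler field *)

Section EulerDerivation.
Variables (k : closedFieldType) (n : nat) (M : zmodType) (Gr : grading k n M).
Notation A := {mpoly k[n]}.
Notation has_wt := (has_wt Gr).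
Notation gpi := (gr_pi Gr).

Definition euler (p : A) : A := \sum_i 'X_i * p^`M(i).

(* The weight 0 component of the Euler vector field. *)
Definition euler0 (p : A) : A := grop Gr (fun w q => gpi w (euler q)) p.

Lemma eulerD : {morph euler : p q / p + q}.
Proof.
move=> p q; rewrite /euler -big_split; apply: eq_bigr => i _ /=.
by rewrite mderivD mulrDr.
Qed.

Lemma eulerZ c p : euler (c *: p) = c *: euler p.
Proof.
rewrite /euler scaler_sumr; apply: eq_bigr => i _.
by rewrite mderivZ scalerAr.
Qed.

Lemma eulerM p q : euler (p * q) = euler p * q + p * euler q.
Proof.
rewrite /euler mulr_suml mulr_sumr -big_split; apply: eq_bigr => i _ /=.
rewrite mderivM mulrDr; congr (_ + _); first by rewrite mulrA.
by rewrite mulrCA.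
Qed.

Lemma mcoeff_X_mderiv i (p : A) mu : ('X_i * p^`M(i))@_mu = (mu i)%:R * p@_mu.
Proof.
elim/mpolyind: p => [|c nu p _ _ IH]; first by rewrite mderiv0 mulr0 !mcoeff0 mulr0.
rewrite mderivD mulrDr !mcoeffD {}IH mulrDr; congr (_ + _).
rewrite mderivZ mderivX -!scalerAr !mcoeffZ mcoeffX mulrCA.
have [nui0|nui] := eqVneq (nu i) 0%N.
  by rewrite nui0 mul0r; case: (eqVneq nu mu) => [<-|_] /=; rewrite ?nui0 ?mul0r ?mulr0.
rewrite -mpolyXD addmC submK ?lep1mP // mcoeffX.
by case: (eqVneq nu mu) => [->|_]; rewrite ?mulr0.
Qed.

Lemma euler_coeff p mu : (euler p)@_mu = (mdeg mu)%:R * p@_mu.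
Proof.
rewrite raddf_sum mdegE natr_sum mulr_suml; apply: eq_bigr => i _ /=.
exact: mcoeff_X_mderiv.
Qed.

(** Multiplication by a homogeneous element translates weights, and translation is injective. *)
Lemma pi_mul_wt w w' p q : has_wt w' q -> gpi (w + w') (p * q) = gpi w p * q.
Proof.
move=> hq; rewrite {1}[p](gr_supp_sum Gr) mulr_suml pi_sum.
have [ws|ws] := boolP (w \in gr_supp Gr p); last first.
  have -> : gpi w p = 0 by apply/eqP; apply: contraNT ws; apply: supp_mem.
  rewrite mul0r big_seq big1 // => v vs.
  rewrite (wt_pi_ne _ (wtM (wt_pi _ _ _) hq)) ifN //.
  by apply: contraNneq ws => /addIr ->.
rewrite (bigD1_seq w) ?gr_supp_uniq //= big1 => [|v /negPf ne].
  by rewrite addr0; apply: (wtM (wt_pi _ _ _) hq).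
rewrite (wt_pi_ne _ (wtM (wt_pi _ _ _) hq)) ifN //.
by apply: contraFneq ne => /addIr ->.
Qed.

Let F w q := gpi w (euler q).
Let FD w : {morph F w : p q / p + q}.
Proof. by move=> p q; rewrite /F eulerD gr_piD. Qed.

Lemma euler0_pi w p : has_wt w p -> euler0 p = gpi w (euler p).
Proof. by move=> hp; rewrite /euler0 (@grop_wt _ _ _ Gr F FD w p hp). Qed.

Lemma euler0_wt w p : has_wt w p -> has_wt w (euler0 p).
Proof. by move=> hp; rewrite (euler0_pi hp); apply: wt_pi. Qed.

Let FM w w' p q : has_wt w p -> has_wt w' q ->
  F (w + w') (p * q) = F w p * q + p * F w' q.
Proof.
move=> hp hq; rewrite /F eulerM gr_piD pi_mul_wt // [p * _]mulrC addrC.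
by rewrite [in LHS]addrC [w + w']addrC pi_mul_wt // [_ * p]mulrC.
Qed.

Let F1 : F 0 1 = 0.
Proof. by rewrite /F /euler big1 ?pi0 // => i _; rewrite mderivC mulr0. Qed.

Lemma euler0_derivE p : euler0 p = \sum_i p^`M(i) * euler0 'X_i.
Proof. by apply: (@grop_derivE _ _ _ Gr F FD FM F1) => c q; rewrite /F eulerZ gr_piZ. Qed.

End EulerDerivation.

Lemma mleadE (R : nzRingType) n (p : {mpoly R[n]}) b :
  p@_b != 0 -> (forall mu, (b < mu)%O -> p@_mu = 0) -> mlead p = b.
Proof.
move=> pb h; apply: le_anti; rewrite [X in _ && X]msupp_le_mlead ?mcoeff_msupp // andbT.
rewrite leNgt; apply/negP => /h /eqP; rewrite mleadc_eq0 => /eqP p0.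
by rewrite p0 mcoeff0 eqxx in pb.
Qed.

(** * Invariants and local orders of vanishing *)

Section Invariants.
Variables (k : closedFieldType) (char0 : [pchar k] =i pred0) (n : nat) (M : zmodType).
Variables (Gr : grading k n M) (f : {mpoly k[n]}) (D : {mpoly k[n]} -> {mpoly k[n]}).
Notation A := {mpoly k[n]}.
Notation has_wt := (has_wt Gr).
Notation d := (mdeg (mlead f)).
Hypothesis f_wt : has_wt 0 f.
Hypothesis d_gt0 : (0 < d)%N.
Hypothesis f_wronskian : forall g i l, has_wt 0 g ->
  g^`M(i) * f^`M(l) = g^`M(l) * f^`M(i).
Hypothesis DE : forall p, D p = \sum_i p^`M(i) * D 'X_i.
Hypothesis D_wt : forall w p, has_wt w p -> has_wt w (D p).
Hypothesis Df : D f = d%:R *: f.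

Lemma derD : {morph D : p q / p + q}.
Proof.
move=> p q; rewrite !(DE (_ + _)) (DE p) (DE q) -big_split; apply: eq_bigr => i _ /=.
by rewrite mderivD mulrDl.
Qed.

Lemma derZ c p : D (c *: p) = c *: D p.
Proof.
rewrite DE [D p]DE scaler_sumr; apply: eq_bigr => i _.
by rewrite mderivZ scalerAl.
Qed.

Lemma derB p q : D (p - q) = D p - D q.
Proof. by rewrite derD -scaleN1r derZ scaleN1r. Qed.

Lemma der_sum (I : Type) (s : seq I) (P : pred I) (F : I -> A) :
  D (\sum_(i <- s | P i) F i) = \sum_(i <- s | P i) D (F i).
Proof. by apply: (big_morph D derD); have := derZ 0 0; rewrite !scale0r. Qed.

Lemma derM p q : D (p * q) = D p * q + p * D q.
Proof.
rewrite DE (DE p) (DE q) mulr_suml mulr_sumr -big_split; apply: eq_bigr => i _ /=.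
by rewrite mderivM mulrDl mulrAC mulrA.
Qed.

Lemma derX p e : D (p ^+ e.+1) = (p ^+ e * D p) *+ e.+1.
Proof.
elim: e => [|e IH]; first by rewrite expr0 mul1r.
by rewrite exprS derM {}IH mulrnAr mulrA -exprS [D p * _]mulrC -mulrS.
Qed.

Let f_neq0 : f != 0.
Proof. by apply: contraTneq d_gt0 => ->; rewrite mlead0 mdeg0. Qed.

Let d_neq0 : d%:R != 0 :> k.
Proof. by rewrite natr_eq0_char0 // -lt0n. Qed.

(** As dg and df are proportional, [D] and [euler] have the same ratio of values on [g] and [f].
    This carries degree information from [euler] over to [D]. *)
Lemma der_euler g : has_wt 0 g -> D g * euler f = d%:R *: f * euler g.
Proof.
move=> hg; rewrite -Df /euler !mulr_sumr; apply: eq_bigr => l _.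
rewrite !(mulrCA _ 'X_l); congr (_ * _).
rewrite (DE g) (DE f) !mulr_suml; apply: eq_bigr => i _.
by rewrite mulrAC (f_wronskian i l hg); ring.
Qed.

Lemma mlead_euler_le (p : A) : (mlead (euler p) <= mlead p)%O.
Proof.
have [->|e0] := eqVneq (euler p) 0; first by rewrite mlead0 le0m.
apply: msupp_le_mlead; have := mlead_supp e0.
by rewrite !mcoeff_msupp euler_coeff mulf_eq0 negb_or => /andP[].
Qed.

Lemma mlead_euler (p : A) : (0 < mdeg (mlead p))%N -> mlead (euler p) = mlead p.
Proof.
move=> dp; apply: mleadE => [|mu lt]; rewrite euler_coeff.
  rewrite mulf_neq0 ?mleadc_eq0 //; first by rewrite natr_eq0_char0 // -lt0n.
  by apply: contraTneq dp => ->; rewrite mlead0 mdeg0.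
by rewrite (mcoeff_gt_mlead lt) mulr0.
Qed.

(** Compare leading terms in [der_euler]: [euler] multiplies the coefficient of a monomial by its
    degree, and the degree and leading coefficient of [f] cancel. *)
Lemma der_lead g : has_wt 0 g -> g != 0 ->
  (D g)@_(mlead g) = (mdeg (mlead g))%:R * mleadc g /\ (mlead (D g) <= mlead g)%O.
Proof.
move=> hg g0; have E := der_euler hg.
have ef0 : euler f != 0.
  by apply: contraTneq d_gt0 => e0; rewrite -(mlead_euler d_gt0) e0 mlead0 mdeg0.
have le : (mlead (D g) <= mlead g)%O.
  have [->|Dg0] := eqVneq (D g) 0; first by rewrite mlead0 le0m.
  rewrite -(lemc_add2l _ _ (mlead f)) -{1}(mlead_euler d_gt0) -mleadM // E -scalerAl.
  rewrite (le_trans (mleadZ_le _ _)) // (le_trans (mleadM_le _ _)) // addmC lemc_add2l.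
  exact: mlead_euler_le.
split=> //; have := congr1 (mcoeff (mlead g + mlead f)) E.
rewrite mleadcMW //; last by rewrite mlead_euler.
rewrite -scalerAl mcoeffZ [f * _]mulrC mleadcMW ?mlead_euler_le //.
rewrite !euler_coeff => /eqP.
have fn : f@_(mlead f) != 0 by rewrite mleadc_eq0.
move=> /eqP h; apply: (mulIf fn); apply: (mulIf d_neq0); rewrite -[LHS]mulrA [f@_ _ * _]mulrC h.
by ring.
Qed.
(** Leading exponents of invariants lie on one ray: multiply the Wronskian identity by X_i X_l and
    compare the coefficients at the sum of the leading monomials. *)
Lemma lead_prop g i l : has_wt 0 g ->
  (mlead g i * mlead f l = mlead g l * mlead f i)%N.
Proof.
have [->|g0] := eqVneq g 0; first by rewrite mlead0 !mnm0E.
move=> hg; have E : ('X_i * g^`M(i)) * ('X_l * f^`M(l)) =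
    ('X_l * g^`M(l)) * ('X_i * f^`M(i)).
  by rewrite mulrACA (f_wronskian i l hg); ring.
have le j (p : A) : (mlead ('X_j * p^`M(j))%R <= mlead p)%O.
  have [->|e0] := eqVneq ('X_j * p^`M(j)) 0; first by rewrite mlead0 le0m.
  apply: msupp_le_mlead; have := mlead_supp e0.
  by rewrite !mcoeff_msupp mcoeff_X_mderiv mulf_eq0 negb_or => /andP[].
have := congr1 (mcoeff (mlead g + mlead f)) E.
rewrite !mleadcMW // !mcoeff_X_mderiv mulrACA [RHS]mulrACA.
have lc : mleadc g * mleadc f != 0 by rewrite mulf_neq0 // mleadc_eq0.
by move/(mulIf lc); rewrite -!natrM => /(natr_inj_char0 char0).
Qed.

Lemma lead_same g h : has_wt 0 g -> has_wt 0 h ->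
  mdeg (mlead g) = mdeg (mlead h) -> mlead g = mlead h.
Proof.
move=> hg hh e; have E p i : has_wt 0 p ->
    (mlead p i * d = mdeg (mlead p) * mlead f i)%N.
  move=> hp; rewrite !mdegE big_distrr big_distrl /=; apply: eq_bigr => l _.
  exact: lead_prop.
apply/mnmP=> i; apply/eqP; rewrite -(eqn_pmul2r d_gt0) E // E //.
by rewrite e.
Qed.

Definition eigen i h := has_wt 0 h /\ D h = i%:R *: h.

Lemma eigen_deg i h : eigen i h -> h != 0 -> mdeg (mlead h) = i.
Proof.
case=> hh Dh h0; have [+ _] := der_lead hh h0; rewrite Dh mcoeffZ.
have lc : mleadc h != 0 by rewrite mleadc_eq0.
by move/(mulIf lc)/(natr_inj_char0 char0).
Qed.

Lemma eigen_lin i g h c : eigen i g -> eigen i h -> eigen i (g - c *: h).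
Proof.
move=> [hg Dg] [hh Dh]; split; first by apply: wtB => //; apply: wtZ.
by rewrite derB derZ Dg Dh scalerBr !scalerA [c * _]mulrC.
Qed.

(** Eigenvectors for the same [i] share their leading monomial. Cancelling its coefficient leaves an
    eigenvector whose leading monomial would again be the cancelled one, so it is zero. *)
Lemma eigen_unique i g h : eigen i g -> eigen i h -> h != 0 -> exists c, g = c *: h.
Proof.
move=> Eg Eh h0; have lc : mleadc h != 0 by rewrite mleadc_eq0.
exists (g@_(mlead h) / mleadc h); apply/eqP; rewrite -subr_eq0; apply/negPn/negP.
set c := _ / _ => e0; have Ee := eigen_lin c Eg Eh.
have e : mlead (g - c *: h) = mlead h.
  by apply: lead_same; [case: Ee | case: Eh | rewrite (eigen_deg Ee) // (eigen_deg Eh)].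
by move: e0; rewrite -mleadc_eq0 e mcoeffB mcoeffZ mulfVK // subrr eqxx.
Qed.

(** Induction on the degree [e] of [g]: D g - e g has smaller degree, because invariants of equal
    degree share their leading monomial. Dividing its components by i - e and subtracting them from
    [g] leaves an eigenvector for [e]. *)
Lemma eigen_decomp g : has_wt 0 g ->
  exists2 G, forall i, eigen i (G i) & g = \sum_(i < msize g) G i.
Proof.
have [s] := ubnP (msize g); elim: s g => // s IH g sz hg.
have [->|g0] := eqVneq g 0.
  exists (fun=> 0) => [i|]; last by rewrite big1.
  by split; [exact: wt0|have := derZ 0 0; rewrite !scaler0 scale0r].
pose e := mdeg (mlead g); have [lc le] := der_lead hg g0.
pose g1 := D g - e%:R *: g.
have hg1 : has_wt 0 g1 by apply: wtB; [exact: D_wt|exact: wtZ].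
have sg : msize g = e.+1 by rewrite mlead_deg.
have sg1 : (msize g1 <= e)%N.
  have [->|g10] := eqVneq g1 0; first by rewrite msize0.
  rewrite -mlead_deg //.
  have le1 : (mlead g1 <= mlead g)%O.
    apply: le_trans (mleadB_le _ _) _; rewrite leUx le /=.
    exact: mleadZ_le.
  have := lemc_mdeg le1; rewrite leq_eqVlt => /orP[/eqP|//].
  move/(lead_same hg1 hg) => e1; move: g10; rewrite -mleadc_eq0 e1.
  by rewrite mcoeffB lc mcoeffZ subrr eqxx.
have [G EG g1E] : exists2 G, forall i, eigen i (G i) & g1 = \sum_(i < msize g1) G i.
  by apply: IH => //; rewrite sg in sz; apply: leq_ltn_trans sg1 _.
pose c i : k := ((i%:R - e%:R)^-1).
pose h := g - \sum_(i < msize g1) c i *: G i.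
have Eh : eigen e h.
  split.
    by apply: wtB => //; apply: wt_sum => i _; apply: wtZ; case: (EG i).
  have key : g1 = \sum_(i < msize g1) D (c i *: G i) -
      e%:R *: \sum_(i < msize g1) c i *: G i.
    rewrite {1}g1E scaler_sumr -sumrB; apply: eq_bigr => i _.
    rewrite derZ; case: (EG i) => _ ->.
    rewrite !scalerA -scalerBl [e%:R * _]mulrC -mulrBr mulVf ?scale1r //.
    rewrite subr_eq0; apply: contraTneq (ltn_ord i) => /(natr_inj_char0 char0) ->.
    by rewrite -leqNgt.
  have -> : D h = D g - \sum_(i < msize g1) D (c i *: G i) by rewrite derB der_sum.
  have -> : D g = e%:R *: g + g1 by rewrite /g1 addrC subrK.
  by rewrite {1}key /h scalerBr; ring.
exists (fun i => if (i < msize g1)%N then c i *: G i else if i == e then h else 0) => [i|].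
  case: ifP => _; first by case: (EG i) => hG DG; split; [exact: wtZ|rewrite derZ DG !scalerA mulrC].
  case: eqP => [->//|_].
  by split; [exact: wt0|have := derZ 0 0; rewrite !scaler0 scale0r].
rewrite sg big_ord_recr /= ltnNge sg1 /= eqxx /h.
rewrite (big_ord_widen_cond _ xpredT (fun i => c i *: G i) sg1) /=.
rewrite addrC [LHS](_ : g = g - \sum_(i < e | (i < msize g1)%N) c i *: G i +
  \sum_(i < e | (i < msize g1)%N) c i *: G i); last by rewrite subrK.
congr (_ + _); rewrite big_mkcond; apply: eq_bigr => i _.
by case: ifP => // _; rewrite (ltn_eqF (ltn_ord i)).
Qed.

End Invariants.

(** * Valuations at a point by lowest monomials *)

Section LowestMonomial.
Variables (R : idomainType) (n : nat).
Implicit Types p q : {mpoly R[n]}.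

Lemma mlastcM p q : (p * q)@_(mlast p + mlast q) = p@_(mlast p) * q@_(mlast q).
Proof.
have [->|nz_p] := eqVneq p 0; first by rewrite mcoeff0 !mul0r mcoeff0.
have [->|nz_q] := eqVneq q 0; first by rewrite mcoeff0 !mulr0 mcoeff0.
rewrite mpolyME (bigD1_seq (mlast p, mlast q)) /=; first last.
- by rewrite allpairs_uniq => // -[? ?] [].
- by rewrite allpairs_f // !mlast_supp.
rewrite mcoeffD mcoeffZ mcoeffX eqxx mulr1.
rewrite big_seq_cond raddf_sum /= big1 ?addr0 //.
move=> _ /andP[/allpairsP[[m1 m2] /= [m1_in_p m2_in_q ->]] ne_m_lc].
rewrite mcoeffZ mcoeffX.
have le1 := mlast_lemc m1_in_p; have le2 := mlast_lemc m2_in_q.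
case: (eqVneq (m1 + m2)%MM (mlast p + mlast q)%MM) => [e|]; last by rewrite mulr0.
case/eqP: ne_m_lc; move: le1; rewrite le_eqVlt => /orP[/eqP e1|lt1].
  by move/eqP: e; rewrite -e1 eqm_add2l => /eqP ->.
by have := ltmc_le_add lt1 le2; rewrite -e ltxx.
Qed.

Lemma mlastM p q : p != 0 -> q != 0 -> mlast (p * q) = (mlast p + mlast q)%MM.
Proof.
move=> p0 q0; apply: mlastE.
  by rewrite mcoeff_msupp mlastcM mulf_neq0 // -mcoeff_msupp mlast_supp.
move=> mu /msuppM_le /allpairsP[[m1 m2] /= [h1 h2 ->]].
by apply: lem_add; apply: mlast_lemc.
Qed.

Lemma mlastD p q : p != 0 -> (forall mu, q@_mu != 0 -> (mlast p < mu)%O) ->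
  mlast (p + q) = mlast p.
Proof.
move=> p0 h; have q0 : q@_(mlast p) = 0.
  by apply/eqP/negPn/negP => /h; rewrite ltxx.
apply: mlastE; first by rewrite mcoeff_msupp mcoeffD q0 addr0 -mcoeff_msupp mlast_supp.
move=> mu; rewrite mcoeff_msupp mcoeffD => pq.
have [qmu|/h/ltW//] := eqVneq q@_mu 0.
by apply: mlast_lemc; rewrite mcoeff_msupp; rewrite qmu addr0 in pq.
Qed.
End LowestMonomial.

Section LocalValuation.
Variables (k : closedFieldType) (char0 : [pchar k] =i pred0) (n : nat).
Variables (a : 'I_n -> k) (g : polymap k n n).
Hypothesis Ja : (jac g).@[a] != 0.
Notation A := {mpoly k[n]}.
Implicit Types p q : A.

Let J : 'M[k]_n := map_mx (meval a) (jacmx g).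
Let J_unit : J \in unitmx.
Proof. by rewrite unitmxE /J det_map_mx unitfE. Qed.

(* An affine change of coordinates carrying 0 to a, after which the linear
   part of g_j - g_j(a) is the j-th coordinate. *)
Definition lchart : polymap k n n :=
  [tuple (a l)%:MP + \sum_j invmx J l j *: 'X_j | l < n].

Lemma jacmx_lchart : jacmx lchart = map_mx (@mpolyC n k) (invmx J).
Proof.
apply/matrixP=> l i; rewrite !mxE tnth_mktuple mderivD mderivC add0r raddf_sum /=.
rewrite (bigD1 i) //= big1 => [|j /negPf ne]; rewrite mderivZ mderivX mnm1E.
  rewrite eqxx addr0 scale1r (_ : (U_(i) - U_(i))%MM = 0%MM) ?mpolyX0 ?alg_mpolyC //.
  by apply/mnmP=> i'; rewrite mnmBE subnn mnm0E.
by rewrite ne scale0r scaler0.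
Qed.

Definition lpull p := p \mPo lchart.

Lemma lpull_eq0 p : (lpull p == 0) = (p == 0).
Proof.
apply/eqP/eqP=> [|->]; last by rewrite /lpull comp_mpoly0.
apply: (mpoly_alg_indep char0); rewrite /jac -/(jacmx lchart).
have -> : \det (jacmx lchart) = (\det (invmx J))%:MP.
  by rewrite jacmx_lchart det_map_mx.
by rewrite mpolyC_eq0 -unitfE -unitmxE unitmx_inv.
Qed.

Lemma lpullM p q : lpull (p * q) = lpull p * lpull q.
Proof. exact: rmorphM. Qed.

Lemma mcoeff0_eval p : p@_0%MM = p.@[fun=> 0].
Proof.
rewrite mevalE {1}[p]mpolyE raddf_sum /=; apply: eq_bigr => m _.
rewrite mcoeffZ mcoeffX; congr (_ * _); have [->|m0] := eqVneq m 0%MM.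
  by rewrite big1 // => i _; rewrite mnm0E expr0.
have [i mi] : exists i, m i != 0%N.
  apply/existsP; rewrite -negb_forall; apply: contra m0 => /forallP h.
  by apply/eqP/mnmP => i; rewrite mnm0E; apply/eqP.
by rewrite (bigD1 i) //= expr0n (negPf mi) mul0r.
Qed.

Lemma lchart0 q : (q \mPo lchart).@[fun=> 0] = q.@[a].
Proof.
rewrite comp_mpoly_meval; apply: meval_eq => l; rewrite tnth_mktuple.
rewrite mevalD mevalC raddf_sum /= big1 ?addr0 // => j _.
by rewrite mevalZ mevalXU mulr0.
Qed.

Lemma lpull_const p : (lpull p)@_0%MM = p.@[a].
Proof. by rewrite mcoeff0_eval lchart0. Qed.

Lemma lpull_lin p i :
  (lpull p)@_U_(i)%MM = \sum_l (p^`M(l)).@[a] * invmx J l i.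
Proof.
have -> : (lpull p)@_U_(i)%MM = ((lpull p)^`M(i))@_0%MM.
  by rewrite mcoeff_deriv mnm0E addmC addm0.
rewrite mderiv_comp mcoeff0_eval raddf_sum /=; apply: eq_bigr => l _.
rewrite mevalM lchart0; congr (_ * _).
have -> : (tnth lchart l)^`M(i) = jacmx lchart l i by rewrite mxE.
by rewrite jacmx_lchart mxE mevalC.
Qed.

(** A valuation with values in exponent vectors. The monomial order compares degrees first, so on
    nonzero polynomials the total degree of the value is the order of vanishing at [a]; the vector
    moreover tells the n local coordinates apart. *)
Definition lval p := mlast (lpull p).

Lemma lvalM p q : p != 0 -> q != 0 -> lval (p * q) = (lval p + lval q)%MM.
Proof. by move=> p0 q0; rewrite /lval lpullM mlastM ?lpull_eq0. Qed.

Lemma lval_unit p : p.@[a] != 0 -> lval p = 0%MM.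
Proof.
move=> pa; apply: mlastE => [|mu _]; last exact: le0m.
by rewrite mcoeff_msupp lpull_const.
Qed.

Lemma lvalZ c p : c != 0 -> p != 0 -> lval (c *: p) = lval p.
Proof.
move=> c0 p0; rewrite -mul_mpolyC lvalM ?mpolyC_eq0 // lval_unit ?mevalC //.
by rewrite add0m.
Qed.

Lemma lvalX p e : p != 0 -> lval (p ^+ e) = (lval p *+ e)%MM.
Proof.
move=> p0; elim: e => [|e IH]; first by rewrite expr0 lval_unit ?meval1 ?oner_neq0.
by rewrite exprS lvalM ?expf_neq0 // IH mulmS.
Qed.

Lemma lval_prod (I : Type) (s : seq I) (P : pred I) (F : I -> A) :
  (forall i, P i -> F i != 0) ->
  lval (\prod_(i <- s | P i) F i) = (\sum_(i <- s | P i) lval (F i))%MM.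
Proof.
move=> F0; suff [] : \prod_(i <- s | P i) F i != 0 /\
  lval (\prod_(i <- s | P i) F i) = (\sum_(i <- s | P i) lval (F i))%MM by [].
elim/big_rec2: _ => [|i mu p Pi [p0 e]].
  by rewrite oner_neq0 lval_unit ?meval1 ?oner_neq0.
by rewrite lvalM ?F0 // e mulf_neq0 // F0.
Qed.

(** In the chart the linear part of g_j is the single variable X_j. *)
Lemma lval_coord j : (tnth g j).@[a] = 0 -> lval (tnth g j) = U_(j)%MM.
Proof.
move=> gj0.
have lin i : (lpull (tnth g j))@_U_(i)%MM = (j == i)%:R.
  rewrite lpull_lin; have /matrixP/(_ j i) := mulmxV J_unit.
  by rewrite !mxE => <-; apply: eq_bigr => l _; rewrite !mxE.
apply: mlastE; first by rewrite mcoeff_msupp lin eqxx oner_neq0.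
move=> mu; rewrite mcoeff_msupp; case mu1: (mdeg mu) => [|[|e]].
- by have /eqP := mu1; rewrite mdeg_eq0 => /eqP ->; rewrite lpull_const gj0 eqxx.
- by have /eqP/mdeg1P[i /eqP ->] := mu1; rewrite lin; case: (eqVneq j i) => [->|]; rewrite ?eqxx.
- by move=> _; apply/ltW/lt_mdeg_ltmc; rewrite mdeg1 mu1.
Qed.

Lemma lval_smooth p l : p.@[a] = 0 -> (p^`M(l)).@[a] != 0 -> mdeg (lval p) = 1%N.
Proof.
move=> pa dp; have p0 : p != 0 by apply: contraNneq dp => ->; rewrite mderiv0 meval0.
have [i pi] : exists i, (lpull p)@_U_(i)%MM != 0.
  apply/existsP; rewrite -[[exists _, _]]negbK; apply/negP => /existsPn h.
  pose u : 'rV[k]_n := \row_l (p^`M(l)).@[a].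
  have uJ : u *m invmx J = 0.
    apply/rowP=> i; have /negPn/eqP := h i; rewrite lpull_lin => e.
    by rewrite !mxE -[RHS]e; apply: eq_bigr => l' _; rewrite mxE.
  have /rowP/(_ l) : u = 0 by rewrite -[u](mulmxKV J_unit) uJ mul0mx.
  by rewrite !mxE => e; rewrite e eqxx in dp.
have := mlast_lemc (m := U_(i)%MM) (p := lpull p); rewrite mcoeff_msupp => /(_ pi).
move/lemc_mdeg; rewrite mdeg1 -/(lval p); case E : (mdeg _) => [|[|//]] // _.
move/eqP: E; rewrite mdeg_eq0 => /eqP e; have : lpull p != 0 by rewrite lpull_eq0.
by move/mlast_supp; rewrite -/(lval p) e mcoeff_msupp lpull_const pa eqxx.
Qed.

Lemma lval_dom p q : p != 0 -> (forall mu, (lpull q)@_mu != 0 -> (lval p < mu)%O) ->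
  lval (p + q) = lval p.
Proof.
move=> p0 h; rewrite /lval /lpull rmorphD; apply: mlastD => //.
by rewrite -/(lpull p) lpull_eq0.
Qed.

Lemma lval_gt0 p : p != 0 -> p.@[a] = 0 -> (0 < mdeg (lval p))%N.
Proof.
move=> p0 pa; rewrite lt0n mdeg_eq0; apply/eqP => e.
have : lpull p != 0 by rewrite lpull_eq0.
by move/mlast_supp; rewrite -/(lval p) e mcoeff_msupp lpull_const pa eqxx.
Qed.

End LocalValuation.

(** * Consequences of algebraic closedness *)

Section ClosedField.
Variables (k : closedFieldType) (char0 : [pchar k] =i pred0).

(** Restrict [f] to a line through two points where its values differ and take a root of the
    resulting nonconstant polynomial minus [c]. *)
Lemma nonconst_surj n (f : {mpoly k[n]}) c : (0 < mdeg (mlead f))%N ->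
  exists v, f.@[v] = c.
Proof.
move=> df; have [v fv] : exists v, f.@[v] != c.
  have /(mpoly_nonroot char0)[v] : f - c%:MP != 0.
    by apply: contraTneq df => /eqP; rewrite subr_eq0 => /eqP ->; rewrite mleadC mdeg0.
  by rewrite mevalB mevalC subr_eq0; exists v.
have [w fw] : exists w, f.@[w] != f.@[v].
  have /(mpoly_nonroot char0)[w] : f - (f.@[v])%:MP != 0.
    by apply: contraTneq df => /eqP; rewrite subr_eq0 => /eqP ->; rewrite mleadC mdeg0.
  by rewrite mevalB mevalC subr_eq0; exists w.
pose q := mmap polyC (fun i => (v i)%:P + (w i - v i)%:P * 'X) f.
have qE t : q.[t] = f.@[fun i => v i + (w i - v i) * t].
  rewrite /q; pose F := horner_eval t \o mmap polyC (fun i => (v i)%:P + (w i - v i)%:P * 'X).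
  apply: (mpoly_rmorph_eq (f := F)) => [b|i] /=.
    by rewrite /horner_eval mmapC hornerC mevalC.
  by rewrite /horner_eval mmapX mmap1U mevalXU !hornerE.
have q0 : q.[0] = f.@[v] by rewrite qE; apply: meval_eq => i; rewrite mulr0 addr0.
have q1 : q.[1] = f.@[w] by rewrite qE; apply: meval_eq => i; rewrite mulr1 addrC subrK.
have /closed_rootP[t] : size (q - c%:P) != 1%N.
  apply/negP => /eqP /eqP/size_poly1P[b _ qb].
  have qbE t : q.[t] = b + c.
    by rewrite -[q](subrK c%:P) qb !hornerE.
  by rewrite -q0 -q1 !qbE eqxx in fw.
rewrite /root !hornerE subr_eq0 qE => /eqP <-; by exists (fun i => v i + (w i - v i) * t).
Qed.

(** After the exact power of X is split off, the cofactor [V] is prime to X and divides its own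
    derivative. This derivative has smaller degree, so it is 0 and [V] is constant in characteristic
    0. *)
Lemma poly_dvd_Xderiv (U : {poly k}) : U != 0 -> U %| 'X * U^`() ->
  exists2 c, c != 0 & exists j, U = c *: 'X^j.
Proof.
move=> U0; have [j [V]] := multiplicity_XsubC U 0; rewrite U0 polyC0 subr0 /= => V0 UE.
have Xd : 'X * ('X^j)^`() = 'X^j *+ j :> {poly k}.
  by rewrite derivXn mulrnAr; case: (j) => [|e]; rewrite ?mulr0n // -exprS.
have -> : 'X * U^`() = ('X * V^`() + V *+ j) * 'X^j.
  by rewrite UE derivM mulrDr ['X * (V * _)]mulrCA Xd mulrDl mulrnAl mulrnAr mulrA.
rewrite {1}UE dvdp_mul2r ?expf_neq0 ?polyX_eq0 //.
rewrite dvdp_addl; last by rewrite -mulr_natr dvdp_mulr.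
rewrite Gauss_dvdpr ?coprimepX // => dV.
have Vn0 : V != 0 by apply: contraNneq V0 => ->; rewrite root0.
have V'0 : V^`() = 0.
  apply/eqP/negPn/negP => V'0; have := dvdp_leq V'0 dV.
  by rewrite leqNgt lt_size_deriv.
suff VE : V = (V`_0)%:P.
  exists V`_0; last by exists j; rewrite -mul_polyC -VE.
  by apply: contra_neq Vn0 => e; rewrite VE e.
apply/polyP=> i; rewrite coefC; case: i => [|i] //=.
have := congr1 (fun p : {poly k} => p`_i) V'0; rewrite coef_deriv coef0 => /eqP.
by rewrite -mulr_natr mulf_eq0 natr_eq0_char0 // orbF => /eqP.
Qed.

(** In the fraction field x / y is a root of X^N - 1, which splits over [k], so x / y is one of its
    roots in [k]. *)
Lemma expr_eq_scale n (x y : {mpoly k[n]}) N : (0 < N)%N ->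
  x ^+ N = y ^+ N -> exists c, x = c *: y.
Proof.
move=> N0 e; have [y0|y0] := eqVneq y 0.
  exists 0; rewrite scale0r; apply/eqP; have := congr1 (eq_op^~ 0) e.
  by rewrite y0 !expf_eq0 N0 eqxx.
pose io := @tofrac {mpoly k[n]} \o @mpolyC n k.
have [r rE] := closed_field_poly_normal ('X^N - 1 : {poly k}).
have := congr1 (fun p => (map_poly io p).[tofrac x / tofrac y]) rE.
have -> : lead_coef ('X^N - 1 : {poly k}) = 1 by apply/eqP/monicXnsubC.
rewrite scale1r (rmorph_prod (map_poly io)) (rmorphB (map_poly io)) rmorph1 /= map_polyXn.
rewrite hornerD hornerN hornerXn hornerC.
rewrite expr_div_n -!rmorphXn e divff ?subrr ?tofrac_eq0 ?expf_neq0 //.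
move/esym/eqP; rewrite horner_prod prodf_seq_eq0 => /hasP[c _ /=].
rewrite rmorphB /= map_polyX map_polyC hornerXsubC subr_eq0 => /eqP E.
exists c; apply/eqP; rewrite -tofrac_eq; apply/eqP; rewrite -mul_mpolyC.
have {}E : tofrac x / tofrac y = tofrac c%:MP_[n] := E.
by rewrite tofracM -E divfK // tofrac_eq0.
Qed.

Definition dmap n (t : 'I_n -> k) : polymap k n n := [tuple t i *: 'X_i | i < n].

End ClosedField.

(** * Linearization *)

Section Linearization.
Variables (k : closedFieldType) (char0 : [pchar k] =i pred0) (m : nat) (M : zmodType).
Variables (Gr : grading k m.+1 M) (dl : 'I_m -> M -> k).
Hypothesis dlD : forall j w w', dl j (w + w') = dl j w + dl j w'.
Hypothesis dl_faithful : forall c : 'cV[k]_m,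
  (forall i w, gr_pi Gr w 'X_i != 0 -> \sum_j dl j w * c j 0 = 0) -> c = 0.
(** Weights that the [dl j] show to be independent span the weight group up to torsion and finite
    index. *)
Hypothesis dl_full : forall w : 'I_m -> M, \det (\matrix_(i, j) dl j (w i)) != 0 ->
  forall w0, exists N, exists2 a : 'I_m -> int,
    (0 < N)%N & w0 *+ N = \sum_i w i *~ a i.
Notation n := m.+1.
Notation A := {mpoly k[n]}.
Notation has_wt := (has_wt Gr).
Notation gpi := (gr_pi Gr).
Notation f := (fpol Gr dl).
Notation d := (mdeg (mlead f)).
Notation fe := (horner_alg f).

Let f_wt : has_wt 0 f. Proof. exact: fpol_wt. Qed.

Let d_gt0 : (0 < d)%N.
Proof.
have [l fl] := fpol_nonconst char0 dlD dl_faithful.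
rewrite lt0n; apply: contraNneq fl => d0.
suff -> : f = (f@_0%MM)%:MP by rewrite mderivC.
have [->|f0] := eqVneq f 0; first by rewrite mcoeff0 mpolyC0.
by apply: msize1_polyC; rewrite -mlead_deg // d0.
Qed.

Let f_wronskian g i l : has_wt 0 g -> g^`M(i) * f^`M(l) = g^`M(l) * f^`M(i).
Proof. exact: fpol_wronskian. Qed.

(* On weight 0 polynomials this is f d/df, up to the factor deg f. *)
Definition der (p : A) : A := (d%:R / n%:R) *: euler0 Gr p.

Let derE p : der p = \sum_i p^`M(i) * der 'X_i.
Proof.
rewrite /der euler0_derivE scaler_sumr; apply: eq_bigr => i _.
by rewrite scalerAr.
Qed.

Let der_wt w p : has_wt w p -> has_wt w (der p).
Proof. by move=> hp; apply: wtZ; apply: euler0_wt. Qed.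

Let der_f : der f = d%:R *: f.
Proof.
rewrite /der (euler0_pi f_wt) /euler (pi_euler_fpol Gr dlD) -[f *+ n]scaler_nat.
by rewrite scalerA divfK // natr_eq0_char0.
Qed.

Let DD := derD derE.
Let DZ := derZ derE.
Let DM := derM derE.
Let Dsum := der_sum derE.

Let DX p e : der (p ^+ e.+1) = (p ^+ e * der p) *+ e.+1.
Proof. exact: (derX derE). Qed.

Lemma fe_eval U v : (fe U).@[v] = U.[f.@[v]].
Proof.
elim/poly_ind: U => [|U c IH]; first by rewrite rmorph0 meval0 horner0.
rewrite rmorphD rmorphM /= horner_algX horner_algC mevalD mevalM IH.
by rewrite !hornerE mevalZ meval1 mulr1.
Qed.

(** [f] takes every value in [k], so U(f) = 0 makes every element of [k] a root of [U]. *)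
Lemma fe_eq0 U : fe U = 0 -> U = 0.
Proof.
move=> e; apply/eqP/negPn/negP => /closed_nonrootP[c].
have [v <-] := nonconst_surj char0 c d_gt0.
by rewrite /root -fe_eval e meval0 eqxx.
Qed.

Lemma fe_inj : injective fe.
Proof.
by move=> U V e; apply/eqP; rewrite -subr_eq0; apply/eqP/fe_eq0; rewrite rmorphB /= e subrr.
Qed.

Let D0 : der 0 = 0.
Proof. by have := DZ 0 0; rewrite !scale0r. Qed.

Lemma der_fe U : der (fe U) = fe (d%:R *: ('X * U^`())).
Proof.
elim/poly_ind: U => [|U c IH]; first by rewrite deriv0 mulr0 scaler0 rmorph0 D0.
rewrite derivD derivM derivX derivC addr0 mulr1 rmorphD rmorphM /= horner_algX horner_algC.
rewrite DD DZ DM IH der_f.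
have -> : der 1 = 0 by rewrite derE big1 // => i _; rewrite mderivC mul0r.
rewrite scaler0 addr0 !linearZ /= !rmorphM rmorphD rmorphM /= !horner_algX.
by rewrite -!mul_mpolyC; ring.
Qed.

Lemma fe_wt U : has_wt 0 (fe U).
Proof.
elim/poly_ind: U => [|U c IH]; first by rewrite rmorph0; apply: wt0.
rewrite rmorphD rmorphM /= horner_algX horner_algC; apply: wtD.
  by have := wtM IH f_wt; rewrite addr0.
by apply: wtZ; apply: wt1.
Qed.

(** The Jacobians of the tuples of total weight 0 add up to 1, so at each point one of them is
    nonzero. *)
Lemma exists_tuple_at a : exists (y : polymap k n n) (w : 'I_n -> M),
  [/\ forall i, has_wt (w i) (tnth y i), \sum_i w i = 0 & (jac y).@[a] != 0].
Proof.
have [t t0 Jt] : exists2 t : {ffun 'I_n -> _}, \sum_i twt t i == 0 &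
    (jac (tup (Gr := Gr) t)).@[a] != 0.
  apply/exists_inP; rewrite -[[exists (_ | _), _]]negbK; apply/negP => /exists_inPn J0.
  have /(congr1 (meval a)) := sum_jac_tup Gr; rewrite raddf_sum meval1 /= big1 => [/eqP|t /J0].
    by rewrite eq_sym oner_eq0.
  by rewrite negbK => /eqP.
exists (tup t), (twt t); split; [|exact/eqP|by []].
by move=> i; rewrite tnth_mktuple; apply: wt_pi.
Qed.

Notation eigen := (eigen Gr der).
Let Edeg := eigen_deg char0 d_gt0 f_wronskian derE der_f.
Let Euniq := eigen_unique char0 d_gt0 f_wronskian derE der_f.

Let f_neq0 : f != 0.
Proof. by apply: contraTneq d_gt0 => ->; rewrite mlead0 mdeg0. Qed.

Lemma eigen_pow i e h : eigen i h -> eigen (i * e) (h ^+ e).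
Proof.
case=> hh Dh; split; first by have := wtX e hh; rewrite mul0rn.
case: e => [|e].
  rewrite expr0 muln0 scale0r derE big1 // => l _.
  by rewrite mderivC mul0r.
by rewrite DX Dh -scalerAr -exprSr -scaler_nat scalerA mulnC natrM.
Qed.

(** Both powers are eigenvectors for i * d, and these are unique up to a scalar. *)
Lemma eigen_root i G : eigen i G -> G != 0 -> exists2 c, c != 0 & G ^+ d = c *: f ^+ i.
Proof.
move=> EG G0; have Ef : eigen d f by [].
have E1 := eigen_pow d EG; have E2 := eigen_pow i Ef; rewrite mulnC in E2.
have [c cE] := Euniq E1 E2 (expf_neq0 i f_neq0).
exists c => //; apply: contraNneq (expf_neq0 d G0) => c0.
by rewrite cE c0 scale0r.
Qed.

Section AtZero.
Variables (a : 'I_n -> k) (y : polymap k n n) (w : 'I_n -> M).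
Hypothesis fa : f.@[a] = 0.
Hypothesis y_wt : forall i, has_wt (w i) (tnth y i).
Hypothesis w0 : \sum_i w i = 0.
Hypothesis Ja : (jac y).@[a] != 0.
Notation lv := (lval a y).

Let lvM := lvalM char0 Ja.
Let lvX := lvalX char0 Ja.
Let lvZ := lvalZ char0 Ja.

Let eigen_lval i G : eigen i G -> G != 0 -> (lv G *+ d = lv f *+ i)%MM.
Proof.
move=> EG G0; have [c c0 e] := eigen_root EG G0.
by rewrite -!lvX // e lvZ // expf_neq0.
Qed.

Let eigen_zero i G : eigen i G -> (0 < i)%N -> G.@[a] = 0.
Proof.
move=> EG i0; have [->|G0] := eqVneq G 0; first by rewrite meval0.
have [c _ /(congr1 (meval a))] := eigen_root EG G0.
rewrite mevalZ !rmorphXn /= fa expr0n eqn0Ngt i0 mulr0 => /eqP.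
by rewrite expf_eq0 => /andP[_ /eqP].
Qed.

(** Since d times the valuation of an eigenvector is i times that of [f], the nonzero components of
    [h] have valuations increasing with [i]. The least [i] is positive: a nonzero component for i =
    0 is a constant, and [h] vanishes at [a]. So [der] multiplies the component of lowest valuation
    by a nonzero scalar. *)
Lemma lval_der h : has_wt 0 h -> h.@[a] = 0 -> h != 0 -> lv (der h) = lv h.
Proof.
move=> hh ha h0.
have [G EG hE] := eigen_decomp char0 d_gt0 f_wronskian derE der_wt der_f hh.
set N := msize h in hE.
have exG : exists j, (j < N)%N && (G j != 0).
  have [/existsP[j Gj]|/existsPn G0] := boolP [exists j : 'I_N, G j != 0].
    by exists j; rewrite ltn_ord.
  by move: h0; rewrite hE big1 ?eqxx // => j _; apply/eqP/negPn/G0.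
case: (ex_minnP exG) => j0 /andP[j0N Gj0] j0min.
have j0_gt0 : (0 < j0)%N.
  rewrite lt0n; apply: contraNneq Gj0 => j00; rewrite j00 in j0N j0min *.
  have E0 := EG 0%N; apply/negPn/negP => G0.
  have G0c : G 0%N = ((G 0%N)@_0%MM)%:MP.
    by apply: msize1_polyC; rewrite -mlead_deg // (Edeg E0).
  move: ha; rewrite hE (bigD1 (Ordinal j0N)) //= mevalD raddf_sum /= big1 => [|i ne].
    rewrite addr0 G0c mevalC => e; move: G0; rewrite G0c e mpolyC0 eqxx //.
  by apply: eigen_zero (EG i) _; rewrite lt0n.
have key c : c j0 != 0 -> lv (\sum_(j < N) c j *: G j) = lv (G j0).
  move=> cj0; rewrite (bigD1 (Ordinal j0N)) //= lval_dom ?lvZ //.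
    by rewrite scaler_eq0 negb_or cj0.
  move=> mu; rewrite /lpull (raddf_sum (comp_mpoly (lchart a y))) (raddf_sum (mcoeff mu)) /= => nz.
  have [i ij0 nzi] : exists2 i : 'I_N, i != Ordinal j0N &
      (lpull a y (c i *: G i))@_mu != 0.
    apply/exists_inP; rewrite -[[exists (_ | _), _]]negbK; apply/negP => /exists_inPn z.
    by move/eqP: nz; apply; apply: big1 => i /z; rewrite negbK => /eqP.
  have ciGi : c i *: G i != 0.
    by apply: contraNneq nzi => ->; rewrite /lpull raddf0 mcoeff0.
  move: (ciGi); rewrite scaler_eq0 negb_or => /andP[ci Gi].
  have lt : (j0 < i)%N.
    rewrite ltn_neqAle eq_sym ij0 /=; apply: j0min.
    by rewrite ltn_ord.
  apply: lt_le_trans (mlast_lemc (m := mu) (p := lpull a y (c i *: G i)) _); last first.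
    by rewrite mcoeff_msupp.
  rewrite -/(lval a y _) lvZ //; apply: lt_mdeg_ltmc.
  rewrite -(ltn_pmul2r d_gt0) -!mdegMn (eigen_lval (EG _) Gj0) (eigen_lval (EG _) Gi).
  by rewrite !mdegMn ltn_pmul2l // lval_gt0.
transitivity (lv (G j0)); last first.
  rewrite hE -(key (fun=> 1)) ?oner_neq0 //; congr (lv _).
  by apply: eq_bigr => j _; rewrite scale1r.
rewrite hE Dsum -(key (fun j => j%:R)) ?natr_eq0_char0 // -?lt0n //; congr (lv _).
by apply: eq_bigr => j _; case: (EG j).
Qed.

Let y_neq0 i : tnth y i != 0.
Proof.
apply: contraNneq Ja => yi; rewrite /jac (expand_det_row _ i) big1 ?meval0 // => j _.
by rewrite mxE yi mderiv0 mul0r.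
Qed.

(* f vanishes to order 1 along some y_i through a, whereas d times the order of
   vanishing of G is i times that of f. *)
Lemma eigen_dvd i G : eigen i G -> G != 0 -> (d %| i)%N.
Proof.
move=> EG G0; have e := eigen_lval EG G0.
have [/existsP[l fl]|/existsPn f_sing] := boolP [exists l, (f^`M(l)).@[a] != 0].
  have := congr1 (@mdeg _) e; rewrite !mdegMn (lval_smooth char0 Ja fa fl) mul1n => <-.
  exact: dvdn_mull.
(* At a singular point of [f], dQ vanishes too, while the dy_i are independent there. Hence some y_i
   vanishes at [a], and [Q] has exponent 1 along it. *)
pose Q := \prod_i tnth y i.
have JQ l : jac y * f^`M(l) = cst dl w *: Q^`M(l) by exact: jac_fpol.
have J0 : jac y != 0 by apply: contraNneq Ja => ->; rewrite meval0.
have c0 : cst dl w != 0 by apply: (cst_neq0 dlD dl_faithful y_wt).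
have dQ l : (Q^`M(l)).@[a] = 0.
  have /(congr1 (meval a)) := JQ l; rewrite mevalM mevalZ; have /negPn/eqP -> := f_sing l.
  by rewrite mulr0 => /esym/eqP; rewrite mulf_eq0 (negPf c0) => /eqP.
have [i0 yi0] : exists i0, (tnth y i0).@[a] = 0.
  have [/existsP[i0 /eqP]|/existsPn ya] := boolP [exists i0, (tnth y i0).@[a] == 0].
    by exists i0.
  pose u : 'rV[k]_n := \row_i (\prod_(j | j != i) tnth y j).@[a].
  pose J : 'M[k]_n := map_mx (meval a) (jacmx y).
  have Ju : J \in unitmx by rewrite unitmxE /J det_map_mx unitfE.
  have uJ : u *m J = 0.
    apply/rowP=> l; rewrite [RHS]mxE -(dQ l) mderiv_prod ?index_enum_uniq //.
    rewrite raddf_sum mxE; apply: eq_bigr => j _.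
    by rewrite /u /J !mxE /= mevalM mulrC.
  have /rowP/(_ 0) : u = 0 by rewrite -[u](mulmxK Ju) uJ mul0mx.
  rewrite !mxE rmorph_prod /= => /eqP; rewrite prodf_seq_eq0 => /hasP[j _ /andP[_ ya0]].
  by have := ya j; rewrite ya0.
have Q0 : Q != 0 by apply/prodf_neq0 => j _; apply: y_neq0.
have Qa : Q.@[a] = 0 by rewrite /Q (bigD1 i0) //= mevalM yi0 mul0r.
have Qwt : has_wt 0 Q by rewrite -w0; apply: wt_prod.
have lQ : lv Q i0 = 1%N.
  rewrite (lval_prod char0 Ja) // mnm_sumE (bigD1 i0) //= big1 => [|j ne].
    by rewrite (lval_coord Ja yi0) mnm1E eqxx.
  have [yj|yj] := eqVneq (tnth y j).@[a] 0.
    by rewrite (lval_coord Ja yj) mnm1E (negPf ne).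
  by rewrite lval_unit // mnm0E.
(* [der Q] is [f] times a function that does not vanish at [a], so [lval_der] equates the valuations
   of [f] and [Q]. *)
have lf : lv f = lv Q.
  rewrite -(lval_der Qwt Qa Q0).
  have E : cst dl w *: der Q = jac y * (d%:R *: f).
    rewrite -der_f derE (derE f) scaler_sumr mulr_sumr; apply: eq_bigr => l _.
    by rewrite scalerAl -JQ mulrA.
  have d0 : d%:R != 0 :> k by rewrite natr_eq0_char0 // -lt0n.
  have Dn0 : der Q != 0.
    apply: contra_eq_neq E => ->; rewrite scaler0 eq_sym mulf_neq0 //.
    by rewrite scaler_eq0 negb_or d0 f_neq0.
  rewrite -(lvZ c0 Dn0) E lvM ?scaler_eq0 ?negb_or ?d0 ?f_neq0 //.
  by rewrite (lval_unit y Ja) add0m lvZ.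
have := congr1 (fun mu : 'X_{1..n} => mu i0) e; rewrite !mulmnE lf lQ mul1n => <-.
exact: dvdn_mull.
Qed.

End AtZero.

(** An eigenvector for i = e * d is a multiple of [f ^+ e]. *)
Lemma inv_poly g : has_wt 0 g -> exists U, g = fe U.
Proof.
move=> hg; have [G EG ->] := eigen_decomp char0 d_gt0 f_wronskian derE der_wt der_f hg.
have [a fa] := nonconst_surj char0 0 d_gt0.
have [y [w [y_wt w0 Ja]]] := exists_tuple_at a.
elim/big_ind: _ => [|p q [U ->] [V ->]|i _]; first by exists 0; rewrite rmorph0.
  by exists (U + V); rewrite rmorphD.
have [->|Gi0] := eqVneq (G i) 0; first by exists 0; rewrite rmorph0.
have /dvdnP[e ie] := eigen_dvd fa y_wt w0 Ja (EG i) Gi0.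
have Ef : eigen (i : nat) (f ^+ e) by rewrite ie mulnC; apply: eigen_pow.
have [c ->] := Euniq (EG i) Ef (expf_neq0 e f_neq0).
by exists (c *: 'X^e); rewrite linearZ /= rmorphXn /= horner_algX ?mulr_algl.
Qed.

(** [dl_full] gives integer coefficients on all weights but the first; adding a large multiple [B]
    of the relation that the weights sum to 0 makes them nonnegative. *)
Lemma posrel (y : polymap k n n) (w : 'I_n -> M) (v : M) :
  (forall i, has_wt (w i) (tnth y i)) -> \sum_i w i = 0 -> jac y != 0 ->
  exists N, exists2 b : 'I_n -> nat, (0 < N)%N & v *+ N = \sum_i w i *+ b i.
Proof.
move=> y_wt w0 J0; have := cst_neq0 dlD dl_faithful y_wt w0 J0.
rewrite /cst /kap expr0 mul1r.
have -> : row' 0 (wmx dl w) = \matrix_(i, j) dl j (w (lift 0 i)).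
  by apply/matrixP=> i j; rewrite !mxE.
move/(dl_full)/(_ v) => [N [c N0 vE]].
pose B := (\sum_j `|c j|)%N.
have cB j : (0 <= c j + B%:Z)%R.
  have : (`|c j| <= B)%N by rewrite /B (bigD1 j) //= leq_addr.
  by lia.
exists N; exists (fun i => if unlift 0 i is Some j then `|(c j + B%:Z)%R|%N else B) => //.
rewrite big_ord_recl unlift_none /=.
transitivity ((\sum_i w i) *+ B + v *+ N); first by rewrite w0 mul0rn add0r.
rewrite big_ord_recl mulrnDl -addrA; congr (_ + _).
rewrite vE -sumrMnl -big_split; apply: eq_bigr => j _ /=.
by rewrite liftK pmulrn gez0_abs // mulrzDr addrC.
Qed.

(** -w = (N - 1) w + N (-w), and by [posrel] N (-w) is the weight of a monomial in a tuple of
    semi-invariants. *)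
Lemma opposite_weight w z : has_wt w z -> z != 0 ->
  exists2 z', has_wt (- w) z' & z' != 0.
Proof.
move=> hz z0; have [y [v [y_wt v0 Ja]]] := exists_tuple_at (fun=> 0).
have J0 : jac y != 0 by apply: contraNneq Ja => ->; rewrite meval0.
have [N [b N0 e]] := posrel (- w) y_wt v0 J0.
have y_neq0 i : tnth y i != 0.
  apply: contraNneq J0 => yi; rewrite /jac (expand_det_row _ i) big1 // => j _.
  by rewrite mxE yi mderiv0 mul0r.
exists (z ^+ N.-1 * \prod_i tnth y i ^+ b i); last first.
  by rewrite mulf_neq0 ?expf_neq0 //; apply/prodf_neq0 => i _; rewrite expf_neq0.
have -> : - w = w *+ N.-1 + \sum_i v i *+ b i.
  by rewrite -e mulNrn -{2}(prednK N0) mulrSr opprD addNKr.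
by apply: wtM; [exact: wtX|apply: wt_prod => i _; exact: wtX].
Qed.

Definition generates w z :=
  [/\ has_wt w z, z != 0 & forall z', has_wt w z' -> exists U, z' = fe U * z].

(** Take [z] nonzero of least degree in weight [w]. Multiplying by an element of opposite weight
    gives U(f) z = V(f) z'. After division by the gcd, Bezout produces [z3] of weight [w] with c z =
    V1(f) z3, and minimality forces V1(f) to be constant. *)
Lemma exists_generator w z0 : has_wt w z0 -> z0 != 0 -> exists z, generates w z.
Proof.
have [s] := ubnP (msize z0); elim: s z0 => // s IH z lt hz z_n0.
have [[z1 [h1 z1n0 lt1]]|zmin] :=
  classic (exists z1, [/\ has_wt w z1, z1 != 0 & (msize z1 < msize z)%N]).
  by apply: (IH z1) => //; apply: leq_trans lt1 _.
exists z; split=> // z' hz'.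
have [z2 h2 z2n0] := opposite_weight hz z_n0.
have [U UE] : exists U, z' * z2 = fe U.
  by apply: inv_poly; rewrite -(subrr w); apply: wtM.
have [V VE] : exists V, z * z2 = fe V.
  by apply: inv_poly; rewrite -(subrr w); apply: wtM.
have V0 : V != 0.
  by apply: contra_eq_neq VE => ->; rewrite rmorph0 mulf_neq0.
have UV : fe U * z = fe V * z' by rewrite -UE -VE; ring.
have G0 : gcdp U V != 0 by rewrite gcdp_eq0 negb_and V0 orbT.
pose U1 := U %/ gcdp U V; pose V1 := V %/ gcdp U V.
have UG : U = U1 * gcdp U V by rewrite divpK ?dvdp_gcdl.
have VG : V = V1 * gcdp U V by rewrite divpK ?dvdp_gcdr.
have V10 : V1 != 0 by apply: contraNneq V0 => V10; rewrite VG V10 mul0r.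
have fe_n0 W : W != 0 -> fe W != 0 by apply: contra_neq => /fe_eq0.
have U1V1 : fe U1 * z = fe V1 * z'.
  apply: (mulIf (fe_n0 _ G0)); rewrite mulrAC -rmorphM /= -UG UV.
  by rewrite [in LHS]VG rmorphM /= mulrAC.
have /Bezout_coprimepP[[S T] /= ST] : coprimep U1 V1.
  by apply: coprimep_div_gcd; rewrite V0 orbT.
have /size_poly1P[c c0 cE] : size (S * U1 + T * V1) == 1%N.
  by rewrite (eqp_size ST) size_poly1.
pose z3 := fe S * z' + fe T * z.
have zE : c *: z = fe V1 * z3.
  rewrite /z3 mulrDr [fe V1 * _]mulrCA -U1V1 -mul_mpolyC -alg_mpolyC -(horner_algC f c) -cE.
  by rewrite rmorphD !rmorphM /=; ring.
have z30 : z3 != 0.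
  by apply: contraNneq z_n0 => z30; move/eqP: zE; rewrite z30 mulr0 scaler_eq0 (negPf c0).
have hz3 : has_wt w z3.
  by apply: wtD; rewrite -[w]add0r; apply: wtM => //; apply: fe_wt.
have lez3 : (msize z <= msize z3)%N.
  by rewrite leqNgt; apply/negP => lt3; apply: zmin; exists z3.
have /msize_poly1P[b b0 bE] : msize (fe V1) == 1%N.
  have := congr1 (fun p : A => msize p) zE; rewrite msizeZ // msizeM ?fe_n0 //.
  have := fe_n0 _ V10; move: lez3 z_n0; rewrite -!msize_poly_eq0; move: (msize z) (msize z3) (msize (fe V1)) => ? ? ?; lia.
exists (b^-1 *: U1); rewrite -mul_polyC rmorphM /= horner_algC -mulrA U1V1 bE mul_mpolyC mulr_algl scalerA mulVf //.
by rewrite scale1r.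
Qed.

(** [der] preserves weights, so the logarithmic derivative of a generator is a polynomial in [f]. *)
Lemma der_generator w z : generates w z -> exists H, der z = fe H * z.
Proof. by case=> hz _; apply; apply: der_wt. Qed.

(* Logarithmic derivatives of invariants have no pole outside f = 0. *)
Lemma inv_log_der U H : U != 0 -> der (fe U) = fe H * fe U ->
  exists2 c, c != 0 & exists j, U = c *: 'X^j.
Proof.
move=> U0; rewrite der_fe -rmorphM /= => /fe_inj e; apply: (poly_dvd_Xderiv char0) => //.
have d0 : d%:R != 0 :> k by rewrite natr_eq0_char0 // -lt0n.
by rewrite -(dvdpZr _ _ d0) e dvdp_mull.
Qed.

(** The product of generators of the two weights has a polynomial logarithmic derivative, so it is c
    f^j. If j = 0 these generators are units, hence constants, of weight 0. *)
Lemma opposite_prod w p q : w != 0 -> has_wt w p -> has_wt (- w) q ->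
  exists2 U, p * q = fe U & U.[0] = 0.
Proof.
move=> w0 hp hq.
have [->|p0] := eqVneq p 0; first by exists 0; rewrite ?mul0r ?rmorph0 ?horner0.
have [->|q0] := eqVneq q 0; first by exists 0; rewrite ?mulr0 ?rmorph0 ?horner0.
have [z Gz] := exists_generator hp p0; have [z' Gz'] := exists_generator hq q0.
have [H zH] := der_generator Gz; have [H' zH'] := der_generator Gz'.
case: Gz => hz z0 /(_ _ hp)[U ->]; case: Gz' => hz' z'0 /(_ _ hq)[U' ->].
have [V VE] : exists V, z * z' = fe V.
  by apply: inv_poly; rewrite -(subrr w); apply: wtM.
have V0 : V != 0 by apply: contra_eq_neq VE => ->; rewrite rmorph0 mulf_neq0.
have [c c0 [j Vj]] : exists2 c, c != 0 & exists j, V = c *: 'X^j.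
  apply: (inv_log_der (H := H + H') V0).
  by rewrite -VE DM zH zH' rmorphD /=; ring.
exists (U * U' * V); first by rewrite !rmorphM /= -VE; ring.
rewrite !hornerM Vj hornerZ hornerXn expr0n; case: (posnP j) => [j0|]; last first.
  by move=> _; rewrite /= !mulr0.
have /msize_poly1P[b b0 bE] : msize z == 1%N.
  have := congr1 (fun p : A => msize p) VE; rewrite Vj j0 expr0 alg_polyC horner_algC.
  rewrite alg_mpolyC msizeC c0 msizeM //; move: z0 z'0; rewrite -!msize_poly_eq0; move: (msize z) (msize z') => ? ?; lia.
case/eqP: w0; apply: (wt_uniq hz) z0; rewrite bE; exact: wtC.
Qed.

(** Taking the weight 0 component and setting f = 0 is a ring homomorphism to [k], because by
    [opposite_prod] products of opposite nonzero weights vanish at f = 0. It is therefore evaluation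
    at the point whose coordinates are its values on the variables. *)
Lemma fixed_point : exists a : 'I_n -> k,
  forall g, exists2 U, gpi 0 g = fe U & U.[0] = g.@[a].
Proof.
have /fin_all_exists[X XE] : forall i : 'I_n, exists U, gpi 0 'X_i = fe U.
  by move=> i; apply: inv_poly; apply: wt_pi.
exists (fun i => (X i).[0]); elim/mpoly_alg_ind => [c|i|p q [U pU U0] [V qV V0]|p q [U pU U0] [V qV V0]].
- exists c%:P; last by rewrite hornerC mevalC.
  by rewrite horner_algC alg_mpolyC; apply: wtC.
- by exists (X i); rewrite // mevalXU.
- by exists (U + V); rewrite ?gr_piD ?rmorphD /= ?pU ?qV // hornerD U0 V0.
pose S := (0 : M) :: gr_supp Gr p.
have pE : p = \sum_(w <- undup S) gpi w p.
  apply: pi_sumE; first exact: undup_uniq.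
  by move=> w /supp_mem h; rewrite mem_undup inE h orbT.
have [W WE W0] : exists2 W, \sum_(w <- undup S | w != 0) gpi w p * gpi (- w) q = fe W & W.[0] = 0.
  elim/big_ind: _ => [|p1 p2 [W1 -> e1] [W2 -> e2]|w w0].
  - by exists 0; rewrite ?rmorph0 ?horner0.
  - by exists (W1 + W2); rewrite ?rmorphD ?hornerD ?e1 ?e2 ?addr0.
  - have [W e e0] := opposite_prod w0 (wt_pi Gr w p) (wt_pi Gr (- w) q).
    by exists W.
exists (U * V + W); last by rewrite hornerD hornerM U0 V0 W0 addr0 mevalM.
rewrite rmorphD rmorphM /= -pU -qV -WE {1}pE mulr_suml pi_sum.
have pqE w : gpi 0 (gpi w p * q) = gpi w p * gpi (- w) q.
  by rewrite mulrC -{1}(addNr w) (pi_mul_wt _ _ (wt_pi _ _ _)) mulrC.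
under eq_bigr do rewrite pqE.
rewrite (bigD1_seq 0) ?undup_uniq ?mem_undup ?mem_head //= oppr0.
by [].
Qed.

Lemma mderiv_fe U l : (fe U)^`M(l) = fe U^`() * f^`M(l).
Proof.
elim/poly_ind: U => [|U c IH]; first by rewrite deriv0 !rmorph0 mderiv0 mul0r.
rewrite derivD derivM derivX derivC addr0 mulr1 !rmorphD !rmorphM /= horner_algX horner_algC.
by rewrite mderivD alg_mpolyC mderivC addr0 mderivM IH; ring.
Qed.

Section AtFixedPoint.
Variable a : 'I_n -> k.
Hypothesis aE : forall g, exists2 U, gpi 0 g = fe U & U.[0] = g.@[a].

Let f_at : f.@[a] = 0.
Proof.
have [U + <-] := aE f; rewrite f_wt -[X in X = _](horner_algX f) => /fe_inj <-.
by rewrite hornerX.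
Qed.

Let wt_at w g : w != 0 -> has_wt w g -> g.@[a] = 0.
Proof.
move=> w0 hg; have [U + <-] := aE g.
rewrite (wt_pi_ne _ hg) eq_sym (negPf w0) => /esym/fe_eq0 ->.
exact: horner0.
Qed.

(** A semi-invariant is U(f) times a generator, or a polynomial in [f] if the weight is 0. At the
    fixed point its differential is a multiple of that of the generator, respectively of [f], so the
    replacement keeps local coordinates and gains a polynomial logarithmic derivative. *)
Lemma local_coordinate w y : has_wt w y -> y != 0 ->
  exists g : A, [/\ has_wt w g, exists H, der g = fe H * g, g.@[a] = 0 &
    exists s, forall l, (y^`M(l)).@[a] = s * (g^`M(l)).@[a]].
Proof.
have [->|w0] := eqVneq w 0.
  move=> /inv_poly[U ->] _; exists f; split=> //.
    by exists d%:R%:P; rewrite horner_algC mulr_algl der_f.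
  exists U^`().[0] => l.
  by rewrite mderiv_fe mevalM fe_eval f_at.
move=> hy y0; have [z Gz] := exists_generator hy y0.
have dz := der_generator Gz; case: (Gz) => hz z0 /(_ _ hy)[U ->].
exists z; split=> //; first exact: wt_at hz.
exists U.[0] => l; rewrite mderivM mevalD !mevalM (wt_at w0 hz) mulr0 add0r.
by rewrite fe_eval f_at.
Qed.

End AtFixedPoint.

Lemma exists_coordinates : exists (a : 'I_n -> k) (g : polymap k n n) (w : 'I_n -> M),
  [/\ forall i, has_wt (w i) (tnth g i), \sum_i w i = 0, (jac g).@[a] != 0,
      forall i, exists H, der (tnth g i) = fe H * tnth g i &
      forall i, (tnth g i).@[a] = 0].
Proof.
have [a aE] := fixed_point; have [y [w [y_wt w0 Ja]]] := exists_tuple_at a.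
have y_neq0 i : tnth y i != 0.
  apply: contraNneq Ja => yi; rewrite /jac (expand_det_row _ i) big1 ?meval0 // => j _.
  by rewrite mxE yi mderiv0 mul0r.
have /fin_all_exists[g gP] i := local_coordinate aE (y_wt i) (y_neq0 i).
have /fin_all_exists[s sP] i : exists s, forall l,
    ((tnth y i)^`M(l)).@[a] = s * ((g i)^`M(l)).@[a] by case: (gP i).
exists a, [tuple g i | i < n], w; split.
- by move=> i; rewrite tnth_mktuple; case: (gP i).
- exact: w0.
- apply: contraNneq Ja => J0; rewrite /jac -/(jacmx y) -det_map_mx.
  have -> : map_mx (meval a) (jacmx y) =
      diag_mx (\row_i s i) *m map_mx (meval a) (jacmx [tuple g i | i < n]).
    apply/matrixP=> i j; rewrite mul_diag_mx !mxE tnth_mktuple; exact: sP.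
  have J0' : (\det (jacmx [tuple g i | i < n])).@[a] = 0 := J0.
  by rewrite det_mulmx [X in _ * X]det_map_mx /= J0' mulr0.
- by move=> i; rewrite tnth_mktuple; case: (gP i).
- by move=> i; rewrite tnth_mktuple; case: (gP i).
Qed.

Theorem linear_coordinates : exists (g h : polymap k n n) (w : 'I_n -> M),
  [/\ inverse_pair g h, forall i, has_wt (w i) (tnth g i), \sum_i w i = 0 &
      \det (\matrix_(i, j) dl j (w (lift 0 i))) != 0].
Proof.
have [a [g [w [g_wt w0 Ja gD ga]]]] := exists_coordinates.
have J0 : jac g != 0 by apply: contraNneq Ja => ->; rewrite meval0.
have g_neq0 i : tnth g i != 0.
  apply: contraNneq J0 => yi; rewrite /jac (expand_det_row _ i) big1 // => j _.
  by rewrite mxE yi mderiv0 mul0r.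
pose lv := lval a g; pose Q := \prod_i tnth g i.
have lvg i : lv (tnth g i) = U_(i)%MM by exact: lval_coord.
have Dprod (b : 'I_n -> nat) : exists H, der (\prod_i tnth g i ^+ b i) =
    fe H * \prod_i tnth g i ^+ b i.
  elim/big_ind: _ => [|p q [H pH] [H' qH]|i _].
  - exists 0; rewrite rmorph0 mul0r derE big1 // => i _.
    by rewrite mderivC mul0r.
  - by exists (H + H'); rewrite DM pH qH rmorphD /=; ring.
  - have [H gH] := gD i; case: (b i) => [|e].
      exists 0; rewrite rmorph0 mul0r derE big1 // => l _.
      by rewrite mderivC mul0r.
    by exists (H *+ e.+1); rewrite DX gH rmorphMn /= exprS mulrnAl mulrCA [_ * tnth g i]mulrC.
have Qwt : has_wt 0 Q by rewrite -w0; apply: wt_prod.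
have Q0 : Q != 0 by apply/prodf_neq0.
have lvQ i : lv Q i = 1%N.
  rewrite /lv (lval_prod char0 Ja) // mnm_sumE (bigD1 i) //= big1 => [|j ne].
    by rewrite -/(lv _) lvg mnm1E eqxx.
  by rewrite -/(lv _) lvg mnm1E (negPf ne).
(* [Q] is an invariant with polynomial logarithmic derivative, hence c f^j; its valuation (1, ...,
   1) forces j = 1. *)
have [c c0 Qf] : exists2 c, c != 0 & Q = c *: f.
  have [V VE] := inv_poly Qwt; have V0 : V != 0.
    by apply: contraNneq Q0 => V0; rewrite VE V0 rmorph0.
  have [H HQ] : exists H, der Q = fe H * Q.
    have [H] := Dprod (fun=> 1%N); rewrite (eq_bigr (fun i => tnth g i)) //; by exists H.
  have [c c0 [j Vj]] : exists2 c, c != 0 & exists j, V = c *: 'X^j.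
    by apply: (inv_log_der V0 (H := H)); rewrite -VE.
  exists c => //; have QE : Q = c *: f ^+ j.
    by rewrite VE Vj -mul_polyC rmorphM rmorphXn /= horner_algX horner_algC mulr_algl.
  have := lvQ 0; rewrite QE /lv (lvalZ char0 Ja) ?expf_neq0 // (lvalX char0 Ja) // mulmnE.
  by move/eqP; rewrite muln_eq1 => /andP[_ /eqP ->].
pose rg p := exists q, p = q \mPo g.
have rgD p q : rg p -> rg q -> rg (p + q).
  by move=> [p' ->] [q' ->]; exists (p' + q'); rewrite rmorphD.
have rgM p q : rg p -> rg q -> rg (p * q).
  by move=> [p' ->] [q' ->]; exists (p' * q'); rewrite rmorphM.
have rgC b : rg b%:MP by exists b%:MP; rewrite comp_mpolyC.
have rgg i : rg (tnth g i) by exists 'X_i; rewrite comp_mpolyXU -tnth_nth.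
have rgX p e : rg p -> rg (p ^+ e).
  by move=> rp; elim: e => [|e IH]; [exact: (rgC 1)|rewrite exprS; apply: (rgM)].
have rgP (b : 'I_n -> nat) : rg (\prod_i tnth g i ^+ b i).
  by elim/big_ind: _ => [|p q|i _]; [exact: (rgC 1)|exact: (rgM)|exact: rgX].
have rgf : rg f.
  have -> : f = (c^-1)%:MP * Q by rewrite mul_mpolyC Qf scalerA mulVf // scale1r.
  by apply: (rgM) => //; have := rgP (fun=> 1%N).
have rgfe U : rg (fe U).
  elim/poly_ind: U => [|U b IH]; first by rewrite rmorph0; exact: (rgC 0).
  rewrite rmorphD rmorphM /= horner_algX horner_algC alg_mpolyC.
  by apply: (rgD) => //; apply: (rgM).
(* It suffices to treat a generator [z]. Some power z^N has the weight of a monomial [gb] in the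
   g_i, and both are constants times powers of [f] times one generator [y]. *)
have rg_wt v p : has_wt v p -> rg p.
  have [->|p0 hp] := eqVneq p 0; first by exists 0; rewrite comp_mpoly0.
  have [z Gz] := exists_generator hp p0; have [H zH] := der_generator Gz.
  case: Gz => hz z0 /(_ _ hp)[U ->]; apply: (rgM) => //.
  have [N [b N0 Nv]] := posrel v g_wt w0 J0.
  pose gb := \prod_i tnth g i ^+ b i.
  have hgb : has_wt (v *+ N) gb.
    by rewrite Nv; apply: wt_prod => i _; apply: wtX.
  have gb0 : gb != 0 by apply/prodf_neq0 => i _; rewrite expf_neq0.
  have [y Gy] := exists_generator hgb gb0; have [K yK] := der_generator Gy.
  case: Gy => hy y0 yP; have [V VE] := yP _ (wtX N hz); have [W WE] := yP _ hgb.
  have V0 : V != 0 by apply: contraNneq (expf_neq0 N z0) => V0; rewrite VE V0 rmorph0 mul0r.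
  have W0 : W != 0 by apply: contraNneq gb0 => W0; rewrite WE W0 rmorph0 mul0r.
  have log_der U1 p1 L : p1 = fe U1 * y -> der p1 = fe L * p1 ->
      der (fe U1) = fe (L - K) * fe U1.
    move=> p1E; rewrite p1E DM yK => e; apply: (mulIf y0).
    by rewrite rmorphB /= !mulrBl -[fe L * _ * _]mulrA -e; ring.
  have zND : der (z ^+ N) = fe (H *+ N) * z ^+ N.
    by rewrite -(prednK N0) DX zH rmorphMn /= exprS mulrnAl mulrCA [_ * z]mulrC.
  have [L gbL] := Dprod b.
  have [c1 c10 [j1 V1]] := inv_log_der V0 (log_der _ _ _ VE zND).
  have [c2 c20 [j2 W2]] := inv_log_der W0 (log_der _ _ _ WE gbL).
  have fEX b0 j : fe (b0 *: 'X^j) = b0 *: f ^+ j.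
    by rewrite -mul_polyC rmorphM rmorphXn /= horner_algX horner_algC mulr_algl.
  have fQ : f = c^-1 *: Q by rewrite Qf scalerA mulVf // scale1r.
  have [e e0 zQ] : exists2 e, e != 0 & z ^+ N * Q ^+ j2 = e *: (gb * Q ^+ j1).
    exists (c1 / c2 * c ^+ j2 / c ^+ j1).
      by rewrite !mulf_neq0 ?invr_eq0 ?expf_neq0.
    rewrite VE WE V1 W2 !fEX fQ !exprZn -!scalerAl !scalerA !exprVn.
    have := expf_neq0 j1 c0; have := expf_neq0 j2 c0.
    move: (c ^+ j1) (c ^+ j2) => x y1 y1n0 xn0.
    have -> : c1 / c2 * y1 / x * (c2 / y1) = c1 / x by field; rewrite ?xn0 ?c20 ?y1n0.
    by congr (_ *: _); ring.
  (* Comparing valuations shows that gb Q^j1 / Q^j2 is the N-th power of the monomial with exponents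
     [lv z i]. *)
  have lE i : (lv z i * N + j2 = b i + j1)%N.
    have := congr1 (fun p => lv p i) zQ; rewrite /lv.
    rewrite (lvalZ char0 Ja) ?mulf_neq0 ?expf_neq0 // !(lvalM char0 Ja) ?expf_neq0 //.
    rewrite !(lvalX char0 Ja) // !mnmDE !mulmnE -!/(lv _) !lvQ !mul1n => ->; congr (_ + _)%N.
    rewrite /lv (lval_prod char0 Ja) => [|l _]; last exact: expf_neq0.
    rewrite mnm_sumE (bigD1 i) //= big1 => [|l ne]; rewrite (lvalX char0 Ja) // mulmnE -/(lv _) lvg mnm1E.
      by rewrite eqxx mul1n addn0.
    by rewrite (negPf ne).
  pose P := \prod_i tnth g i ^+ lv z i.
  have PE : P ^+ N * Q ^+ j2 = gb * Q ^+ j1.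
    rewrite /P /gb /Q -!prodrXl -!big_split; apply: eq_bigr => i _ /=.
    by rewrite -exprM -!exprD lE.
  have [r rN] : exists r, r ^+ N = e.
    have /closed_rootP[r] : size ('X^N - e%:P) != 1%N by rewrite size_XnsubC // -lt0n.
    by rewrite /root hornerD hornerN hornerXn hornerC subr_eq0 => /eqP; exists r.
  have zP : z ^+ N = (r *: P) ^+ N.
    apply: (mulIf (expf_neq0 j2 Q0)).
    by rewrite zQ -PE exprZn rN -scalerAl.
  have [c' ->] := expr_eq_scale N0 zP.
  by rewrite scalerA -mul_mpolyC; apply: (rgM); [exact: rgC|exact: rgP].
have /fin_all_exists[h hE] : forall i : 'I_n, rg 'X_i.
  move=> i; rewrite ['X_i](gr_supp_sum Gr); elim/big_ind: _ => [|p q|v _].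
  - exact: (rgC 0).
  - exact: (rgD).
  - exact: (rg_wt v _ (wt_pi _ _ _)).
pose h' : polymap k n n := [tuple h i | i < n].
have hg : pcomp h' g = pid k n.
  by apply: eq_from_tnth => i; rewrite !tnth_mktuple -hE.
(* The difference of the two sides vanishes after composition with [g], whose entries are
   algebraically independent. *)
have gh : pcomp g h' = pid k n.
  apply: eq_from_tnth => i; rewrite !tnth_mktuple; apply/eqP; rewrite -subr_eq0; apply/eqP.
  apply: (mpoly_alg_indep char0 J0); rewrite raddfB /= comp_mpolyA hg.
  by rewrite comp_mpoly_id comp_mpolyXU -tnth_nth subrr.
exists g, h', w; split=> //.
have := cst_neq0 dlD dl_faithful g_wt w0 J0.
rewrite /cst /kap expr0 mul1r; congr (\det _ != 0).
by apply/matrixP=> i j; rewrite !mxE.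
Qed.

End Linearization.

(** * Characters of diagonalizable groups *)

(** Excluded middle turns the subgroup into a boolean predicate, as the quotient construction
    requires; [rp] chooses representatives. *)
Lemma classical_quotient (V : zmodType) (P : V -> Prop) :
  P 0 -> (forall x y, P x -> P y -> P (x - y)) ->
  exists (M : zmodType) (pr : {additive V -> M}) (rp : M -> V),
    cancel rp pr /\ forall x, pr x = 0 <-> P x.
Proof.
move=> P0 PB; pose Pb : {pred V} := fun x => excluded_middle_informative (P x).
have PbE x : x \in Pb <-> P x.
  by rewrite unfold_in /Pb; case: excluded_middle_informative => //= nP; split.
have Pb_closed : zmod_closed Pb.
  by split=> [|x y /PbE Px /PbE Py]; apply/PbE; [exact: P0|exact: PB].
pose mix := GRing.isZmodClosed.Build V Pb Pb_closed.
pose I : zmodClosed V := HB.pack Pb mix.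
exists (Quotient.quot I), (\pi_(Quotient.quot I))%qT, repr; split=> [q|x].
  exact: reprK.
rewrite -PbE; split=> [e|xI].
  by rewrite -[x]subr0 (Quotient.idealrBE I x 0) e raddf0.
apply/eqP; rewrite -[X in _ == X](raddf0 (\pi_(Quotient.quot I))%qT).
by rewrite -(Quotient.idealrBE I x 0) subr0.
Qed.

Section Characters.
Variables (k : closedFieldType) (r : nat).
Implicit Types (t s : 'rV[k]_(r + r)) (e : 'rV[int]_r).

Definition chr e t : k := \prod_j t 0 (lshift r j) ^ e 0 j.

Definition tmul t s : 'rV[k]_(r + r) := \row_i (t 0 i * s 0 i).

Lemma diag_coord_neq0 t j : diag_set t -> t 0 (lshift r j) != 0.
Proof.
move=> /(_ j) e; apply/eqP => t0; move/eqP: e.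
by rewrite t0 mul0r eq_sym oner_eq0.
Qed.

Lemma diag_coord_inv t j : diag_set t -> t 0 (rshift r j) = (t 0 (lshift r j))^-1.
Proof.
move=> Dt; apply: (mulfI (diag_coord_neq0 j Dt)).
by rewrite Dt divff // diag_coord_neq0.
Qed.

Lemma diag_eq t s : diag_set t -> diag_set s ->
  (forall j, t 0 (lshift r j) = s 0 (lshift r j)) -> t = s.
Proof.
move=> Dt Ds h; apply/rowP=> i; rewrite -[i]splitK; case: (split i) => j //=.
by rewrite !diag_coord_inv // h.
Qed.

Lemma chr_neq0 e t : diag_set t -> chr e t != 0.
Proof. by move=> Dt; apply/prodf_neq0 => j _; rewrite expfz_neq0 // diag_coord_neq0. Qed.

Lemma chr0 t : chr 0 t = 1.
Proof. by rewrite /chr big1 // => j _; rewrite mxE expr0z. Qed.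

Lemma chrD e e' t : diag_set t -> chr (e + e') t = chr e t * chr e' t.
Proof.
move=> Dt; rewrite /chr -big_split; apply: eq_bigr => j _ /=.
by rewrite mxE expfzDr // diag_coord_neq0.
Qed.

Lemma chrN e t : diag_set t -> chr (- e) t = (chr e t)^-1.
Proof.
move=> Dt; apply: (mulfI (chr_neq0 e Dt)).
by rewrite -chrD // subrr chr0 divff // chr_neq0.
Qed.

Lemma chrB e e' t : diag_set t -> chr (e - e') t = chr e t / chr e' t.
Proof. by move=> Dt; rewrite chrD // chrN. Qed.

Lemma chrZ e t (z : int) : chr (z *: e) t = chr e t ^ z.
Proof.
rewrite /chr (big_morph (fun x : k => x ^ z) (fun x y => expfzMl x y z) (exp1rz _ z)).
by apply: eq_bigr => j _; rewrite mxE exprz_exp mulrC.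
Qed.

Lemma chr_sum (I : Type) (l : seq I) (P : pred I) (F : I -> 'rV[int]_r) t :
  diag_set t -> chr (\sum_(i <- l | P i) F i) t = \prod_(i <- l | P i) chr (F i) t.
Proof.
move=> Dt; elim/big_rec2: _ => [|i e p _ <-]; first exact: chr0.
exact: chrD.
Qed.

Lemma chrM e t s : chr e (tmul t s) = chr e t * chr e s.
Proof.
rewrite /chr -big_split; apply: eq_bigr => j _ /=.
by rewrite mxE expfzMl.
Qed.

(** The character to which a monomial restricts on [diag_set], where coordinate [rshift r j] is the
    inverse of coordinate [lshift r j]. *)
Definition wexp (mu : 'X_{1..r + r}) : 'rV[int]_r :=
  \row_j ((mu (lshift r j))%:Z - (mu (rshift r j))%:Z).

Lemma monom_chr (mu : 'X_{1..r + r}) t : diag_set t ->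
  \prod_i t 0 i ^+ mu i = chr (wexp mu) t.
Proof.
move=> Dt; rewrite big_split_ord /= -big_split; apply: eq_bigr => j _ /=.
by rewrite mxE expfzDr ?diag_coord_neq0 // -exprz_inv -diag_coord_inv.
Qed.

Lemma mpoly_chr (p : {mpoly k[r + r]}) t : diag_set t ->
  p.@[t 0] = \sum_(mu <- msupp p) p@_mu * chr (wexp mu) t.
Proof.
move=> Dt; rewrite mevalE; apply: eq_bigr => mu _.
by rewrite monom_chr.
Qed.

End Characters.

(** * The character group of [K] and the independence of characters *)

Section CharacterGroup.
Variables (k : closedFieldType) (r : nat) (K : 'rV[k]_(r + r) -> Prop).
Hypothesis K_diag : forall t, K t -> diag_set t.
Hypothesis K_one : K (const_mx 1).
Hypothesis K_mul : forall t s, K t -> K s -> K (tmul t s).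

Definition trivial_chr (e : 'rV[int]_r) := forall t, K t -> chr e t = 1.

Variables (M : zmodType) (pr : {additive 'rV[int]_r -> M}) (rp : M -> 'rV[int]_r).
Hypothesis rpK : cancel rp pr.
Hypothesis pr_eq0 : forall e, pr e = 0 <-> trivial_chr e.

(** For [t] in [K] the value does not depend on the representative; [M] is the group of restrictions
    of characters to [K]. *)
Definition qchr (q : M) (t : 'rV[k]_(r + r)) := chr (rp q) t.

Lemma qchr_pr e t : K t -> qchr (pr e) t = chr e t.
Proof.
move=> Kt; have Dt := K_diag Kt.
have /pr_eq0/(_ _ Kt) : pr (rp (pr e) - e) = 0 by rewrite raddfB rpK subrr.
rewrite chrB // => h; apply: (divIf (chr_neq0 e Dt)).
by rewrite h divff // chr_neq0.
Qed.

Lemma qchr_neq0 q t : K t -> qchr q t != 0.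
Proof. by move=> Kt; apply/chr_neq0/K_diag. Qed.

Lemma qchrD q q' t : K t -> qchr (q + q') t = qchr q t * qchr q' t.
Proof.
move=> Kt; rewrite -{1}[q]rpK -{1}[q']rpK -raddfD qchr_pr //.
by rewrite chrD //; apply: K_diag.
Qed.

Lemma qchr0 t : K t -> qchr 0 t = 1.
Proof. by move=> Kt; rewrite -(raddf0 pr) qchr_pr // chr0. Qed.

Lemma qchr_sum (I : Type) (l : seq I) (P : pred I) (F : I -> M) t :
  K t -> qchr (\sum_(i <- l | P i) F i) t = \prod_(i <- l | P i) qchr (F i) t.
Proof.
move=> Kt; elim/big_rec2: _ => [|i e p _ <-]; first exact: qchr0.
exact: qchrD.
Qed.

Lemma qchr_one q : qchr q (const_mx 1) = 1.
Proof. by rewrite /qchr /chr big1 // => j _; rewrite mxE exp1rz. Qed.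

Lemma qchrM q t s : qchr q (tmul t s) = qchr q t * qchr q s.
Proof. exact: chrM. Qed.

Lemma qchr_sep q q' : q != q' -> exists2 t, K t & qchr q t != qchr q' t.
Proof.
move=> ne; apply: NNPP => h; case/negP: ne; rewrite -subr_eq0; apply/eqP.
rewrite -[q]rpK -[q']rpK -raddfB; apply/pr_eq0 => t Kt.
have Dt := K_diag Kt; rewrite chrB //.
have [e|ne] := eqVneq (qchr q t) (qchr q' t); last by case: h; exists t.
by rewrite -/(qchr q t) e divff // chr_neq0.
Qed.

(** Dedekind's argument: from the relation at [tmul t u] subtract the relation at [t] multiplied by
    the value of [q0] at [u]. The term of [q0] drops out, and [u] is chosen to separate [q] from
    [q0]. *)
Lemma chr_indep (s : seq M) (c : M -> k) : uniq s ->
  (forall t, K t -> \sum_(q <- s) c q * qchr q t = 0) -> forall q, q \in s -> c q = 0.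
Proof.
elim: s c => // q0 s IH c /= /andP[q0s us] rel.
have cs q : q \in s -> c q = 0.
  move=> qs; have /qchr_sep[u Ku nu] : q != q0 by apply: contraNneq q0s => <-.
  have h t : K t -> \sum_(q <- s) (c q * (qchr q u - qchr q0 u)) * qchr q t = 0.
    move=> Kt; have := rel _ (K_mul Kt Ku); have := congr1 ( *%R (qchr q0 u)) (rel _ Kt).
    rewrite !big_cons mulr0 mulrDr => e1; rewrite qchrM => e2.
    transitivity (c q0 * (qchr q0 t * qchr q0 u) + \sum_(v <- s) c v * qchr v (tmul t u) -
      (qchr q0 u * (c q0 * qchr q0 t) + qchr q0 u * \sum_(v <- s) c v * qchr v t)).
      rewrite opprD addrACA (_ : _ - _ = 0 :> k) ?add0r; last by ring.
      rewrite mulr_sumr -sumrB; apply: eq_bigr => v _.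
      by rewrite qchrM; ring.
    by rewrite e1 e2 subrr.
  have /eqP := IH _ us h q qs.
  by rewrite mulf_eq0 subr_eq0 (negPf nu) orbF => /eqP.
move=> q; rewrite inE => /orP[/eqP ->|/cs//].
have := rel _ K_one; rewrite big_cons big_seq big1 => [/eqP|v /cs ->]; last by rewrite mul0r.
by rewrite addr0 mulf_eq0 (negPf (qchr_neq0 _ K_one)) orbF => /eqP.
Qed.

Lemma chr_indep_mpoly n (s : seq M) (c : M -> {mpoly k[n]}) : uniq s ->
  (forall t, K t -> \sum_(q <- s) qchr q t *: c q = 0) -> forall q, q \in s -> c q = 0.
Proof.
move=> us rel q qs; apply/mpolyP=> mu; rewrite mcoeff0.
apply: (chr_indep (c := fun q => (c q)@_mu) us _ qs) => t Kt.
have /(congr1 (mcoeff mu)) := rel t Kt; rewrite mcoeff0 raddf_sum /= => E.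
by rewrite -[RHS]E; apply: eq_bigr => v _; rewrite mcoeffZ mulrC.
Qed.

End CharacterGroup.

(** * The grading defined by an action *)

Section ActionGrading.
Variables (k : closedFieldType) (char0 : [pchar k] =i pred0).
Variables (r : nat) (K : 'rV[k]_(r + r) -> Prop).
Hypothesis K_diag : forall t, K t -> diag_set t.
Hypothesis K_one : K (const_mx 1).
Hypothesis K_mul : forall t s, K t -> K s -> K (tmul t s).
Variables (M : zmodType) (pr : {additive 'rV[int]_r -> M}) (rp : M -> 'rV[int]_r).
Hypothesis rpK : cancel rp pr.
Hypothesis pr_eq0 : forall e, pr e = 0 <-> trivial_chr K e.
Variables (n : nat) (psi : 'rV[k]_(r + r) -> polymap k n n) (F : polymap k (r + r + n) n).
Hypothesis psi1 : psi (const_mx 1) = pid k n.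
Hypothesis psiM : forall t s, K t -> K s -> psi (tmul t s) = pcomp (psi t) (psi s).
Hypothesis psiF : forall t a, K t -> peval (psi t) a = peval F (row_mx t a).
Hypothesis psiJ : forall t, K t -> jac (psi t) = 1.
Notation A := {mpoly k[n]}.
Notation qchr := (qchr rp).
Implicit Types (p : A) (q : M).

Let mt (mm : 'X_{1..r + r + n}) : 'X_{1..r + r} := [multinom mm (lshift n i) | i < r + r].
Let mx (mm : 'X_{1..r + r + n}) : 'X_{1..n} := [multinom mm (rshift (r + r) i) | i < n].
Let qw mm := pr (wexp (mt mm)).

(** Composition with the action morphism gives a polynomial in (t, x); this collects the monomials
    whose part in [t] restricts to the character [q] on [K]. *)
Definition act_pi q p : A :=
  \sum_(mm <- msupp (p \mPo F) | qw mm == q) (p \mPo F)@_mm *: 'X_[mx mm].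

Definition act_supp p := undup (map qw (msupp (p \mPo F))).

Lemma act_sum p t : K t -> p \mPo psi t = \sum_(q <- act_supp p) qchr q t *: act_pi q p.
Proof.
move=> Kt; have Dt := K_diag Kt; transitivity
  (\sum_(mm <- msupp (p \mPo F)) (chr (wexp (mt mm)) t * (p \mPo F)@_mm) *: 'X_[mx mm] : A).
  apply: (mpoly_eq_eval char0) => v; rewrite comp_mpoly_meval raddf_sum /=.
  transitivity (p.@[peval F (row_mx t (\row_i v i)) 0]).
    rewrite -psiF //; apply: meval_eq => i; rewrite mxE.
    by apply: meval_eq => j; rewrite mxE.
  transitivity ((p \mPo F).@[row_mx t (\row_i v i) 0]).
    by rewrite comp_mpoly_meval; apply: meval_eq => i; rewrite mxE.
  rewrite mevalE; apply: eq_bigr => mm _.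
  rewrite mevalZ mevalX big_split_ord /= mulrA; congr (_ * _).
    rewrite mulrC; congr (_ * _); rewrite -monom_chr //; apply: eq_bigr => i _.
    by rewrite row_mxEl mnmE.
  by apply: eq_bigr => i _; rewrite row_mxEr mxE mnmE.
transitivity (\sum_(q <- act_supp p) \sum_(mm <- msupp (p \mPo F) | qw mm == q)
    (chr (wexp (mt mm)) t * (p \mPo F)@_mm) *: 'X_[mx mm] : A).
  rewrite (exchange_big_dep predT) //= big_seq [RHS]big_seq; apply: eq_bigr => mm mmS.
  rewrite big_mkcond (bigD1_seq (qw mm)) ?undup_uniq ?mem_undup ?map_f //= eqxx.
  by rewrite big1 ?addr0 // => q; rewrite eq_sym => /negPf ->.
apply: eq_bigr => q _; rewrite scaler_sumr; apply: eq_bigr => mm /eqP <-.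
by rewrite scalerA (qchr_pr K_diag rpK pr_eq0).
Qed.

Let act_pi_out q p : q \notin act_supp p -> act_pi q p = 0.
Proof.
move=> nq; rewrite /act_pi big_seq_cond big1 // => mm /andP[mmS /eqP e].
by case/negP: nq; rewrite mem_undup -e map_f.
Qed.

(** Characters being independent, an expansion of [p \mPo psi t] in characters has unique
    coefficients. Additivity, homogeneity and the action on semi-invariants follow by exhibiting an
    expansion. *)
Lemma act_pi_unique p (s : seq M) (c : M -> A) : uniq s ->
  (forall t, K t -> p \mPo psi t = \sum_(q <- s) qchr q t *: c q) ->
  forall q, act_pi q p = if q \in s then c q else 0.
Proof.
move=> us pE q; pose c' q := if q \in s then c q else 0.
pose S := undup (act_supp p ++ s).
have [qS|nS] := boolP (q \in S); last first.
  move: nS; rewrite mem_undup mem_cat negb_or => /andP[h /negPf ->].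
  exact: act_pi_out.
apply/eqP; rewrite -subr_eq0; apply/eqP; rewrite -/(c' q).
apply: (chr_indep_mpoly K_diag K_one K_mul rpK pr_eq0
  (c := fun q => act_pi q p - c' q) (undup_uniq _) _ qS) => t Kt.
transitivity ((p \mPo psi t) - (p \mPo psi t)); last by rewrite subrr.
rewrite {1}act_sum // [in X in _ = _ - X]pE //.
rewrite (eq_bigr (fun q => qchr q t *: act_pi q p - qchr q t *: c' q)); last first.
  by move=> q' _; rewrite scalerBr.
rewrite sumrB; congr (_ - _).
  apply: big_uniq_supp; rewrite ?undup_uniq // => q' nz.
    rewrite mem_undup mem_cat; apply/orP; left; apply: contraNT nz => /act_pi_out ->.
    by rewrite scaler0.
  by apply: contraNT nz => /act_pi_out ->; rewrite scaler0.
transitivity (\sum_(q <- s) qchr q t *: c' q).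
  apply: big_uniq_supp; rewrite ?undup_uniq // => q' nz; have q's : q' \in s.
    1,3: by apply: contraNT nz; rewrite /c' => /negPf ->; rewrite scaler0.
    by rewrite mem_undup mem_cat q's orbT.
  exact: q's.
by rewrite big_seq [RHS]big_seq; apply: eq_bigr => q' q's; rewrite /c' q's.
Qed.

Definition semi_inv q p := forall t, K t -> p \mPo psi t = qchr q t *: p.

Lemma semi_inv_pi q q' p : semi_inv q p -> act_pi q' p = if q' == q then p else 0.
Proof.
move=> hp; rewrite (@act_pi_unique p [:: q] (fun=> p)) ?inE // => t Kt.
by rewrite big_seq1 hp.
Qed.

(** Expand p composed with psi t and psi s, once successively and once as psi (t s), and compare
    coefficients of characters in [t]. *)
Lemma pi_semi_inv q p : semi_inv q (act_pi q p).
Proof.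
have [qs|/act_pi_out ->] := boolP (q \in act_supp p); last first.
  by move=> t Kt; rewrite comp_mpoly0 scaler0.
move=> s Ks; apply/eqP; rewrite -subr_eq0; apply/eqP.
apply: (chr_indep_mpoly K_diag K_one K_mul rpK pr_eq0
  (c := fun q => act_pi q p \mPo psi s - qchr q s *: act_pi q p) (undup_uniq _) _ qs) => t Kt.
transitivity ((p \mPo psi t \mPo psi s) - (p \mPo psi (tmul t s))).
  rewrite [p \mPo psi t]act_sum // [p \mPo psi (tmul _ _)]act_sum; last exact: K_mul.
  rewrite raddf_sum -sumrB; apply: eq_bigr => q' _ /=.
  by rewrite comp_mpolyZ scalerBr scalerA qchrM.
by rewrite psiM // comp_mpolyA subrr.
Qed.

Lemma act_pi_fixP q p : act_pi q p = p <-> semi_inv q p.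
Proof.
split=> [<-|hp]; first exact: pi_semi_inv.
by rewrite (semi_inv_pi _ hp) eqxx.
Qed.

Lemma act_piD q : {morph act_pi q : p p' / p + p'}.
Proof.
move=> p p'; pose S := undup (act_supp p ++ act_supp p').
have ext p1 : {subset act_supp p1 <= S} -> forall t, K t ->
    p1 \mPo psi t = \sum_(q <- S) qchr q t *: act_pi q p1.
  move=> sub t Kt; rewrite act_sum //; apply: big_uniq_supp; rewrite ?undup_uniq // => q' nz.
    by apply: contraNT nz => /act_pi_out ->; rewrite scaler0.
  by apply: sub; apply: contraNT nz => /act_pi_out ->; rewrite scaler0.
have sp : {subset act_supp p <= S} by move=> x h; rewrite mem_undup mem_cat h.
have sp' : {subset act_supp p' <= S} by move=> x h; rewrite mem_undup mem_cat h orbT.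
rewrite (@act_pi_unique (p + p') S (fun q => act_pi q p + act_pi q p')) ?undup_uniq //.
  case: ifP => // /negbT nS; rewrite !act_pi_out ?addr0 //.
    by apply: contra nS; apply: sp'.
  by apply: contra nS; apply: sp.
move=> t Kt; rewrite comp_mpolyD (ext _ sp) // (ext _ sp') // -big_split.
by apply: eq_bigr => q' _; rewrite scalerDr.
Qed.

Lemma act_piZ q c p : act_pi q (c *: p) = c *: act_pi q p.
Proof.
rewrite (@act_pi_unique (c *: p) (act_supp p) (fun q => c *: act_pi q p)) ?undup_uniq //.
  by case: ifP => // /negbT nS; rewrite act_pi_out ?scaler0.
move=> t Kt; rewrite comp_mpolyZ act_sum // scaler_sumr.
by apply: eq_bigr => q' _; rewrite !scalerA mulrC.
Qed.

Lemma act_pi_pi q q' p : act_pi q (act_pi q' p) = if q == q' then act_pi q p else 0.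
Proof. by rewrite (semi_inv_pi _ (pi_semi_inv q' p)); case: eqP => // ->. Qed.

Lemma act_supp_sum p : p = \sum_(q <- act_supp p) act_pi q p.
Proof.
have := act_sum p K_one; rewrite psi1 comp_mpoly_id => e; rewrite {1}e.
by apply: eq_bigr => q _; rewrite qchr_one scale1r.
Qed.

Lemma semi_invM q q' p p' : semi_inv q p -> semi_inv q' p' -> semi_inv (q + q') (p * p').
Proof.
move=> hp hp' t Kt; rewrite rmorphM /= hp // hp' // (qchrD K_diag rpK pr_eq0) //.
by rewrite -scalerAl -scalerAr scalerA.
Qed.

(** Chain rule: Jacobian 1 of the action is what gives the volume form weight 0. *)
Lemma semi_inv_jac (y : polymap k n n) (w : 'I_n -> M) :
  (forall i, semi_inv (w i) (tnth y i)) -> semi_inv (\sum_i w i) (jac y).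
Proof.
move=> hy t Kt; have := jac_comp y (psi t); rewrite psiJ // mulr1 => <-.
rewrite (qchr_sum K_diag rpK pr_eq0) // /jac.
have -> : \matrix_(i, j) (tnth (pcomp y (psi t)) i)^`M(j) =
    diag_mx (\row_i (qchr (w i) t)%:MP) *m jacmx y.
  by apply/matrixP=> i j; rewrite mul_diag_mx !mxE tnth_mktuple hy // mderivZ mul_mpolyC.
rewrite det_mulmx det_diag -mul_mpolyC rmorph_prod; congr (_ * _).
by apply: eq_bigr => i _; rewrite mxE.
Qed.

Definition act_grading : grading k n M.
Proof.
exists act_pi act_supp.
- exact: act_piD.
- exact: act_piZ.
- exact: act_pi_pi.
- by move=> p; apply: undup_uniq.
- exact: act_supp_sum.
- by apply/act_pi_fixP => t Kt; rewrite rmorph1 (qchr0 K_diag rpK pr_eq0) // scale1r.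
- by move=> w w' p q /act_pi_fixP hp /act_pi_fixP hq; apply/act_pi_fixP/semi_invM.
- move=> y w hy; apply/act_pi_fixP/semi_inv_jac => i.
  exact/act_pi_fixP.
Defined.

End ActionGrading.

(* Partial homomorphisms to the multiplicative group of k, given by their graph. *)
Section PartialHom.
Variables (k : closedFieldType) (V : zmodType).
Implicit Types R : V -> k -> Prop.

Record phom R : Prop := PHom {
  phom0 : R 0 1;
  phom_neq0 : forall x y, R x y -> y != 0;
  phomB : forall x y x' y', R x y -> R x' y' -> R (x - x') (y / y');
  phom_ker : forall y, R 0 y -> y = 1
}.

Lemma phom_uniq R x y y' : phom R -> R x y -> R x y' -> y = y'.
Proof.
move=> HR h h'; have := phomB HR h h'; rewrite subrr => /(phom_ker HR) e.
by rewrite -[y](divfK (phom_neq0 HR h')) e mul1r.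
Qed.

Lemma phomN R x y : phom R -> R x y -> R (- x) y^-1.
Proof. by move=> HR h; have := phomB HR (phom0 HR) h; rewrite sub0r mul1r. Qed.

Lemma phomD R x y x' y' : phom R -> R x y -> R x' y' -> R (x + x') (y * y').
Proof.
by move=> HR h h'; have := phomB HR h (phomN HR h'); rewrite opprK invrK.
Qed.

Lemma phomMn R x y d : phom R -> R x y -> R (x *+ d) (y ^+ d).
Proof.
move=> HR h; elim: d => [|d IH]; first exact: (phom0 HR).
by rewrite mulrS exprS; apply: phomD.
Qed.

Lemma phomMz R x y (z : int) : phom R -> R x y -> R (x *~ z) (y ^ z).
Proof.
move=> HR h; case: z => d; first exact: phomMn.
exact: (phomN HR (phomMn d.+1 HR h)).
Qed.

Lemma phom_sum R (I : Type) (l : seq I) (x : I -> V) (y : I -> k) : phom R ->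
  (forall i, R (x i) (y i)) -> R (\sum_(i <- l) x i) (\prod_(i <- l) y i).
Proof.
move=> HR h; elim/big_rec2: _ => [|i a b _]; first exact: (phom0 HR).
exact: phomD.
Qed.

(** If some positive multiple of [v] lies in the domain, take the least one, d v, and a d-th root
    [z] of its value; by Euclidean division only multiples of d v lie in the domain. Otherwise only
    a = 0 occurs and z = 1 serves. *)
Lemma phom_root R v : phom R -> exists2 z : k, z != 0 &
  forall (a : int) y, R (v *~ a) y -> y = z ^ a.
Proof.
move=> HR; have [[d [d0 [y Rd]] dmin]|none] := classic (exists2 d,
    (0 < d)%N /\ (exists y, R (v *+ d) y) &
    forall d', (0 < d')%N -> (exists y, R (v *+ d') y) -> (d <= d')%N); last first.
  have vn a y : R (v *~ a) y -> a = 0.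
    move=> Ra; apply/eqP/negPn/negP => a0; apply: none.
    have : exists d, (0 < d)%N /\ exists y, R (v *+ d) y.
      exists `|a|%N; rewrite absz_gt0; split=> //.
      case: a Ra {a0} => d Ra; first by exists y.
      by exists y^-1; have := phomN HR Ra; rewrite NegzE mulrNz opprK.
    case=> d; have [s] := ubnP d; elim: s d => // s IH d ds [d0 Rd].
    have [[d' [[d'0 Rd'] lt]]|nd] :=
      classic (exists d', ((0 < d')%N /\ exists y, R (v *+ d') y) /\ (d' < d)%N).
      by apply: (IH d') => //; apply: leq_trans lt _.
    exists d => // d' d'0 Rd'; rewrite leqNgt; apply/negP => lt.
    by apply: nd; exists d'.
  exists 1; first exact: oner_neq0.
  by move=> a y /[dup] /vn ->; rewrite mulr0z => /(phom_ker HR).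
have [z zd] : exists z, z ^+ d = y.
  have /closed_rootP[z] : size ('X^d - y%:P) != 1%N by rewrite size_XnsubC // -lt0n.
  by rewrite /root hornerD hornerN hornerXn hornerC subr_eq0 => /eqP; exists z.
have z0 : z != 0.
  by apply: contraTneq (phom_neq0 HR Rd) => z0; rewrite -zd z0 expr0n eqn0Ngt d0 eqxx.
exists z => // a y' Ra.
have da : (a %% d)%Z = 0.
  have am : (0 <= (a %% d)%Z)%R by apply: modz_ge0; rewrite -lt0n.
  have alt : (`|(a %% d)%Z| < d)%N by have := ltz_pmod a (_ : 0 < d%:Z)%R; lia.
  apply/eqP; rewrite -absz_eq0; apply/negPn; rewrite -lt0n; apply/negP => gt0.
  have : (d <= `|(a %% d)%Z|)%N.
    apply: dmin => //; exists (y' / y ^ (a %/ d)%Z).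
    have -> : v *+ `|(a %% d)%Z| = v *~ a - v *+ d *~ (a %/ d)%Z.
      rewrite -[v *+ d]/(v *~ d%:Z) -mulrzA -mulrzBr -[v *+ _]/(v *~ `|(a %% d)%Z|%N%:Z).
      by rewrite gez0_abs // /modz [d%:Z * _]mulrC.
    by apply: phomB => //; apply: phomMz.
  by rewrite leqNgt alt.
have aE : a = (d%:Z * (a %/ d)%Z)%R by rewrite {1}(divz_eq a d) da addr0 mulrC.
have := phomMz (a %/ d)%Z HR Rd; rewrite -[v *+ d]/(v *~ d%:Z) -mulrzA -aE => h.
rewrite (phom_uniq HR Ra h) -zd -[z ^+ d]/(z ^ d%:Z) exprz_exp.
by rewrite -aE.
Qed.

(** Give [v] the value from [phom_root]; its compatibility with the values already fixed makes the
    extension single-valued. *)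
Lemma phom_ext1 R v : phom R -> exists R', [/\ phom R', forall x y, R x y -> R' x y &
  exists z, R' v z].
Proof.
move=> HR; have [z z0 zP] := phom_root v HR.
exists (fun x y => exists x0 y0 (a : int), [/\ R x0 y0, x = x0 + v *~ a & y = y0 * z ^ a]).
split; last 2 first.
- by move=> x y Rx; exists x, y, 0; rewrite mulr0z addr0 expr0z mulr1.
- by exists z, 0, 1, 1; rewrite add0r mulr1z mul1r expr1z; split=> //; apply: phom0.
split.
- by exists 0, 1, 0; rewrite mulr0z addr0 expr0z mulr1; split=> //; apply: phom0.
- by move=> _ _ [x [y [a [Rx _ ->]]]]; rewrite mulf_neq0 ?expfz_neq0 // (phom_neq0 HR Rx).
- move=> _ _ _ _ [x [y [a [Rx -> ->]]]] [x' [y' [a' [Rx' -> ->]]]].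
  exists (x - x'), (y / y'), (a - a'); split; first exact: phomB.
    by rewrite mulrzBr opprD addrACA.
  by rewrite expfzDr // -invr_expz invfM mulrACA.
- move=> _ [x [y [a [Rx e ->]]]].
  have : R (v *~ - a) y by rewrite mulrNz -[- _]add0r e addrK.
  by move/zP => ->; rewrite -expfzDr // addNr expr0z.
Qed.

Lemma phom_ext R (l : seq V) : phom R -> exists R', [/\ phom R', forall x y, R x y -> R' x y &
  forall v, v \in l -> exists z, R' v z].
Proof.
move=> HR; elim: l => [|v l [R1 [HR1 sub1 all1]]]; first by exists R.
have [R2 [HR2 sub2 [z Rz]]] := phom_ext1 v HR1.
exists R2; split=> // [x y /sub1/sub2//|u]; rewrite inE => /orP[/eqP ->|/all1[y /sub2]].
  by exists z.
by exists y.
Qed.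

End PartialHom.

(** Extend to the unit vectors of the lattice; their values are the coordinates of [t]. *)
Lemma chr_ext (k : closedFieldType) r (R : 'rV[int]_r -> k -> Prop) : phom R ->
  exists2 t : 'rV[k]_(r + r), diag_set t & forall e y, R e y -> chr e t = y.
Proof.
move=> HR; have [R' [HR' sub allE]] := phom_ext [seq delta_mx 0 j | j : 'I_r] HR.
have /fin_all_exists[z zP] (j : 'I_r) : exists z, R' (delta_mx 0 j) z.
  by apply: allE; apply: map_f; rewrite mem_enum.
pose t : 'rV[k]_(r + r) := row_mx (\row_j z j) (\row_j (z j)^-1).
exists t => [j|e y /sub Re].
  by rewrite row_mxEl row_mxEr !mxE divff // (phom_neq0 HR' (zP j)).
apply: (phom_uniq HR' _ Re); rewrite (row_sum_delta e) /chr.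
have -> : \prod_j t 0 (lshift r j) ^ (\sum_j0 e 0 j0 *: delta_mx 0 j0 : 'rV_r) 0 j =
    \prod_j z j ^ e 0 j.
  apply: eq_bigr => j _; rewrite -row_sum_delta row_mxEl mxE.
  by [].
apply: phom_sum => // j; rewrite -[e 0 j *: _]/(e 0 j *: delta_mx 0 j).
have -> : e 0 j *: delta_mx 0 j = (delta_mx 0 j : 'rV[int]_r) *~ e 0 j.
  by rewrite -scaler_int intz.
exact: phomMz.
Qed.

(** [d] is the determinant and [u] comes from the adjugate, both integral. The sizes are equated by
    a hypothesis because they arise as different expressions. *)
Lemma int_cramer (k : fieldType) s r (Z : 'M[int]_(s, r)) : s = r ->
  row_free (map_mx intr Z : 'M[k]_(s, r)) ->
  exists2 d : int, d != 0 & forall e : 'rV[int]_r, exists u : 'rV_s, d *: e = u *m Z.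
Proof.
move=> sr; subst s; rewrite row_free_unit unitmxE unitfE -[\det _]/(\det (map_mx intr Z)).
rewrite (det_map_mx (intr : {rmorphism int -> k})) => dZ; exists (\det Z).
  by apply: contraNneq dZ => ->.
move=> e; exists (e *m \adj Z).
by rewrite -mulmxA mul_adj_mx mul_mx_scalar.
Qed.

(** * Points, rank and Lie algebra of a diagonalizable group *)

Section DiagonalizableGroup.
Variables (k : closedFieldType) (char0 : [pchar k] =i pred0).
Variables (r : nat) (K : 'rV[k]_(r + r) -> Prop).
Hypothesis K_closed : zariski_closed K.
Hypothesis K_diag : forall t, K t -> diag_set t.
Hypothesis K_one : K (const_mx 1).
Hypothesis K_mul : forall t s, K t -> K s -> K (tmul t s).

Lemma trivial_chr0 : trivial_chr K 0.
Proof. by move=> t _; apply: chr0. Qed.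

Lemma trivial_chrB e e' : trivial_chr K e -> trivial_chr K e' -> trivial_chr K (e - e').
Proof. by move=> h h' t Kt; rewrite chrB ?h ?h' ?divr1 //; apply: K_diag. Qed.

Notation ik := (map_mx (intr : int -> k)).

Section CharGroup.
Variables (M : zmodType) (pr : {additive 'rV[int]_r -> M}) (rp : M -> 'rV[int]_r).
Hypothesis rpK : cancel rp pr.
Hypothesis pr_eq0 : forall e, pr e = 0 <-> trivial_chr K e.

(* Dedekind's independence of characters makes K the common kernel of the
   characters that are trivial on it. *)
Lemma mem_of_chr t : diag_set t -> (forall e, trivial_chr K e -> chr e t = 1) -> K t.
Proof.
move=> Dt ht; have [I KI] := K_closed; apply/KI => p Ip.
pose S := undup [seq pr (wexp mu) | mu <- msupp p].
pose c q := \sum_(mu <- msupp p | pr (wexp mu) == q) p@_mu.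
have pE s (h : M -> k) : diag_set s -> (forall e, chr e s = h (pr e)) ->
    p.@[s 0] = \sum_(q <- S) c q * h q.
  move=> Ds hE; rewrite mpoly_chr //.
  transitivity (\sum_(q <- S) \sum_(mu <- msupp p | pr (wexp mu) == q) p@_mu * chr (wexp mu) s).
    rewrite (exchange_big_dep predT) //= big_seq [RHS]big_seq; apply: eq_bigr => mu muS.
    rewrite big_mkcond (bigD1_seq (pr (wexp mu))) ?undup_uniq ?mem_undup ?(map_f (fun mu => pr (wexp mu))) //= eqxx.
    by rewrite big1 ?addr0 // => q; rewrite eq_sym => /negPf ->.
  apply: eq_bigr => q _; rewrite mulr_suml; apply: eq_bigr => mu /eqP <-.
  by rewrite hE.
have c0 : forall q, q \in S -> c q = 0.
  apply: (chr_indep K_diag K_one K_mul rpK pr_eq0 (undup_uniq _)) => s Ks.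
  rewrite -(pE s (fun q => qchr rp q s)); first exact: ((KI s).1 Ks).
    exact: K_diag.
  by move=> e; rewrite (qchr_pr K_diag rpK pr_eq0).
rewrite (pE t (fun q => chr (rp q) t)) // => [|e].
  by rewrite big_seq big1 // => q /c0 ->; rewrite mul0r.
have : chr (e - rp (pr e)) t = 1 by apply/ht/pr_eq0; rewrite raddfB rpK subrr.
rewrite chrB // => h; rewrite -[LHS](divfK (chr_neq0 (rp (pr e)) Dt)) h.
by rewrite mul1r.
Qed.

(** The source of points of [K] with prescribed properties: consistent values on some characters,
    equal to 1 on the trivial ones, are attained. *)
Lemma mem_chr_ext (R : 'rV[int]_r -> k -> Prop) : phom R ->
  (forall e, trivial_chr K e -> R e 1) ->
  exists2 t, K t & forall e y, R e y -> chr e t = y.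
Proof.
move=> HR RL; have [t Dt tE] := chr_ext HR; exists t => //.
by apply: mem_of_chr => // e /RL/tE.
Qed.

Lemma lattice_basis : exists b (B : 'M[int]_(b, r)),
  [/\ row_free (ik B), forall i, trivial_chr K (row i B) &
      forall e, trivial_chr K e -> (ik e <= ik B)%MS].
Proof.
pose Q b := exists B : 'M[int]_(b, r), row_free (ik B) /\ forall i, trivial_chr K (row i B).
have Qr b : Q b -> (b <= r)%N.
  by case=> B [/eqP Bb _]; rewrite -[X in (X <= _)%N]Bb rank_leq_col.
have Q0 : Q 0%N by exists 0; split=> [|[]//]; rewrite /row_free -leqn0 rank_leq_row.
have [b [[B [Bfree BL]] bmax]] : exists b, Q b /\ ~ Q b.+1.
  apply: NNPP => h; have Qall b : Q b.
    by elim: b => // b IH; apply: NNPP => nQ; apply: h; exists b.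
  by have := Qr _ (Qall r.+1); rewrite ltnn.
exists b, B; split=> // e Le; apply: NNPP => /negP nle; apply: bmax.
pose B' : 'M[int]_(b + 1, r) := col_mx B e.
have B'free : row_free (ik B').
  rewrite /row_free map_col_mx -addsmxE eqn_leq -{1}[X in (_ <= X)%N]addn0.
  apply/andP; split; first by rewrite addn0 addsmxE rank_leq_row.
  have : (\rank (ik B) < \rank (ik B + ik e)%MS)%N.
    rewrite ltn_neqAle mxrankS ?addsmxSl // andbT; apply: contraNneq nle => e1.
    have [_] := mxrank_leqif_eq (addsmxSl (ik B) (ik e)).
    rewrite e1 eqxx => /esym/andP[_ h].
    by apply: submx_trans h; apply: addsmxSr.
  by move/eqP: Bfree => ->; rewrite addn1.
rewrite -[b.+1]addn1; exists B'; split=> // i.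
rewrite -[i]splitK; case: (split i) => j /=; first by rewrite rowKu.
by rewrite rowKd row_id.
Qed.

End CharGroup.

Lemma trivial_chr_comb b (B : 'M[int]_(b, r)) (v : 'rV_b) :
  (forall i, trivial_chr K (row i B)) -> trivial_chr K (v *m B).
Proof.
move=> BL t Kt; rewrite mulmx_sum_row chr_sum; last exact: K_diag.
by rewrite big1 // => i _; rewrite chrZ BL // exp1rz.
Qed.

(** The columns of [Delta] are a basis of the vectors orthogonal to all trivial characters, that is,
    of the Lie algebra of [K]. For the last clause, [X] stacked on a basis [B] of the span of the
    trivial characters is square and invertible over [k], so integral Cramer writes a multiple of
    [e] through the rows of [X] and trivial characters. *)
Lemma char_weights : exists rho (Delta : 'M[k]_(r, rho)),
  [/\ forall e, trivial_chr K e -> ik e *m Delta = 0,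
      forall c : 'cV_rho, Delta *m c = 0 -> c = 0,
      exists X : 'M[int]_(rho, r), \det (ik X *m Delta) != 0 &
      forall X : 'M[int]_(rho, r), \det (ik X *m Delta) != 0 ->
        exists2 N, (0 < N)%N & forall e, exists a : 'rV[int]_rho,
          trivial_chr K (e *+ N - a *m X)].
Proof.
have [b [B [Bfree BL Bmax]]] := lattice_basis.
pose C := cokermx (ik B); exists (\rank C), (col_base C).
have kill s (A : 'M[k]_(s, r)) : A *m C = 0 -> A *m col_base C = 0.
  move=> AC; have /row_freeP[D RD] := row_base_free C.
  by rewrite -[LHS]mulmx1 -RD mulmxA -[A *m _ *m _]mulmxA mulmx_base AC mul0mx.
have BD : ik B *m col_base C = 0 by apply: kill; apply: mulmx_coker.
split.
- by move=> e /Bmax; rewrite submxE => /eqP; apply: kill.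
- move=> c Dc; have /row_fullP[D DC] := col_base_full C.
  by rewrite -[c]mul1mx -DC -mulmxA Dc mulmx0.
- pose f := fullrankfun (col_base_full C).
  exists (\matrix_i delta_mx 0 (f i)).
  have -> : ik (\matrix_i delta_mx 0 (f i)) *m col_base C = rowsub f (col_base C).
    apply/row_matrixP=> i; rewrite row_mul -map_row rowK map_delta_mx -rowE.
    by apply/rowP=> j; rewrite !mxE.
  have := fullrowsub_unit (col_base_full C).
  by rewrite unitmxE unitfE.
move=> X dX; have rE : (\rank C + b = r)%N.
  have /eqP Bb := Bfree; rewrite /C mxrank_coker Bb subnK //.
  by rewrite -[X in (X <= _)%N]Bb rank_leq_col.
have Zfree : row_free (ik (col_mx X B)).
  rewrite map_col_mx; apply: inj_row_free => v; rewrite -[v]hsubmxK mul_row_col => v0.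
  have := congr1 (mulmx^~ (col_base C)) v0.
  rewrite mulmxDl -!mulmxA BD mulmx0 addr0 mul0mx => v1X.
  have v1 : lsubmx v = 0.
    have u : ik X *m col_base C \in unitmx by rewrite unitmxE unitfE.
    by rewrite -[lsubmx v](mulmxK u) v1X mul0mx.
  move: v0; rewrite v1 mul0mx add0r => v2B.
  have /row_freeP[D BDi] := Bfree.
  by rewrite -[rsubmx v]mulmx1 -BDi mulmxA v2B mul0mx row_mx0.
have [d d0 dP] := int_cramer rE Zfree.
exists `|d|%N; first by rewrite absz_gt0.
have [s sd] : exists s : int, s * d = `|d|%N%:Z.
  by exists (if (0 <= d)%R then 1 else -1); case: ifP; lia.
move=> e; have [u uE] := dP e; exists (s *: lsubmx u).
have -> : e *+ `|d|%N - (s *: lsubmx u) *m X = (s *: rsubmx u) *m B.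
  have -> : e *+ `|d|%N = s *: (d *: e).
    by rewrite scalerA sd -scaler_nat natz.
  rewrite uE -{1}[u]hsubmxK mul_row_col scalerDr !scalemxAl addrC addKr.
  by [].
exact: trivial_chr_comb.
Qed.

End DiagonalizableGroup.

(** * Dimension *)

Section AlgebraicIndependence.
Variables (k : closedFieldType) (N : nat).
Implicit Types X : 'rV[k]_N -> Prop.

Definition alg_free X d (g : 'I_d -> {mpoly k[N]}) :=
  forall P : {mpoly k[d]}, (forall x, X x -> P.@[fun i => (g i).@[x 0]] = 0) -> P = 0.

Lemma zero_set_closed (p : {mpoly k[N]}) : zariski_closed (fun x => p.@[x 0] = 0).
Proof.
by exists (eq p) => x; split=> [px q <-|h]; last exact: h.
Qed.

(** Each step of the chain adds a function [p] that vanishes on the smaller set but not on the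
    larger. In a relation on the larger set between [p] and the earlier functions, powers of [p]
    cancel by irreducibility; restriction to the smaller set then leaves a relation among the
    earlier ones. *)
Lemma chain_alg_free X d C : irreducible_chain X d C ->
  exists g : 'I_d -> {mpoly k[N]}, alg_free X g.
Proof.
suff H : irreducible_chain X d C -> exists g : 'I_d -> {mpoly k[N]}, alg_free (C d) g.
  move=> hC; have [g gP] := H hC; exists g => P PX; apply: gP => x Cx; apply: PX.
  by case: hC => /(_ d (leqnn d))[_ _ sub] _; apply: sub.
elim: d => [|d IH] [hC hS].
  have [_ [[x Cx] _] _] := hC 0%N (leqnn _).
  exists (fun=> 0) => P /(_ x Cx); rewrite (nvar0_mpolyC P) mevalC => ->.
  by rewrite mpolyC0.
have [g gP] : exists g : 'I_d -> {mpoly k[N]}, alg_free (C d) g.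
  apply: IH; split=> i lei; first by apply: hC; apply: leq_trans lei (leqnSn _).
  by apply: hS; apply: leq_trans lei (leqnSn _).
have [sub nsub] := hS d (ltnSn d).
have [[I CI] _ _] := hC d (leqnSn d); have [_ [_ irr] _] := hC d.+1 (leqnn _).
have [p [x1 [Cx1 px1 pC]]] : exists p x1,
    [/\ C d.+1 x1, p.@[x1 0] != 0 & forall x, C d x -> p.@[x 0] = 0].
  apply: NNPP => h; apply: nsub => x Cx; apply/CI => p Ip; apply: NNPP => /eqP px.
  by apply: h; exists p, x; split=> // y /CI; apply.
pose g' i := if unlift ord_max i is Some j then g j else p.
exists g' => P PC; apply/eqP/negPn/negP => P0.
have [m mP] : exists m, P@_m != 0 by exists (mlead P); rewrite mleadc_eq0.
have uP : muni P != 0.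
  by apply: contraNneq mP => uP; rewrite -mcoeff_muni uP coef0 mcoeff0.
have [j [Q]] := multiplicity_XsubC (muni P) 0; rewrite uP polyC0 subr0 /= => Q0 PQ.
pose gt := [tuple g i | i < d].
pose q : {mpoly k[N]} := (map_poly (comp_mpoly gt) Q).[p].
have qE x : q.@[x 0] = (map_poly (meval (fun i => (g i).@[x 0])) Q).[p.@[x 0]].
  rewrite /q -horner_map -map_poly_comp /=; congr (_.[_]).
  apply: eq_map_poly => c /=; rewrite comp_mpoly_meval; apply: meval_eq => i.
  by rewrite tnth_mktuple.
have PE x : C d.+1 x -> q.@[x 0] * p.@[x 0] ^+ j = 0.
  move=> Cx; rewrite -(PC x Cx) meval_muni {2}/g' unlift_none PQ rmorphM /= map_polyXn.
  rewrite hornerM hornerXn qE; congr (_.[_] * _); apply: eq_map_poly => c.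
  apply: meval_eq => i; rewrite /g'.
  suff -> : widen_ord (leqnSn d) i = lift ord_max i by rewrite liftK.
  by apply/val_inj; rewrite /= /bump leqNgt ltn_ord.
have [] := irr _ _ (zero_set_closed q) (zero_set_closed p).
- move=> x /PE/eqP; rewrite mulf_eq0 expf_eq0 => /orP[/eqP|/andP[_ /eqP]]; first by left.
  by right.
- move=> Cq; case/negP: Q0; rewrite /root horner_coef0; apply/eqP/gP => x Cx.
  have := Cq x (sub x Cx); rewrite qE (pC x Cx) horner_coef0 coef_map.
  exact.
- by move=> /(_ x1 Cx1) e; rewrite e eqxx in px1.
Qed.

End AlgebraicIndependence.

Section DegreeBound.
Variables (k : closedFieldType) (n : nat).

Definition deg_le (p : {mpoly k[n]}) e := forall mu, mu \in msupp p -> (mdeg mu <= e)%N.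

Lemma deg_leM p q e e' : deg_le p e -> deg_le q e' -> deg_le (p * q) (e + e').
Proof.
move=> hp hq mu /msuppM_le /allpairsP[[m1 m2] /= [h1 h2 ->]].
by rewrite mdegD leq_add ?hp ?hq.
Qed.

Lemma deg_leX p e d : deg_le p e -> deg_le (p ^+ d) (d * e).
Proof.
move=> hp; elim: d => [|d IH]; last by rewrite exprS mulSn; apply: deg_leM.
by move=> mu; rewrite expr0 mcoeff_msupp mcoeff1; case: (eqVneq mu 0%MM) => [->|_]; rewrite ?mdeg0 ?eqxx.
Qed.

Lemma deg_le_prod (I : Type) (s : seq I) (F : I -> {mpoly k[n]}) (e : I -> nat) :
  (forall i, deg_le (F i) (e i)) -> deg_le (\prod_(i <- s) F i) (\sum_(i <- s) e i).
Proof.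
move=> h; elim/big_rec2: _ => [mu|i a p _]; last exact: deg_leM.
by rewrite mcoeff_msupp mcoeff1; case: (eqVneq mu 0%MM) => [->|_]; rewrite ?mdeg0 ?eqxx.
Qed.

End DegreeBound.

Section CountingCharacters.
Variables (k : closedFieldType) (r : nat) (K : 'rV[k]_(r + r) -> Prop).
Hypothesis K_diag : forall t, K t -> diag_set t.
Variables (M : zmodType) (pr : {additive 'rV[int]_r -> M}) (rp : M -> 'rV[int]_r).
Hypothesis rpK : cancel rp pr.
Hypothesis pr_eq0 : forall e, pr e = 0 <-> trivial_chr K e.
Variables (rho N : nat) (w : 'I_rho -> M) (a : 'I_(r + r) -> 'I_rho -> int).
Hypothesis N_gt0 : (0 < N)%N.
Let g (i : 'I_(r + r)) := pr (wexp U_(i)%MM).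
Hypothesis gN : forall i, g i *+ N = \sum_j w j *~ a i j.

Let pr_wexp mu : pr (wexp mu) = \sum_i g i *+ mu i.
Proof.
have -> : wexp mu = \sum_i wexp U_(i)%MM *+ mu i.
  apply/rowP=> j; rewrite mxE summxE.
  have E i : (wexp U_(i)%MM *+ mu i) 0 j =
      ((i == lshift r j)%:Z - (i == rshift r j)%:Z) *+ mu i.
    by rewrite -scaler_nat !mxE !mnm1E mulr_natl.
  rewrite (eq_bigr _ (fun i _ => E i)) (bigD1 (lshift r j)) //= (bigD1 (rshift r j)) /=; last first.
    by rewrite eq_sym eq_lrshift.
  rewrite big1 => [|i /andP[/negPf -> /negPf ->]]; last by rewrite subrr mul0rn.
  rewrite !eqxx eq_lrshift [rshift r j == _]eq_sym eq_lrshift subr0 sub0r addr0.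
  by rewrite mulNrn; congr (_ - _); apply: esym (natz _).
by rewrite raddf_sum; apply: eq_bigr => i _; rewrite raddfMn.
Qed.

Let A := (\sum_i \sum_j `|a i j|)%N.

Let cf (mu : 'X_{1..r + r}) j : int := \sum_i a i j * (mu i %/ N)%N%:Z.

Let cf_le mu j e : (mdeg mu <= e)%N -> (`|cf mu j| <= e * A)%N.
Proof.
move=> le; apply: (@leq_trans (\sum_i `|a i j| * mu i)).
  rewrite /cf; elim/big_rec2: _ => [//|i x y _ h].
  have : (mu i %/ N <= mu i)%N by apply: leq_div.
  move: (mu i %/ N)%N => z zle.
  have : (`|(a i j * z%:Z)%R| <= `|a i j| * mu i)%N by rewrite abszM leq_mul2l zle orbT.
  by move=> h'; lia.
rewrite /A mulnC big_distrl /=; apply: leq_sum => i _; apply: leq_mul.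
  by rewrite (bigD1 j) //= leq_addr.
by apply: leq_trans le; rewrite mdegE (bigD1 i) //= leq_addr.
Qed.

(** Division of each exponent by [N] splits the character of a monomial into an integer combination
    of the [w j] and a remainder with exponents below [N]. In degree at most [e] the coefficients
    lie between -eA and eA; they are shifted by eA to become natural numbers. *)
Let Val e (u : {ffun 'I_rho -> 'I_(e * A + e * A).+1} * {ffun 'I_(r + r) -> 'I_N}) : M :=
  \sum_j w j *~ ((u.1 j : nat)%:Z - (e * A)%:Z) + \sum_i g i *+ u.2 i.

Let code e mu : {ffun 'I_rho -> 'I_(e * A + e * A).+1} * {ffun 'I_(r + r) -> 'I_N} :=
  ([ffun j => inord `|(cf mu j + (e * A)%:Z)%R|], [ffun i => Ordinal (ltn_pmod (mu i) N_gt0)]).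

Let code_val e mu : (mdeg mu <= e)%N -> Val (code e mu) = pr (wexp mu).
Proof.
move=> le; rewrite pr_wexp /Val /=.
transitivity (\sum_j w j *~ cf mu j + \sum_i g i *+ (mu i %% N)).
  congr (_ + _); apply: eq_bigr => j _; rewrite ffunE //.
  have h := cf_le j le; congr (_ *~ _); rewrite inordK; lia.
have -> : \sum_j w j *~ cf mu j = \sum_i g i *+ N *+ (mu i %/ N).
  transitivity (\sum_j \sum_i w j *~ a i j *+ (mu i %/ N)).
    apply: eq_bigr => j _; rewrite mulrz_sumr; apply: eq_bigr => i _.
    by rewrite mulrzA.
  by rewrite exchange_big; apply: eq_bigr => i _; rewrite gN sumrMnl.
rewrite -big_split; apply: eq_bigr => i _ /=.
by rewrite -mulrnA -mulrnDr mulnC -divn_eq.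
Qed.

(* The monomials of degree at most D in each of d functions restrict on K to
   combinations of O(D ^ rho) characters, but there are (D + 1) ^ d of them. *)
Lemma alg_free_bound d (h : 'I_d -> {mpoly k[r + r]}) : alg_free K h -> (d <= rho)%N.
Proof.
move=> hfree; rewrite leqNgt; apply/negP => rd.
pose dl := \max_i msize (h i).
(* For exponents at most [D] there are at most c (D + 1)^rho codes of characters; with D = c this is
   below (D + 1)^(rho + 1), hence below the number of products. *)
pose c := ((2 * d * dl * A).+1 ^ rho * N ^ (r + r))%N.
pose D := c; pose e := (d * D * dl)%N.
pose T := {ffun 'I_d -> 'I_D.+1}.
pose Phi : finType := ({ffun 'I_rho -> 'I_(e * A + e * A).+1} * {ffun 'I_(r + r) -> 'I_N})%type.
have lt_card : (#|{: Phi}| < #|{: T}|)%N.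
  rewrite card_prod !card_ffun !card_ord.
  have le1 : ((e * A + e * A).+1 <= (2 * d * dl * A).+1 * D.+1)%N.
    rewrite /e mulSn mulnS; lia.
  have le2 s : ((e * A + e * A).+1 ^ s <= ((2 * d * dl * A).+1 * D.+1) ^ s)%N.
    by case: s => // s; rewrite leq_exp2r.
  apply: (@leq_ltn_trans (c * D.+1 ^ rho)).
    rewrite /c mulnAC leq_mul2r; apply/orP; right.
    by rewrite -expnMn le2.
  apply: (@leq_trans (D.+1 ^ rho.+1)); last exact: leq_pexp2l.
  by rewrite expnS ltn_mul2r expn_gt0 /= ltnSn.
pose G (x : T) := \prod_i h i ^+ x i.
have Gdeg x : deg_le (G x) e.
  have hd i : deg_le (h i) dl.
    move=> nu /msize_mdeg_lt lt; apply: leq_trans (ltnW lt) _.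
    exact: (leq_bigmax i).
  move=> mu /(deg_le_prod (fun i => deg_leX (d := x i) (hd i)))/leq_trans; apply.
  rewrite -big_distrl leq_mul2r; apply/orP; right.
  apply: (@leq_trans (\sum_(i < d) D)); last by rewrite sum_nat_const card_ord.
  by apply: leq_sum => i _; rewrite -ltnS.
(* Rows are products, columns are codes of characters. More rows than columns give a nonzero
   combination of products that vanishes on [K]. *)
pose W : 'M[k]_(#|{: T}|, #|{: Phi}|) := \matrix_(i, j)
  \sum_(mu <- msupp (G (enum_val i)) | code e mu == enum_val j) (G (enum_val i))@_mu.
have GW i t : K t -> (G (enum_val i)).@[t 0] = \sum_j W i j * qchr rp (Val (enum_val j)) t.
  move=> Kt; have Dt := K_diag Kt; rewrite mpoly_chr //.
  under [RHS]eq_bigr do rewrite mxE mulr_suml.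
  rewrite (exchange_big_dep predT) //= big_seq [RHS]big_seq; apply: eq_bigr => mu muS.
  rewrite (bigD1 (enum_rank (code e mu))) /=; last by rewrite enum_rankK.
  rewrite big1 ?addr0 => [|j /andP[/eqP -> ]]; last by rewrite enum_valK eqxx.
  by rewrite enum_rankK code_val ?(qchr_pr K_diag rpK pr_eq0) // (Gdeg (enum_val i)).
have [v vW v0] : exists2 v : 'rV_(#|{: T}|), v *m W = 0 & v != 0.
  have : kermx W != 0.
    rewrite kermx_eq0 /row_free; apply: contraL lt_card => /eqP <-.
    by rewrite -leqNgt rank_leq_col.
  by case/rowV0Pn => v /sub_kermxP vW v0; exists v.
pose mm (x : T) : 'X_{1..d} := [multinom (x i : nat) | i < d].
pose P : {mpoly k[d]} := \sum_(x : T) v 0 (enum_rank x) *: 'X_[mm x].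
have P0 : P = 0.
  apply: hfree => t Kt; rewrite raddf_sum /=.
  transitivity (\sum_i v 0 i * (G (enum_val i)).@[t 0]).
    rewrite [RHS](reindex _ (onW_bij _ (enum_rank_bij T))) /=.
    apply: eq_bigr => x _; rewrite mevalZ mevalX enum_rankK rmorph_prod; congr (_ * _).
    by apply: eq_bigr => i _; rewrite mnmE rmorphXn.
  under eq_bigr do rewrite GW // mulr_sumr.
  rewrite exchange_big big1 // => j _ /=.
  have /rowP/(_ j) := vW; rewrite !mxE => E.
  under eq_bigr do rewrite mulrA.
  by rewrite -mulr_suml E mul0r.
case/eqP: v0; apply/rowP=> i; rewrite mxE.
have := congr1 (mcoeff (mm (enum_val i))) P0; rewrite mcoeff0 raddf_sum (bigD1 (enum_val i)) //=.
rewrite mcoeffZ mcoeffX eqxx mulr1 enum_valK big1 ?addr0 // => x ne.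
rewrite mcoeffZ mcoeffX; case: eqP => [e1|_]; last by rewrite mulr0.
case/eqP: ne; apply/ffunP=> l; apply/val_inj.
by have /mnmP/(_ l) := e1; rewrite !mnmE.
Qed.

End CountingCharacters.

(** * Diagonal actions *)

Section DiagonalMaps.
Variables (k : closedFieldType) (n : nat).
Implicit Types s : 'I_n -> k.

Lemma prod1_neq0 s : \prod_i s i = 1 -> forall i, s i != 0.
Proof.
move/eqP => s1 i; apply: contraTneq s1 => si.
by rewrite (bigD1 i) //= si mul0r eq_sym oner_eq0.
Qed.

Lemma comp_dmap s (p : polymap k n n) i : tnth (pcomp (dmap s) p) i = s i *: tnth p i.
Proof. by rewrite !tnth_mktuple comp_mpolyZ comp_mpolyXU -tnth_nth. Qed.

Lemma dmapM s s' : pcomp (dmap s) (dmap s') = dmap (fun i => s i * s' i).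
Proof.
apply: eq_from_tnth => i; rewrite comp_dmap !tnth_mktuple.
by rewrite scalerA.
Qed.

Lemma dmap1 s : (forall i, s i = 1) -> dmap s = pid k n.
Proof. by move=> s1; apply: eq_from_tnth => i; rewrite !tnth_mktuple s1 scale1r. Qed.

Lemma dmap_inverse s : (forall i, s i != 0) -> inverse_pair (dmap s) (dmap (fun i => (s i)^-1)).
Proof.
by move=> s0; split; rewrite dmapM dmap1 // => i; rewrite ?divff ?mulVf.
Qed.

Lemma jac_dmap s : jac (dmap s) = (\prod_i s i)%:MP.
Proof.
have := jac_pid k n; rewrite /jac => J1.
have -> : \matrix_(i, j) (tnth (dmap s) i)^`M(j) =
    diag_mx (\row_i (s i)%:MP) *m jacmx (pid k n).
  by apply/matrixP=> i j; rewrite mul_diag_mx !mxE !tnth_mktuple mderivZ mul_mpolyC.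
rewrite det_mulmx det_diag [X in _ * X]J1 mulr1 rmorph_prod.
by apply: eq_bigr => i _; rewrite mxE.
Qed.

Lemma inverse_pairC (g h : polymap k n n) : inverse_pair g h -> inverse_pair h g.
Proof. by case. Qed.

Lemma inverse_pair_comp (g h g' h' : polymap k n n) :
  inverse_pair g h -> inverse_pair g' h' -> inverse_pair (pcomp g g') (pcomp h' h).
Proof.
move=> [gh hg] [gh' hg']; split.
  by rewrite -pcompA [pcomp g' _]pcompA gh' pcomp1f.
by rewrite -pcompA [pcomp h _]pcompA hg pcomp1f.
Qed.

Lemma jac_inverse (g h : polymap k n n) : inverse_pair g h -> jac g = 1 -> jac h = 1.
Proof.
case=> gh hg Jg; have := jac_comp h g; rewrite hg jac_pid Jg mulr1 => e.
have := congr1 (comp_mpoly h) e; rewrite rmorph1 comp_mpolyA gh comp_mpoly_id.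
by move=> ->.
Qed.

End DiagonalMaps.

Lemma intr_inj_char0 (k : fieldType) : [pchar k] =i pred0 -> injective (intr : int -> k).
Proof.
move=> char0 x y /eqP; rewrite -subr_eq0 -rmorphB /= => h; apply/eqP.
rewrite -subr_eq0; move: (x - y) h => [] z; first by rewrite natr_eq0_char0.
by rewrite NegzE rmorphN oppr_eq0 /= natr_eq0_char0.
Qed.

Section DiagonalAction.
Variables (k : closedFieldType) (char0 : [pchar k] =i pred0).
Variables (r : nat) (K : 'rV[k]_(r + r) -> Prop).
Hypothesis K_closed : zariski_closed K.
Hypothesis K_diag : forall t, K t -> diag_set t.
Hypothesis K_one : K (const_mx 1).
Hypothesis K_mul : forall t s, K t -> K s -> K (tmul t s).
Variables (m : nat) (psi : 'rV[k]_(r + r) -> polymap k m.+1 m.+1).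
Variable F : polymap k (r + r + m.+1) m.+1.
Hypothesis psi1 : psi (const_mx 1) = pid k m.+1.
Hypothesis psiM : forall t s, K t -> K s -> psi (tmul t s) = pcomp (psi t) (psi s).
Hypothesis psiF : forall t a, K t -> peval (psi t) a = peval F (row_mx t a).
Hypothesis psiJ : forall t, K t -> jac (psi t) = 1.
Hypothesis psi_inj : forall t, K t -> psi t = pid k m.+1 -> t = const_mx 1.
Variable h : 'I_m -> {mpoly k[r + r]}.
Hypothesis h_free : alg_free K h.
Notation ik := (map_mx (intr : int -> k)).

Section Weights.
Variables (M : zmodType) (pr : {additive 'rV[int]_r -> M}) (rp : M -> 'rV[int]_r).
Hypothesis rpK : cancel rp pr.
Hypothesis pr_eq0 : forall e, pr e = 0 <-> trivial_chr K e.
Variables (rho : nat) (Delta : 'M[k]_(r, rho)).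
Hypothesis D_trivial : forall e, trivial_chr K e -> ik e *m Delta = 0.
Hypothesis D_free : forall c : 'cV_rho, Delta *m c = 0 -> c = 0.
Hypothesis D_basis : exists X : 'M[int]_(rho, r), \det (ik X *m Delta) != 0.
Hypothesis D_full : forall X : 'M[int]_(rho, r), \det (ik X *m Delta) != 0 ->
  exists2 N, (0 < N)%N & forall e, exists a : 'rV[int]_rho,
    trivial_chr K (e *+ N - a *m X).

Let Gr := act_grading char0 K_diag K_one K_mul rpK pr_eq0 psi1 psiM psiF psiJ.
(** Pairing of a weight with the j-th basis vector of the Lie algebra. *)
Definition wdl (j : 'I_rho) (q : M) : k := (ik (rp q) *m Delta) 0 j.

Let ikB s (x y : 'M[int]_(s, r)) : ik (x - y) = ik x - ik y.
Proof. by apply/matrixP=> i j; rewrite !mxE rmorphB. Qed.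

Let ikD s (x y : 'M[int]_(s, r)) : ik (x + y) = ik x + ik y.
Proof. by apply/matrixP=> i j; rewrite !mxE rmorphD. Qed.

Let ik0 s : ik (0 : 'M[int]_(s, r)) = 0.
Proof. by apply/matrixP=> i j; rewrite !mxE. Qed.

Let pr_comb s (a : 'rV[int]_s) (X : 'M[int]_(s, r)) : pr (a *m X) = \sum_i pr (row i X) *~ a 0 i.
Proof.
rewrite mulmx_sum_row raddf_sum; apply: eq_bigr => i _.
by rewrite -[a 0 i in LHS]intz scaler_int raddfMz.
Qed.

Let rp_Delta q e : pr e = q -> ik (rp q) *m Delta = ik e *m Delta.
Proof.
move=> <-; apply/eqP; rewrite -subr_eq0 -mulmxBl -ikB; apply/eqP/D_trivial.
by apply/pr_eq0; rewrite raddfB rpK subrr.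
Qed.

Lemma wdlD j q q' : wdl j (q + q') = wdl j q + wdl j q'.
Proof.
have e : pr (rp q + rp q') = q + q' by rewrite raddfD !rpK.
by rewrite /wdl (rp_Delta e) ikD mulmxDl mxE.
Qed.

(** Suppose [c] is orthogonal to all weights of the variables but the entry [lam] of [Delta *m c] is
    nonzero. Sending each character that pairs to a * lam to 2^a is a partial homomorphism, realized
    by a [t] in [K]. This [t] acts trivially, so t = 1, although its coordinate [l] is 2. *)
Lemma wdl_faithful (c : 'cV[k]_rho) :
  (forall i w, gr_pi Gr w 'X_i != 0 -> \sum_j wdl j w * c j 0 = 0) -> c = 0.
Proof.
move=> hc; apply: D_free; apply/colP=> l; rewrite [RHS]mxE.
apply/eqP/negPn/negP => l0; set lam := (Delta *m c) l 0 in l0.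
pose ev (x : 'rV[int]_r) : k := (ik x *m Delta *m c) 0 0.
have evB x y : ev (x - y) = ev x - ev y.
  by rewrite /ev ikB !mulmxBl !mxE.
pose R (x : 'rV[int]_r) (y : k) := exists2 a : int, ev x = a%:~R * lam & y = 2%:R ^ a.
have two0 : 2%:R != 0 :> k by rewrite natr_eq0_char0.
have HR : phom R.
  split.
  - by exists 0; rewrite ?expr0z // mul0r /ev ik0 !mul0mx mxE.
  - by move=> x _ [a _ ->]; rewrite expfz_neq0.
  - move=> x _ x' _ [a e ->] [a' e' ->]; exists (a - a').
      by rewrite evB e e' rmorphB /= mulrBl.
    by rewrite expfzDr // -invr_expz.
  - move=> _ [a + ->]; rewrite /ev ik0 !mul0mx mxE => /esym/eqP.
    rewrite mulf_eq0 (negPf l0) orbF -[0]/(0%:~R) => /eqP/(intr_inj_char0 char0) ->.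
    by rewrite expr0z.
have [t Kt tE] : exists2 t, K t & forall e y, R e y -> chr e t = y.
  apply: (mem_chr_ext K_closed K_diag K_one K_mul rpK pr_eq0 HR) => e Le.
  by exists 0; rewrite ?expr0z // mul0r /ev D_trivial // mul0mx mxE.
have t1 : t = const_mx 1.
  apply: psi_inj => //; apply: eq_from_tnth => i; rewrite tnth_mktuple.
  have := act_sum char0 K_diag rpK pr_eq0 psiF 'X_i Kt.
  rewrite comp_mpolyXU -tnth_nth => ->.
  rewrite [RHS](gr_supp_sum Gr); apply: eq_bigr => w _.
  have [w0|w0] := eqVneq (act_pi pr F w 'X_i) 0.
    by rewrite w0 scaler0; symmetry; exact: w0.
  rewrite [qchr rp w t](tE (rp w) 1) ?scale1r //.
  exists 0; rewrite ?expr0z // mul0r /ev -(hc i w w0) mxE.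
  by apply: eq_bigr.
have d1 : chr (delta_mx 0 l) t = 2%:R.
  apply: tE; exists 1; rewrite ?expr1z // mul1r /ev -mulmxA.
  by have -> : ik (delta_mx 0 l) = delta_mx 0 l :> 'rV[k]_r;
    [apply/matrixP=> i j; rewrite !mxE; case: (_ && _) | rewrite -rowE mxE].
move: d1; rewrite t1 /chr big1 => [/eqP|j _]; last by rewrite mxE exp1rz.
by rewrite mulr2n -subr_eq0 opprD addNKr oppr_eq0 oner_eq0.
Qed.

(** The weights of a tuple of total weight 0 form a matrix with [m.+1] rows and rank [rho] whose
    rows sum to 0. *)
Lemma rank_weights_le : (rho <= m)%N.
Proof.
have [y [w [hy w0 Ja]]] := exists_tuple_at Gr (fun=> 0).
have J0 : jac y != 0 by apply: contraNneq Ja => ->; rewrite meval0.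
have Wfree : row_free (wmx wdl w)^T.
  apply: inj_row_free => v /(congr1 trmx); rewrite trmx_mul trmxK trmx0.
  move/(wmx_inj wdlD hy wdl_faithful J0)/(congr1 trmx).
  by rewrite trmxK trmx0.
rewrite -ltnS -(eqP Wfree) mxrank_tr ltn_neqAle rank_leq_row andbT.
apply/negP => /row_free_inj/(_ (const_mx 1 : 'rV_m.+1) 0) inj.
have /rowP/(_ 0)/eqP : const_mx 1 = 0 :> 'rV[k]_m.+1.
  apply: inj; rewrite mul0mx; apply/rowP=> j; rewrite !mxE.
  under eq_bigr do rewrite !mxE mul1r.
  by rewrite -(dl_sum wdlD) w0 (dl0 wdlD).
by rewrite !mxE oner_eq0.
Qed.

Lemma weights_full (w : 'I_rho -> M) : \det (\matrix_(i, j) wdl j (w i)) != 0 ->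
  forall w0, exists N, exists2 a : 'I_rho -> int, (0 < N)%N & w0 *+ N = \sum_i w i *~ a i.
Proof.
move=> d0 w0; have [|N N0 /(_ (rp w0))[a]] := @D_full (\matrix_i rp (w i)).
  apply: contraNneq d0 => <-; apply/eqP; congr (\det _).
  by apply/matrixP=> i j; rewrite /wdl !mxE; apply: eq_bigr => l _; rewrite !mxE.
move/pr_eq0/eqP; rewrite raddfB raddfMn rpK subr_eq0 => /eqP E.
exists N, (a 0) => //; rewrite E pr_comb.
by apply: eq_bigr => i _; rewrite rowK rpK.
Qed.

(** The dimension of the group enters here, through [m] algebraically independent functions on [K],
    whose number is bounded by counting characters. *)
Lemma rank_weights_ge : (m <= rho)%N.
Proof.
have [X /D_full[N N0 hN]] := D_basis.
have /fin_all_exists[a ha] (i : 'I_(r + r)) := hN (wexp U_(i)%MM).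
apply: (@alg_free_bound k r K K_diag M pr rp rpK pr_eq0 rho N (fun j => pr (row j X))
  (fun i => a i 0) N0 _ m h h_free) => i.
have /pr_eq0/eqP := ha i; rewrite raddfB raddfMn subr_eq0 => /eqP ->.
exact: pr_comb.
Qed.

End Weights.

Lemma diag_coordinates (M : zmodType) (pr : {additive 'rV[int]_r -> M}) (rp : M -> 'rV[int]_r)
    (rpK : cancel rp pr) (pr_eq0 : forall e, pr e = 0 <-> trivial_chr K e) :
  exists (g gi : polymap k m.+1 m.+1) (w : 'I_m.+1 -> M),
  [/\ inverse_pair g gi, forall i, semi_inv K rp psi (w i) (tnth g i), \sum_i w i = 0 &
    forall a : 'rV[int]_m, trivial_chr K (a *m (\matrix_i rp (w (lift 0 i)))) -> a = 0].
Proof.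
have [rho [Delta [D1 D2 D3 D4]]] := char_weights K_diag.
have e : rho = m.
  apply/eqP; rewrite eqn_leq (rank_weights_le rpK pr_eq0 D1 D2) /=.
  exact: (rank_weights_ge rpK pr_eq0 D3 D4).
subst rho.
have [g [gi [w [ggi gw w0 d0]]]] := linear_coordinates char0 (wdlD rpK pr_eq0 D1)
  (wdl_faithful (rpK := rpK) (pr_eq0 := pr_eq0) D1 D2) (weights_full rpK pr_eq0 D4).
exists g, gi, w; split=> //.
- by move=> i; apply/(act_pi_fixP char0 K_diag K_one K_mul rpK pr_eq0 psiM psiF)/gw.
move=> a /D1 aD; apply/rowP=> i; apply: (intr_inj_char0 char0).
pose W : 'M[k]_m := \matrix_(i, j) wdl rp Delta j (w (lift 0 i)).
have Wu : W \in unitmx by rewrite unitmxE unitfE.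
have : ik a *m W = 0.
  rewrite -aD (map_mxM (intr : {rmorphism int -> k})) -mulmxA; congr (_ *m _).
  by apply/matrixP=> i' j; rewrite /W [RHS]mxE /wdl !mxE; apply: eq_bigr => l _; rewrite !mxE.
by move/(congr1 (mulmx^~ (invmx W))); rewrite mulmxK // mul0mx => /rowP/(_ i); rewrite !mxE.
Qed.

Theorem diagonal_action_conjugate : exists g gi : polymap k m.+1 m.+1,
  [/\ is_aut_star g, inverse_pair g gi,
    forall t, K t -> exists2 s : 'I_m.+1 -> k, \prod_i s i = 1 &
      psi t = pcomp g (pcomp (dmap s) gi) &
    forall s : 'I_m.+1 -> k, \prod_i s i = 1 -> exists2 t, K t &
      psi t = pcomp g (pcomp (dmap s) gi)].
Proof.
have [M [pr [rp [rpK pr_eq0]]]] := @classical_quotient 'rV[int]_r (trivial_chr K)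
  (@trivial_chr0 k r K) (@trivial_chrB k r K K_diag).
have [g [gi [w [ggi gw w0 indep]]]] := diag_coordinates rpK pr_eq0.
have [c c0 Jg] := inverse_pair_jac ggi.
(* Dividing the first coordinate by the constant Jacobian makes the Jacobian 1. *)
pose s0 i : k := if i == 0 :> 'I_m.+1 then c^-1 else 1.
have s0n i : s0 i != 0 by rewrite /s0; case: ifP; rewrite ?invr_eq0 ?oner_eq0.
pose gi1 := pcomp (dmap s0) g; pose g1 := pcomp gi (dmap (fun i => (s0 i)^-1)).
have inv1 : inverse_pair gi1 g1 by apply: inverse_pair_comp => //; apply: dmap_inverse.
have Jgi1 : jac gi1 = 1.
  rewrite jac_comp jac_dmap Jg big_ord_recl /s0 eqxx big1 ?mulr1 // comp_mpolyC.
  by rewrite -rmorphM /= mulVf.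
have conj t : K t -> psi t = pcomp g1 (pcomp (dmap (fun i => qchr rp (w i) t)) gi1).
  move=> Kt; have -> : pcomp (dmap (fun i => qchr rp (w i) t)) gi1 = pcomp gi1 (psi t).
    apply: eq_from_tnth => i; rewrite comp_dmap [RHS]tnth_mktuple /gi1 comp_dmap.
    by rewrite comp_mpolyZ (gw i t Kt) !scalerA mulrC.
  by rewrite pcompA (proj2 inv1) pcomp1f.
have prod1 t : K t -> \prod_i qchr rp (w i) t = 1.
  by move=> Kt; rewrite -(qchr_sum K_diag rpK pr_eq0) // w0 (qchr0 K_diag rpK pr_eq0).
exists g1, gi1; split.
- split; first by exists gi1; apply: inverse_pairC.
  exact: jac_inverse inv1 Jgi1.
- exact: inverse_pairC.
- by move=> t Kt; exists (fun i => qchr rp (w i) t); [exact: prod1|exact: conj].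
move=> s s1; have sn := prod1_neq0 s1.
set X := \matrix_i _ in indep.
(* Prescribe the values of [s] on all weights but the first; this is consistent because these
   weights are independent. The value on the first is then forced, both products being 1. *)
pose R (x : 'rV[int]_r) (y : k) := exists2 a : 'rV[int]_m,
  trivial_chr K (x - a *m X) & y = \prod_i s (lift 0 i) ^ a 0 i.
have HR : phom R.
  split.
  - exists 0; first by rewrite mul0mx subr0; apply: trivial_chr0.
    by rewrite big1 // => i _; rewrite mxE expr0z.
  - by move=> x _ [a _ ->]; apply/prodf_neq0 => i _; rewrite expfz_neq0.
  - move=> x _ x' _ [a e ->] [a' e' ->]; exists (a - a').
      have -> : x - x' - (a - a') *m X = (x - a *m X) - (x' - a' *m X).
        by rewrite mulmxBl !opprB addrACA [RHS]addrACA; congr (_ + _); rewrite addrC.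
      exact: trivial_chrB.
    rewrite -prodf_div; apply: eq_bigr => i _.
    by rewrite !mxE expfzDr // -invr_expz.
  - move=> _ [a + ->]; rewrite sub0r -mulNmx => /indep/eqP; rewrite oppr_eq0 => /eqP ->.
    by rewrite big1 // => i _; rewrite mxE expr0z.
have [t Kt tE] : exists2 t, K t & forall e y, R e y -> chr e t = y.
  apply: (mem_chr_ext K_closed K_diag K_one K_mul rpK pr_eq0 HR) => e Le.
  exists 0; first by rewrite mul0mx subr0.
  by rewrite big1 // => i _; rewrite mxE expr0z.
exists t; first exact: Kt.
rewrite (conj t Kt); suff -> : dmap (fun i => qchr rp (w i) t) = dmap s by [].
have tw i : qchr rp (w (lift 0 i)) t = s (lift 0 i).
  apply: tE; exists (delta_mx 0 i).
    by rewrite -rowE rowK subrr; apply: trivial_chr0.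
  rewrite (bigD1 i) //= mxE !eqxx expr1z big1 ?mulr1 // => j ji.
  by rewrite mxE (negPf ji) andbF expr0z.
apply: eq_from_tnth => i; rewrite !tnth_mktuple; suff -> : qchr rp (w i) t = s i by [].
have [j ->|->] := unliftP 0 i; first exact: tw.
have := prod1 t Kt; rewrite big_ord_recl; under eq_bigr do rewrite tw.
move: s1; rewrite big_ord_recl => {}s1 E; apply: (mulIf _ (etrans E (esym s1))).
by apply/prodf_neq0 => j _; apply: sn.
Qed.

End DiagonalAction.

(** * Conjugating a subgroup to the torus *)

Section Conjugacy.
Variables (k : closedFieldType) (char0 : [pchar k] =i pred0) (m : nat).

Lemma diag_mul_tmul r (t s : 'rV[k]_(r + r)) : peval (diag_mul k r) (row_mx t s) = tmul t s.
Proof. by apply/rowP=> i; rewrite diag_mulE mxE. Qed.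

Lemma inverse_pair_idem n (g : polymap k n n) : is_aut g -> pcomp g g = g -> g = pid k n.
Proof.
case=> gi [ggi gig] gg; have := congr1 (pcomp gi) gg.
by rewrite pcompA gig pcomp1f.
Qed.

(** The action is transported from [G] to its diagonal model [K], and so are the independent
    functions given by a chain of length [m] in [G]. *)
Lemma conjugate_to_Dstar (H : polymap k m.+1 m.+1 -> Prop) :
  (forall g, H g -> is_aut_star g) -> diagonalizable_subgroup_of_dim H m ->
  conjugate_in_aut_star H (@Dstar k m.+1).
Proof.
move=> Haut [G [[phi [[phi_aut phiM [F phiF]] Himg phi_inj]] [r [Kc iso]] [[C hC] _]]].
have [f [h [fK hG hf fh fM]]] := iso.
pose K : 'rV[k]_(r + r) -> Prop := @cs_set k (diag_group k r) Kc.
pose psi (t : 'rV[k]_(r + r)) := phi (peval h t).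
have K_one : K (const_mx 1) := cs_one_in Kc.
have K_mul t s : K t -> K s -> K (tmul t s).
  by rewrite -diag_mul_tmul; apply: (@cs_op_in k (diag_group k r) Kc).
have hM t s : K t -> K s -> peval h (tmul t s) = ag_op (peval h t) (peval h s).
  move=> Kt Ks; have Gt := hG t Kt; have Gs := hG s Ks.
  rewrite -[RHS](hf _ (ag_op_in Gt Gs)) (fM _ _ Gt Gs) (fh t Kt) (fh s Ks).
  by rewrite -diag_mul_tmul.
have psiM t s : K t -> K s -> psi (tmul t s) = pcomp (psi t) (psi s).
  by move=> Kt Ks; rewrite /psi hM // phiM //; apply: hG.
have psi1 : psi (const_mx 1) = pid k m.+1.
  apply: inverse_pair_idem; first by apply: phi_aut; apply: hG.
  rewrite -psiM //; congr psi; apply/rowP=> i; rewrite !mxE mulr1 //.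
(* The morphism (t, a) to (h(t), a), which turns the action morphism of [G] into one of [K]. *)
pose hh : polymap k (r + r + m.+1) (ag_emb G + m.+1) :=
  [tuple match split i with
         | inl j => tnth h j \mPo [tuple 'X_(lshift m.+1 l) | l < r + r]
         | inr j => 'X_(rshift (r + r) j) end | i < ag_emb G + m.+1].
have psiF t a : K t -> peval (psi t) a = peval (pcomp F hh) (row_mx t a).
  move=> Kt; rewrite /psi phiF; last exact: hG.
  rewrite peval_comp; congr (peval F _); apply/rowP=> i; rewrite [RHS]mxE tnth_mktuple mxE.
  case: (split i) => j; rewrite ?mevalXU ?row_mxEr //.
  rewrite comp_mpoly_meval mxE; apply: meval_eq => l.
  by rewrite tnth_mktuple mevalXU row_mxEl.
have psiH t : K t -> H (psi t) by move=> Kt; apply/Himg; exists (peval h t) => //; apply: hG.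
have psiJ t : K t -> jac (psi t) = 1 by move=> /psiH/Haut[].
have psi_inj t : K t -> psi t = pid k m.+1 -> t = const_mx 1.
  move=> Kt; rewrite -psi1 => /phi_inj e.
  by rewrite -(fh t Kt) -(fh _ K_one) e //; apply: hG.
have [g gfree] := chain_alg_free hC.
have hfree : alg_free K (fun i => g i \mPo h).
  move=> P PK; apply: gfree => x Gx; have Kx := fK x Gx; rewrite -[RHS](PK _ Kx).
  apply: meval_eq => i; rewrite comp_mpoly_meval; apply: meval_eq => j.
  by rewrite -[in LHS](hf x Gx) mxE.
have K_diag t : K t -> diag_set t := @cs_sub k (diag_group k r) Kc t.
have [u [ui [u_aut uui sub sur]]] := diagonal_action_conjugate char0 (cs_closed Kc)
  K_diag K_one K_mul psi1 psiM psiF psiJ psi_inj hfree.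
have Hpsi q : H q <-> exists2 t, K t & q = psi t.
  split=> [/Himg[x Gx ->]|[t Kt ->]]; last exact: psiH.
  by exists (peval f x); [apply: fK|rewrite /psi hf].
exists u, ui; split=> // q; split=> [/Hpsi[t Kt ->]|[d [t [t1 ->]] ->]].
  have [s s1 ->] := sub t Kt; exists (dmap s) => //; exists (\row_i s i).
  split; first by rewrite -[RHS]s1; apply: eq_bigr => i _; rewrite mxE.
  by apply: eq_from_tnth => i; rewrite !tnth_mktuple mxE.
by apply/Hpsi; have [t' Kt' <-] := sur _ t1; exists t'.
Qed.

End Conjugacy.

(** * The diagonal torus *)

Section SubtorusChain.
Variables (k : closedFieldType) (char0 : [pchar k] =i pred0) (m : nat).
Implicit Types (v : 'I_m -> k) (x : 'rV[k]_(m + m)).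

(** The first [i] coordinates are free; these subtori form the chain that bounds the dimension from
    below. *)
Definition subtorus i x := diag_set x /\ forall j : 'I_m, (i <= j)%N -> x 0 (lshift m j) = 1.

Definition subtorus_pt i v : 'rV[k]_(m + m) :=
  row_mx (\row_j (if (j < i)%N then v j else 1)) (\row_j (if (j < i)%N then (v j)^-1 else 1)).

Lemma subtorus_pt_in i v : (forall j, v j != 0) -> subtorus i (subtorus_pt i v).
Proof.
move=> v0; split=> j; rewrite row_mxEl ?row_mxEr !mxE; case: ltnP => //.
  by rewrite divff.
by rewrite mulr1.
Qed.

Lemma subtorus_ptK i x : subtorus i x -> x = subtorus_pt i (fun j => x 0 (lshift m j)).
Proof.
case=> Dx x1; apply: diag_eq => // [|j].
  by apply: (proj1 (subtorus_pt_in _ _)) => j; apply: diag_coord_neq0.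
by rewrite row_mxEl mxE; case: ltnP => // /x1.
Qed.

Lemma meval_prodX v : (\prod_(j < m) 'X_j).@[v] = \prod_j v j.
Proof. by rewrite rmorph_prod; apply: eq_bigr => j _; apply: mevalXU. Qed.

(* On a torus every polynomial function is a polynomial in the coordinates up to
   a power of their product. *)
Lemma subtorus_pt_poly i (p : {mpoly k[m + m]}) : exists N (P : {mpoly k[m]}), forall v,
  (forall j, v j != 0) -> P.@[v] = p.@[subtorus_pt i v 0] * (\prod_j v j) ^+ N.
Proof.
elim/mpoly_alg_ind: p => [c|j|p q [N [P PE]] [N' [P' PE']]|p q [N [P PE]] [N' [P' PE']]].
- by exists 0, c%:MP => v _; rewrite !mevalC expr0 mulr1.
- rewrite -[j]splitK; case: (split j) => l /=.
    exists 0, (if (l < i)%N then 'X_l else 1) => v _.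
    rewrite mevalXU row_mxEl mxE expr0 mulr1; case: ifP => _; [exact: mevalXU|exact: meval1].
  exists 1%N, (if (l < i)%N then \prod_(j' | j' != l) 'X_j' else \prod_j' 'X_j') => v v0.
  rewrite mevalXU row_mxEr mxE expr1; case: ifP => _; rewrite rmorph_prod /=.
    rewrite [in RHS](bigD1 l) //= mulKf //; by apply: eq_bigr => j' _; rewrite mevalXU.
  by rewrite mul1r; apply: eq_bigr => j' _; rewrite mevalXU.
- exists (N + N')%N, (P * (\prod_j 'X_j) ^+ N' + P' * (\prod_j 'X_j) ^+ N) => v v0.
  rewrite !mevalD !mevalM !rmorphXn /= !meval_prodX PE // PE' // mulrDl exprD.
  by congr (_ + _); rewrite -mulrA // [X in _ * X]mulrC.
- exists (N + N')%N, (P * P') => v v0; rewrite !mevalM PE // PE' // exprD.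
  by rewrite mulrACA.
Qed.

Lemma subtorus_closed i : zariski_closed (subtorus i).
Proof.
exists (fun p => (exists j : 'I_m, p = 'X_(lshift m j) * 'X_(rshift m j) - 1) \/
  exists2 j : 'I_m, (i <= j)%N & p = 'X_(lshift m j) - 1).
move=> x; split=> [[Dx x1] p [[j ->]|[j ij ->]]|h].
- by rewrite mevalB mevalM !mevalXU meval1 Dx subrr.
- by rewrite mevalB mevalXU meval1 x1 // subrr.
split=> [j|j ij]; apply/eqP; rewrite -subr_eq0; apply/eqP.
  have := h _ (or_introl (ex_intro _ j erefl)).
  by rewrite mevalB mevalM !mevalXU meval1.
have := h _ (or_intror (ex_intro2 _ _ j ij erefl)).
by rewrite mevalB mevalXU meval1.
Qed.

(** A closed set not containing the subtorus meets it, in the coordinates [v], within the zeros of a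
    nonzero polynomial. If two such sets covered it, the product of their polynomials and of all
    coordinates would vanish identically. *)
Lemma subtorus_irreducible i : irreducible_set (subtorus i).
Proof.
split; first by exists (subtorus_pt i (fun=> 1)); apply: subtorus_pt_in => j; apply: oner_neq0.
have nonvan (Y : 'rV[k]_(m + m) -> Prop) : zariski_closed Y -> ~ subset_of (subtorus i) Y ->
    exists2 P : {mpoly k[m]}, P != 0 & forall v, (forall j, v j != 0) ->
      Y (subtorus_pt i v) -> P.@[v] = 0.
  move=> [I YI] nY; have [x [Cx nYx]] : exists x, subtorus i x /\ ~ Y x.
    by apply: NNPP => h; apply: nY => x Cx; apply: NNPP => nYx; apply: h; exists x.
  have [p [Ip px]] : exists p, I p /\ p.@[x 0] <> 0.
    by apply: NNPP => h; apply/nYx/YI => p Ip; apply: NNPP => px; apply: h; exists p.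
  have [N [P PE]] := subtorus_pt_poly i p.
  exists P => [|v v0 /YI/(_ p Ip) pv]; last by rewrite PE // pv mul0r.
  apply/eqP => P0; apply: px; apply/eqP; move: P0.
  have v0 j : x 0 (lshift m j) != 0 by apply: diag_coord_neq0; case: Cx.
  move/(congr1 (meval (fun j => x 0 (lshift m j)))); rewrite PE // -subtorus_ptK // meval0.
  move/eqP; rewrite mulf_eq0 => /orP[//|]; apply: contraLR => _.
  by rewrite expf_neq0 //; apply/prodf_neq0 => j _.
move=> Y Z Ycl Zcl YZ; apply: NNPP => /not_or_and[/(nonvan _ Ycl)[P P0 PY] /(nonvan _ Zcl)[Q Q0 QZ]].
have X0 : \prod_(j < m) 'X_j != 0 :> {mpoly k[m]}.
  apply/prodf_neq0 => j _; apply/eqP => /(congr1 (meval (fun=> 1))).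
  by rewrite mevalXU meval0; apply/eqP/oner_neq0.
have [v] : exists v, (P * Q * \prod_(j < m) 'X_j).@[v] != 0.
  by apply: mpoly_nonroot => //; rewrite !mulf_neq0.
rewrite !mevalM rmorph_prod /= !mulf_eq0 !negb_or => /andP[/andP[Pv Qv] /prodf_neq0 v0].
have {}v0 j : v j != 0 by have := v0 j isT; rewrite mevalXU.
by case: (YZ _ (subtorus_pt_in i v0)) => [/(PY _ v0)/eqP|/(QZ _ v0)/eqP]; apply/negP.
Qed.

Lemma subtorus_chain : irreducible_chain (@diag_set k m) m subtorus.
Proof.
split=> i im; first by split; [exact: subtorus_closed|exact: subtorus_irreducible|move=> x []].
split=> [x [Dx x1]|sub]; first by split=> // j ij; apply: x1; apply: ltnW.
have two0 (j : 'I_m) : 2%:R != 0 :> k by rewrite natr_eq0_char0.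
have [_ /(_ (Ordinal im) (leqnn i))] := sub _ (subtorus_pt_in i.+1 two0).
rewrite row_mxEl mxE ltnSn => /eqP.
by rewrite mulr2n -subr_eq0 addrK oner_eq0.
Qed.

(** The upper bound is [alg_free_bound] with N = 1, as the unit vectors generate all characters. *)
Lemma diag_set_dim : has_dim (@diag_set k m) m.
Proof.
split; first by exists subtorus; apply: subtorus_chain.
move=> e C /chain_alg_free[g]; have Dt t : @diag_set k m t -> diag_set t by [].
have [M [pr [rp [rpK pr_eq0]]]] := @classical_quotient 'rV[int]_m (trivial_chr (@diag_set k m))
  (@trivial_chr0 k m _) (@trivial_chrB k m _ Dt).
apply: (@alg_free_bound k m _ Dt M pr rp rpK pr_eq0 m 1 (fun j => pr (delta_mx 0 j))
  (fun i j => wexp U_(i)%MM 0 j)) => // i.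
rewrite mulr1n [in LHS](row_sum_delta (wexp U_(i)%MM)) raddf_sum; apply: eq_bigr => j _.
by rewrite -[wexp _ 0 j in LHS]intz scaler_int raddfMz.
Qed.

End SubtorusChain.

Section DiagonalTorus.
Variables (k : closedFieldType) (char0 : [pchar k] =i pred0).

Lemma Dstar_aut_star n (g : polymap k n n) : Dstar g -> is_aut_star g.
Proof.
case=> t [t1 ->]; have t0 := prod1_neq0 t1.
split; last by rewrite (jac_dmap (t 0)) t1.
by exists (dmap (fun i => (t 0 i)^-1)); apply: dmap_inverse.
Qed.

Variable m : nat.
Implicit Types x y : 'rV[k]_(m + m).

(** The first coordinate is the inverse of the product of the others, expressed through the stored
    inverses so that it is polynomial. *)
Definition torus_coord x (i : 'I_m.+1) : k :=
  if unlift 0 i is Some j then x 0 (lshift m j) else \prod_j x 0 (rshift m j).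

Lemma torus_coord0 x : torus_coord x 0 = \prod_j x 0 (rshift m j).
Proof. by rewrite /torus_coord unlift_none. Qed.

Lemma torus_coord_lift x j : torus_coord x (lift 0 j) = x 0 (lshift m j).
Proof. by rewrite /torus_coord liftK. Qed.

Lemma prod_torus_coord x : diag_set x -> \prod_i torus_coord x i = 1.
Proof.
move=> Dx; rewrite big_ord_recl torus_coord0 -big_split /= big1 // => j _.
by rewrite torus_coord_lift mulrC Dx.
Qed.

Lemma torus_coord_neq0 x i : diag_set x -> torus_coord x i != 0.
Proof. by move/prod_torus_coord/prod1_neq0. Qed.

Lemma torus_coordM x y i : torus_coord (tmul x y) i = torus_coord x i * torus_coord y i.
Proof.
rewrite /torus_coord; case: (unlift 0 i) => [j|]; first by rewrite mxE.
by rewrite -big_split; apply: eq_bigr => j _; rewrite mxE.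
Qed.

Lemma dmap_inj n (s s' : 'I_n -> k) : dmap s = dmap s' -> s =1 s'.
Proof.
move=> e i; have /(congr1 (fun g => (tnth g i).@[fun=> 1])) := e.
by rewrite !tnth_mktuple !mevalZ !mevalXU !mulr1.
Qed.

Lemma Dstar_diagonalizable : diagonalizable_subgroup_of_dim (@Dstar k m.+1) m.
Proof.
exists (diag_group k m); split; last exact: diag_set_dim.
  exists (fun x => dmap (torus_coord x)); split.
  - split=> [x Dx|x y _ _|].
    + by exists (dmap (fun i => (torus_coord x i)^-1)); apply: dmap_inverse => i; apply: torus_coord_neq0.
    + rewrite dmapM; apply: eq_from_tnth => i; rewrite !tnth_mktuple.
      by rewrite -torus_coordM -diag_mul_tmul.
    exists [tuple (if unlift 0 i is Some j then 'X_(lshift m.+1 (lshift m j))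
      else \prod_j 'X_(lshift m.+1 (rshift m j))) * 'X_(rshift (m + m) i) | i < m.+1].
    move=> x a _; apply/rowP=> i; rewrite !mxE !tnth_mktuple mevalZ mevalM !mevalXU row_mxEr.
    rewrite /torus_coord; case: (unlift 0 i) => [j|]; first by rewrite mevalXU row_mxEl.
    by rewrite rmorph_prod; congr (_ * _); apply: eq_bigr => j _; rewrite /= mevalXU row_mxEl.
  - move=> g; split=> [[t [t1 ->]]|[x Dx ->]]; last first.
      exists (\row_i torus_coord x i); split.
        by rewrite -[RHS](prod_torus_coord Dx); apply: eq_bigr => i _; rewrite mxE.
      by apply: eq_from_tnth => i; rewrite !tnth_mktuple mxE.
    have t0 := prod1_neq0 t1.
    exists (row_mx (\row_j t 0 (lift 0 j)) (\row_j (t 0 (lift 0 j))^-1)).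
      by move=> j; rewrite row_mxEl row_mxEr !mxE divff.
    apply: eq_from_tnth => i; rewrite !tnth_mktuple; congr (_ *: _).
    have [j ->|->] := unliftP 0 i; first by rewrite torus_coord_lift row_mxEl mxE.
    rewrite torus_coord0; under eq_bigr do rewrite row_mxEr mxE.
    by rewrite prodfV; move: t1; rewrite big_ord_recl => /(canRL (mulfK _)) -> //; 
      [rewrite mul1r|apply/prodf_neq0].
  - move=> x y Dx Dy /dmap_inj e; apply: diag_eq => // j.
    by rewrite -!torus_coord_lift.
exists m, (@ClosedSubgroup k (diag_group k m) (@diag_set k m) (@diag_closed k m)
  (fun _ Dx => Dx) (@diag_one_in k m) (@diag_op_in k m) (@diag_inv_in k m)).
have pidE x : peval (pid k (m + m)) x = x.
  by apply/rowP=> i; rewrite mxE tnth_mktuple mevalXU.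
by exists (pid k (m + m)), (pid k (m + m)); split=> [x|x|x _|x _|x y _ _] /=; rewrite ?pidE.
Qed.

End DiagonalTorus.

Theorem theorem12 (k : closedFieldType) (char0 : [pchar k] =i pred0)
    (n : nat) (n_gt0 : (0 < n)%N) :
  ((forall g, @Dstar k n g -> is_aut_star g) /\
   diagonalizable_subgroup_of_dim (@Dstar k n) n.-1) /\
  (forall H : polymap k n n -> Prop,
     (forall g, H g -> is_aut_star g) ->
     diagonalizable_subgroup_of_dim H n.-1 ->
     conjugate_in_aut_star H (@Dstar k n)).
Proof.
case: n n_gt0 => // m _; split; last by move=> H; apply: conjugate_to_Dstar.
by split; [exact: Dstar_aut_star|exact: Dstar_diagonalizable].
Qed.
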